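(* Let $0<\alpha<\frac19$, let $\beta_1,\beta_2,\dots\in(0,\alpha]$, let $\phi\in C^1([0,1])$, and put $S_n=\sum_{k=1}^n\phi_k\circ\mathcal T^k$ and $\sigma_n^2=\int S_n^2\,dm$. Suppose there are $c>0$ and $\beta>\frac{1}{2(1-2\alpha)}$ such that $\sigma_n^2\ge c\,n^\beta$ for all sufficiently large $n$. Then $S_n/\sigma_n$ converges in distribution (with respect to $m$) to the standard normal law, i.e. $m\big(\{x: S_n(x)/\sigma_n\le t\}\big)\to\frac{1}{\sqrt{2\pi}}\int_{-\infty}^te^{-s^2/2}ds$ for every $t\in\mathbb R$.
   Context: For $0<\gamma<1$ let $T_\gamma(x)=x+2^\gamma x^{1+\gamma}$ on $[0,1/2]$ and $T_\gamma(x)=2x-1$ on $(1/2,1]$. $m$ is Lebesgue measure on $[0,1]$. For a sequence $\beta_k$ write $T_k=T_{\beta_k}$ and $\mathcal T^n=T_n\circ\cdots\circ T_1$. For $\phi\in C^1([0,1])$ put $\phi_k=\phi-\int\phi\circ\mathcal T^k\,dm$ for $k\ge1$. *)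

(* Defs.v *)
From Stdlib Require Import Reals Lra ClassicalEpsilon.
Open Scope R_scope.

(* Riemann integral over [a,b] of f (unspecified if f is not Riemann integrable;
   all integrands used below are bounded with finitely many discontinuities,
   hence Riemann integrable). *)
Definition RI (f : R -> R) (a b : R) : R :=
  epsilon (inhabits 0)
    (fun v => exists pr : Riemann_integrable f a b, RiemannInt pr = v).

(* x^y for x >= 0, y > 0, with 0^y = 0 *)
Definition rpow (x y : R) : R := if Req_EM_T x 0 then 0 else Rpower x y.

Definition Tmap (g x : R) : R :=
  if Rle_dec x (1/2) then x + rpow 2 g * rpow x (1 + g) else 2 * x - 1.

Fixpoint Tcomp (beta : nat -> R) (n : nat) (x : R) : R :=
  match n with
  | O => x
  | S k => Tmap (beta (S k)) (Tcomp beta k x)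
  end.

Definition phik (beta : nat -> R) (phi : R -> R) (k : nat) (x : R) : R :=
  phi x - RI (fun y => phi (Tcomp beta k y)) 0 1.

Fixpoint Sn (beta : nat -> R) (phi : R -> R) (n : nat) (x : R) : R :=
  match n with
  | O => 0
  | S k => Sn beta phi k x + phik beta phi (S k) (Tcomp beta (S k) x)
  end.

Definition sigma2 (beta : nat -> R) (phi : R -> R) (n : nat) : R :=
  RI (fun x => (Sn beta phi n x) ^ 2) 0 1.

Definition C1_01 (phi : R -> R) : Prop :=
  exists dphi : R -> R,
    (forall x, 0 <= x <= 1 ->
       limit1_in (fun y => (phi y - phi x) / (y - x))
                 (fun y => 0 <= y <= 1 /\ y <> x) (dphi x) x) /\
    (forall x, 0 <= x <= 1 ->
       limit1_in dphi (fun y => 0 <= y <= 1) (dphi x) x).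

Definition cover_length (A : R -> Prop) (s : R) : Prop :=
  exists a b : nat -> R,
    (forall n, a n <= b n) /\
    (forall x, A x -> exists n, a n < x < b n) /\
    infinite_sum (fun n => b n - a n) s.

Definition lebesgue_outer_is (A : R -> Prop) (v : R) : Prop :=
  (forall s, cover_length A s -> v <= s) /\
  (forall w, (forall s, cover_length A s -> w <= s) -> w <= v).

Definition std_normal_cdf_is (t l : R) : Prop :=
  forall eps, eps > 0 -> exists A, forall a, a <= A ->
    Rabs (/ sqrt (2 * PI) * RI (fun s => exp (- s ^ 2 / 2)) a t - l) < eps.

(* Main.v *)
(* Let P_k be the transfer operator of T_k, h_k = P_k...P_1 1 and
   G_k = sum_j P_k...P_{j+1} (phi_j h_j).  Up to a term bounded in L^2, S_n is the sum of the
   reverse martingale differences (G_k/h_k)(T^k x) - (P_{k+1} G_k/h_{k+1})(T^{k+1} x).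
   All functions are controlled in the classes |g x| <= A x^-a, |g x - g y| <= A x^-a (1 - x/y)
   (x <= y).  A mean-zero g of such a class is a difference of two members of an invariant cone;
   subtracting common constants from both (coupling) makes their mass decay like
   n^-(1-a)/alpha, and interpolating with the pointwise bound x^-a gives decay of P^n g in a
   class of slightly larger exponent.  Hence G_k has exponent kappa = alpha + 1/9 uniformly in k,
   and 4 kappa + alpha < 1, that is alpha < 1/9, makes the fourth moments of the differences
   finite and the covariances of their conditional variances summable.  The sum V of the
   conditional variances then has variance O(n) = o(sigma_n^4), and the characteristic function
   follows by comparing E cos(l M + th) exp(l^2 V / 2), with V truncated, one step at a time. *)
Require Import Defs.
From Stdlib Require Import Reals Lra Lia ClassicalEpsilon FunctionalExtensionality List.
From Coquelicot Require Import Coquelicot.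
Open Scope R_scope.

(** Every integral is a Riemann integral: densities are kept continuous on the whole line, functions
    along the orbit piecewise continuous, and Lebesgue outer measure enters only at the very end.
    The obstacle is that the comparison functions [x^-a] are unbounded at 0 whereas each density is
    bounded, so pole bounds are stated with constants uniform in time, and truncations are removed
    by a limit. The summand 1/9 in [kappa] balances two demands. Raising the exponent of the pole
    from [alpha] by [delta] buys the decay [n^-(delta/alpha)], which is summable for
    [alpha < delta]; the moment condition becomes [5 alpha + 4 delta < 1]. The two ranges of [alpha]
    coincide for [delta = 1/9]. Time runs backwards in the martingale: a difference is centred given
    the later orbit, so the characteristic function is expanded by removing the earliest difference
    first. The growth assumption enters through [b > 1/2], which makes [n / sigma_n^4] vanish. *)

Definition cont (f : R -> R) := forall x, continuous f x.

Lemma cont_const k : cont (fun _ => k).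
Proof. intros x; apply continuous_const. Qed.

Lemma cont_id : cont (fun x => x).
Proof. intros x; apply continuous_id. Qed.

Lemma cont_plus f g : cont f -> cont g -> cont (fun x => f x + g x).
Proof. intros A B x; apply (continuous_plus f g); auto. Qed.

Lemma cont_minus f g : cont f -> cont g -> cont (fun x => f x - g x).
Proof. intros A B x; apply (continuous_minus f g); auto. Qed.

Lemma cont_opp f : cont f -> cont (fun x => - f x).
Proof. intros A x; apply (continuous_opp f); auto. Qed.

Lemma cont_mult f g : cont f -> cont g -> cont (fun x => f x * g x).
Proof. intros A B x; apply (continuous_mult f g); auto. Qed.

Lemma cont_comp f g : cont f -> cont g -> cont (fun x => f (g x)).
Proof. intros A B x; apply (continuous_comp g f); auto. Qed.

Lemma cont_inv f : cont f -> (forall x, f x <> 0) -> cont (fun x => / f x).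
Proof.
intros A B x. apply continuity_pt_filterlim.
apply (continuity_pt_inv f x); auto. apply continuity_pt_filterlim, A.
Qed.

Lemma cont_div f g : cont f -> cont g -> (forall x, g x <> 0) ->
  cont (fun x => f x / g x).
Proof. intros; apply cont_mult; auto. apply cont_inv; auto. Qed.

Lemma cont_pow f n : cont f -> cont (fun x => f x ^ n).
Proof.
intros A; induction n; simpl. apply cont_const. apply cont_mult; auto.
Qed.

Lemma cont_of_lipschitz f L :
  (forall x y, Rabs (f x - f y) <= L * Rabs (x - y)) -> cont f.
Proof.
intros H x. apply continuity_pt_filterlim. intros e He.
exists (e / (Rabs L + 1)). pose proof (Rabs_pos L).
split. apply Rdiv_lt_0_compat; lra.
intros y [_ Hy]. simpl in *. unfold Rdist in *.
specialize (H y x). pose proof (Rabs_pos (y - x)). pose proof (Rle_abs L).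
assert (e = (Rabs L + 1) * (e / (Rabs L + 1))) by (field; lra).
nra.
Qed.

Lemma cont_abs : cont Rabs.
Proof.
apply cont_of_lipschitz with 1. intros x y. rewrite Rmult_1_l. apply Rabs_triang_inv2.
Qed.

Lemma Rmax_abs x y : Rmax x y = (x + y + Rabs (x - y)) / 2.
Proof. unfold Rmax, Rabs; destruct Rle_dec, Rcase_abs; lra. Qed.

Lemma Rmin_abs x y : Rmin x y = (x + y - Rabs (x - y)) / 2.
Proof. unfold Rmin, Rabs; destruct Rle_dec, Rcase_abs; lra. Qed.

Lemma cont_max f g : cont f -> cont g -> cont (fun x => Rmax (f x) (g x)).
Proof.
intros. apply (fun h => eq_ind _ cont h _ (functional_extensionality _ _ (fun x => eq_sym (Rmax_abs (f x) (g x))))).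
apply cont_div; [|apply cont_const|intros; lra].
apply cont_plus. now apply cont_plus.
apply (cont_comp Rabs); [apply cont_abs|now apply cont_minus].
Qed.

Lemma cont_min f g : cont f -> cont g -> cont (fun x => Rmin (f x) (g x)).
Proof.
intros. apply (fun h => eq_ind _ cont h _ (functional_extensionality _ _ (fun x => eq_sym (Rmin_abs (f x) (g x))))).
apply cont_div; [|apply cont_const|intros; lra].
apply cont_minus. now apply cont_plus.
apply (cont_comp Rabs); [apply cont_abs|now apply cont_minus].
Qed.

Lemma cont_cos : cont cos.
Proof. intros x; apply continuous_cos. Qed.

Lemma cont_exp : cont exp.
Proof. intros x; apply continuous_exp. Qed.

Create HintDb cdb.
#[export] Hint Resolve cont_const cont_id cont_plus cont_minus cont_opp cont_mult cont_pow
  cont_max cont_min cont_cos cont_exp cont_abs : cdb.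

Lemma cont_ex (f : R -> R) a b : cont f -> ex_RInt f a b.
Proof. intros H; apply (ex_RInt_continuous f). intros; apply H. Qed.
#[export] Hint Resolve cont_ex : cdb.

Lemma cont_at f x e : cont f -> 0 < e ->
  exists d, 0 < d /\ forall y, Rabs (y - x) < d -> Rabs (f y - f x) < e.
Proof.
intros H He. specialize (H x). apply continuity_pt_filterlim in H.
destruct (H e He) as (d & Hd & K). exists d; split; auto. intros y Hy.
destruct (Req_dec x y) as [->|N].
unfold Rminus; rewrite Rplus_opp_r, Rabs_R0; auto.
apply (K y). split; [split; [exact I|exact N]|exact Hy].
Qed.

Lemma cont_bounded f a b : cont f ->
  exists M, 0 < M /\ forall x, a <= x <= b -> Rabs (f x) <= M.
Proof.
intros H. destruct (Rle_dec a b) as [L|L].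
2:{ exists 1; split; intros; lra. }
destruct (continuity_ab_maj (fun x => Rabs (f x)) a b L) as (m & Hm & _).
intros c _. apply continuity_pt_filterlim. apply (cont_comp Rabs); auto with cdb.
exists (Rabs (f m) + 1). split. pose proof (Rabs_pos (f m)); lra.
intros x Hx; specialize (Hm x Hx); simpl in Hm; lra.
Qed.

(** * Riemann integrals: linearity and elementary bounds *)

Lemma RInt_add (f g : R -> R) a b : ex_RInt f a b -> ex_RInt g a b ->
  RInt (fun x => f x + g x) a b = RInt f a b + RInt g a b.
Proof. exact (@RInt_plus R_CompleteNormedModule f g a b). Qed.

Lemma RInt_sub (f g : R -> R) a b : ex_RInt f a b -> ex_RInt g a b ->
  RInt (fun x => f x - g x) a b = RInt f a b - RInt g a b.
Proof. exact (@RInt_minus R_CompleteNormedModule f g a b). Qed.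

Lemma RInt_mull (f : R -> R) k a b : ex_RInt f a b ->
  RInt (fun x => k * f x) a b = k * RInt f a b.
Proof. exact (@RInt_scal R_CompleteNormedModule f a b k). Qed.

Lemma RInt_cst (k a b : R) : RInt (fun _ : R => k) a b = (b - a) * k.
Proof. exact (@RInt_const R_CompleteNormedModule a b k). Qed.

Lemma RInt_cat (f : R -> R) a b c : ex_RInt f a b -> ex_RInt f b c ->
  RInt f a b + RInt f b c = RInt f a c.
Proof. exact (@RInt_Chasles R_CompleteNormedModule f a b c). Qed.

Lemma ex_add (f g : R -> R) a b : ex_RInt f a b -> ex_RInt g a b ->
  ex_RInt (fun x => f x + g x) a b.
Proof. exact (@ex_RInt_plus R_NormedModule f g a b). Qed.

Lemma ex_sub (f g : R -> R) a b : ex_RInt f a b -> ex_RInt g a b ->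
  ex_RInt (fun x => f x - g x) a b.
Proof. exact (@ex_RInt_minus R_NormedModule f g a b). Qed.

Lemma ex_mull (f : R -> R) k a b : ex_RInt f a b -> ex_RInt (fun x => k * f x) a b.
Proof. exact (@ex_RInt_scal R_NormedModule f a b k). Qed.

Lemma ex_cst (k a b : R) : ex_RInt (fun _ : R => k) a b.
Proof. apply cont_ex, cont_const. Qed.
#[export] Hint Resolve ex_add ex_sub ex_mull ex_cst : cdb.

Lemma RInt_eq (f g : R -> R) a b : a <= b -> (forall x, a < x < b -> f x = g x) ->
  RInt f a b = RInt g a b.
Proof.
intros H K. apply RInt_ext. rewrite Rmin_left, Rmax_right; auto.
Qed.

Lemma ex_eq (f g : R -> R) a b : a <= b -> (forall x, a < x < b -> f x = g x) ->
  ex_RInt f a b -> ex_RInt g a b.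
Proof.
intros H K. apply ex_RInt_ext. rewrite Rmin_left, Rmax_right; auto.
Qed.

Lemma RInt_nonneg (f : R -> R) a b : a <= b -> ex_RInt f a b ->
  (forall x, a < x < b -> 0 <= f x) -> 0 <= RInt f a b.
Proof. intros; apply RInt_ge_0; auto. Qed.

Lemma RInt_upper (f : R -> R) a b k : a <= b -> ex_RInt f a b ->
  (forall x, a < x < b -> f x <= k) -> RInt f a b <= (b - a) * k.
Proof. intros. rewrite <- RInt_cst. apply RInt_le; auto with cdb. Qed.

Lemma RInt_lower (f : R -> R) a b k : a <= b -> ex_RInt f a b ->
  (forall x, a < x < b -> k <= f x) -> (b - a) * k <= RInt f a b.
Proof. intros. rewrite <- RInt_cst. apply RInt_le; auto with cdb. Qed.

Ltac eqR := match goal with |- @eq _ ?x ?y => change (@eq R x y) end.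

(** * Piecewise continuous functions *)

(** Each piece agrees, in its open interior only, with a function continuous on all of R. Break
    points carry no condition, so jumps such as that of the map at 1/2 are harmless, and one-sided
    limits at the ends come for free. *)
Inductive pw : R -> R -> (R -> R) -> Prop :=
| pw_base a b f F : a < b -> cont f -> (forall x, a < x < b -> F x = f x) -> pw a b F
| pw_split a c b F : pw a c F -> pw c b F -> pw a b F.

Lemma pw_lt a b F : pw a b F -> a < b.
Proof. induction 1; lra. Qed.

Lemma pw_ex a b F : pw a b F -> ex_RInt F a b.
Proof.
induction 1.
- apply (ex_eq f); auto with cdb. lra. intros; symmetry; auto.
- apply (@ex_RInt_Chasles R_NormedModule F a c b); auto.
Qed.
#[export] Hint Resolve pw_ex : cdb.

Lemma pw_cont f a b : a < b -> cont f -> pw a b f.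
Proof. intros; apply pw_base with f; auto. Qed.

Lemma pw_sub a b F : pw a b F -> forall c d, a <= c -> c < d -> d <= b -> pw c d F.
Proof.
induction 1 as [a b f F L C E|a e b F H1 I1 H2 I2]; intros c d Hc Hd Hb.
- apply pw_base with f; auto. intros; apply E; lra.
- destruct (Rle_dec d e). apply I1; lra.
  destruct (Rle_dec e c). apply I2; lra.
  apply pw_split with e. apply I1; lra. apply I2; lra.
Qed.

(** Common refinement of two partitions: the outer induction splits [F] and restricts [G] by
    [pw_sub]; only on a piece where [F] is continuous is [G] split in turn. *)
Lemma pw_op (op : R -> R -> R) :
  (forall f g, cont f -> cont g -> cont (fun x => op (f x) (g x))) ->
  forall a b F, pw a b F -> forall G, pw a b G -> pw a b (fun x => op (F x) (G x)).
Proof.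
intros Hop a b F H. induction H as [a b f F L C E|a e b F H1 I1 H2 I2]; intros G HG.
- induction HG as [a b g G L' C' E'|a e b G H1 I1 H2 I2].
  + apply pw_base with (fun x => op (f x) (g x)); auto. intros; rewrite E, E'; auto.
  + pose proof (pw_lt _ _ _ H1). pose proof (pw_lt _ _ _ H2).
    apply pw_split with e; [apply I1|apply I2]; auto; intros; apply E; lra.
- pose proof (pw_lt _ _ _ H1). pose proof (pw_lt _ _ _ H2).
  apply pw_split with e; [apply I1|apply I2]; apply (pw_sub _ _ _ HG); lra.
Qed.

Lemma pw_plus a b F G : pw a b F -> pw a b G -> pw a b (fun x => F x + G x).
Proof. intros; apply (pw_op Rplus); auto with cdb. Qed.

Lemma pw_minus a b F G : pw a b F -> pw a b G -> pw a b (fun x => F x - G x).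
Proof. intros; apply (pw_op Rminus); auto with cdb. Qed.

Lemma pw_mult a b F G : pw a b F -> pw a b G -> pw a b (fun x => F x * G x).
Proof. intros; apply (pw_op Rmult); auto with cdb. Qed.

Lemma pw_comp a b f F : cont f -> pw a b F -> pw a b (fun x => f (F x)).
Proof.
intros Hf H. apply (pw_op (fun x _ => f x)) with (G := F); auto.
intros; now apply cont_comp.
Qed.

Lemma pw_const a b k : a < b -> pw a b (fun _ => k).
Proof. intros; apply pw_cont; auto with cdb. Qed.

Lemma pw_pow a b F n : pw a b F -> pw a b (fun x => F x ^ n).
Proof. intros; apply (pw_comp a b (fun x => x ^ n)); auto with cdb. Qed.

Lemma pw_ext a b F G : pw a b F -> (forall x, a < x < b -> F x = G x) -> pw a b G.
Proof.
intros H. revert G. induction H as [a b f F L C E|a e b F H1 I1 H2 I2]; intros G HG.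
- apply pw_base with f; auto. intros; rewrite <- HG; auto.
- pose proof (pw_lt _ _ _ H1). pose proof (pw_lt _ _ _ H2).
  apply pw_split with e; [apply I1|apply I2]; intros; apply HG; lra.
Qed.

#[export] Hint Resolve pw_plus pw_minus pw_mult pw_pow : cdb.

Lemma pw_affine k d : 0 < k -> forall a b F, pw a b F ->
  pw ((a - d) / k) ((b - d) / k) (fun x => F (k * x + d)).
Proof.
intros Hk a b F H.
assert (Q : forall u v, u < v -> (u - d) / k < (v - d) / k).
{ intros; apply Rmult_lt_compat_r; [apply Rinv_0_lt_compat|]; lra. }
assert (Q' : forall u, k * ((u - d) / k) = u - d) by (intros; field; lra).
induction H as [a b f F L C E|a e b F H1 I1 H2 I2].
- apply pw_base with (fun x => f (k * x + d)); auto.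
  { apply (cont_comp f); auto with cdb. }
  intros x Hx. apply E. pose proof (Q' a); pose proof (Q' b). nra.
- apply pw_split with ((e - d) / k); auto.
Qed.

(** The [epsilon] in [RI] picks some witness, and every proof of integrability yields the same
    value. *)
Lemma RI_RInt (f : R -> R) a b : ex_RInt f a b -> RI f a b = RInt f a b.
Proof.
intros H. unfold RI.
assert (E : exists v, exists pr : Riemann_integrable f a b, RiemannInt pr = v).
{ exists (RiemannInt (ex_RInt_Reals_0 _ _ _ H)). eexists; reflexivity. }
destruct (epsilon_spec (inhabits 0) _ E) as (pr & K). rewrite <- K.
symmetry; apply RInt_Reals.
Qed.

Lemma RInt_pt (f : R -> R) a : RInt f a a = 0.
Proof. exact (@RInt_point R_CompleteNormedModule a f). Qed.

(** * The maps and their transfer operators *)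

(** Real power extended by 0 to the negative half-line, so that it is continuous on all of R for
    [g > 0]; [Rpower] alone has no useful value at 0. *)
Definition pp (g x : R) : R := if Rle_dec x 0 then 0 else Rpower x g.

Lemma pp_pos g x : 0 < x -> pp g x = Rpower x g.
Proof. intros; unfold pp; destruct Rle_dec; lra. Qed.

Lemma pp_0 g x : x <= 0 -> pp g x = 0.
Proof. intros; unfold pp; destruct Rle_dec; lra. Qed.

Lemma Rpower_pos x y : 0 < Rpower x y.
Proof. apply exp_pos. Qed.

Lemma Rpower_base1 y : Rpower 1 y = 1.
Proof. unfold Rpower. rewrite ln_1, Rmult_0_r. apply exp_0. Qed.

Lemma Rpower_base_le x y a : 0 < x <= y -> 0 <= a -> Rpower x a <= Rpower y a.
Proof. intros; apply Rle_Rpower_l; lra. Qed.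

Lemma Rpower_le1_anti x a b : 0 < x <= 1 -> a <= b -> Rpower x b <= Rpower x a.
Proof.
intros Hx H. unfold Rpower. destruct (Req_dec x 1) as [->|N].
rewrite ln_1, !Rmult_0_r; lra.
assert (ln x < 0) by (rewrite <- ln_1; apply ln_increasing; lra).
destruct (Req_dec a b) as [->|]; [lra|].
left; apply exp_increasing. nra.
Qed.

Lemma Rpower_neg_anti x y a : 0 < x <= y -> 0 <= a -> Rpower y (- a) <= Rpower x (- a).
Proof.
intros. rewrite !Rpower_Ropp. apply Rinv_le_contravar. apply Rpower_pos.
now apply Rpower_base_le.
Qed.

Lemma Rpower_bernoulli t a : 0 < t -> 0 <= a <= 1 -> Rpower t a <= 1 + a * (t - 1).
Proof.
intros Ht Ha.
destruct (Req_dec a 0) as [->|N0]; [rewrite Rpower_O; lra|].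
(* convexity of exp: t^a = exp(a ln t) is below the chord through 0 and ln t *)
assert (T : forall u, 1 + u <= exp u).
{ apply exp_ineq1_le. }
set (w := Rpower t a). assert (Hw : 0 < w) by apply Rpower_pos.
assert (E1 : exp ((1 - a) * ln t) * w = t).
{ unfold w, Rpower. rewrite <- exp_plus. replace (_ + _) with (ln t) by ring. now apply exp_ln. }
assert (E2 : exp (- a * ln t) * w = 1).
{ unfold w, Rpower. rewrite <- exp_plus. replace (_ + _) with 0 by ring. apply exp_0. }
pose proof (T ((1 - a) * ln t)). pose proof (T (- a * ln t)).
assert (a * (exp ((1 - a) * ln t) * w) + (1 - a) * (exp (- a * ln t) * w) >= w).
{ assert (0 <= a * w) by nra. assert (0 <= (1 - a) * w) by nra.
  pose proof (Rmult_le_compat_l _ _ _ H1 H). pose proof (Rmult_le_compat_l _ _ _ H2 H0). nra. }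
rewrite E1, E2 in H1. lra.
Qed.

Lemma pp_nonneg g x : 0 <= pp g x.
Proof. unfold pp; destruct Rle_dec. lra. left; apply Rpower_pos. Qed.

Lemma pp_mono g x y : 0 <= g -> x <= y -> pp g x <= pp g y.
Proof.
intros G H. destruct (Rle_dec x 0). rewrite pp_0; auto. apply pp_nonneg.
rewrite !pp_pos by lra. apply Rpower_base_le; lra.
Qed.

Lemma pp_one g : pp g 1 = 1.
Proof. rewrite pp_pos by lra. apply Rpower_base1. Qed.

Lemma pp_le1 g x : 0 <= g -> x <= 1 -> pp g x <= 1.
Proof. intros. rewrite <- (pp_one g). now apply pp_mono. Qed.

Lemma pp_ratio g u v : 0 <= g <= 1 -> 0 <= u <= v -> u * pp g v <= v * pp g u.
Proof.
intros Hg H. destruct (Req_dec u 0) as [->|N].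
{ rewrite (pp_0 g 0) by lra. lra. }
rewrite !pp_pos by lra.
assert (E : Rpower u g = Rpower (u / v) g * Rpower v g).
{ rewrite Rpower_mult_distr; try lra. f_equal; field; lra.
  apply Rdiv_lt_0_compat; lra. }
assert (0 < u / v <= 1).
{ split. apply Rdiv_lt_0_compat; lra. apply (Rdiv_le_1 u v); lra. }
pose proof (Rpower_le1_anti (u / v) g 1 H0 ltac:(lra)).
rewrite Rpower_1 in H1 by lra. pose proof (Rpower_pos v g).
rewrite E. assert (u = v * (u / v)) by (field; lra).
rewrite H3 at 1. rewrite Rmult_assoc. apply Rmult_le_compat_l. lra. nra.
Qed.

Lemma pp_cont g : 0 < g -> cont (pp g).
Proof.
intros Hg x. destruct (Rtotal_order x 0) as [H|[H|H]].
- apply (continuous_ext_loc (pp g) (fun _ => 0) x); [|apply continuous_const].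
  exists (mkposreal (- x) ltac:(lra)). intros y Hy. apply Rabs_def2 in Hy. simpl in Hy.
  unfold minus, plus, opp in Hy; simpl in Hy. symmetry; apply pp_0; lra.
- subst. apply continuity_pt_filterlim. intros e He.
  exists (Rpower e (/ g)). split. apply Rpower_pos.
  intros y [_ Hy]. simpl in *. unfold Rdist in *. rewrite (pp_0 g 0) by lra.
  rewrite Rminus_0_r in *. rewrite Rabs_pos_eq by apply pp_nonneg.
  destruct (Rle_dec y 0); [rewrite pp_0; lra|]. rewrite pp_pos by lra.
  rewrite Rabs_pos_eq in Hy by lra.
  rewrite <- (Rpower_1 e He). replace 1 with (/ g * g) by (field; lra).
  rewrite <- Rpower_mult. apply Rlt_Rpower_l; lra.
- apply (continuous_ext_loc (pp g) (fun y => Rpower y g) x).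
  + exists (mkposreal x H). intros y Hy. apply Rabs_def2 in Hy. simpl in Hy.
    unfold minus, plus, opp in Hy; simpl in Hy. symmetry; apply pp_pos; lra.
  + apply continuity_pt_filterlim. apply derivable_continuous_pt.
    eexists. apply derivable_pt_lim_power; auto.
Qed.

Lemma xpp_derive g x : 0 < g -> is_derive (fun y => y * pp g y) x ((1 + g) * pp g x).
Proof.
intros Hg. destruct (Rtotal_order x 0) as [H|[H|H]].
- apply (is_derive_ext_loc (fun _ => 0)).
  + exists (mkposreal (- x) ltac:(lra)). intros y Hy. apply Rabs_def2 in Hy. simpl in Hy.
    unfold minus, plus, opp in Hy; simpl in Hy. rewrite pp_0; lra.
  + rewrite pp_0 by lra. rewrite Rmult_0_r. apply (is_derive_const (V := R_NormedModule) 0 x).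
- subst. apply is_derive_Reals. intros e He.
  destruct (cont_at (pp g) 0 e (pp_cont g Hg) He) as (d & Hd & K).
  exists (mkposreal d Hd). intros h Hh0 Hh. simpl in Hh.
  specialize (K h). rewrite (pp_0 g 0) in * by lra. rewrite !Rplus_0_l.
  rewrite Rminus_0_r in K. specialize (K Hh).
  replace ((h * pp g h - 0 * 0) / h - (1 + g) * 0) with (pp g h - 0) by (field; auto). auto.
- apply (is_derive_ext_loc (fun y => y * Rpower y g)).
  + exists (mkposreal x H). intros y Hy. apply Rabs_def2 in Hy. simpl in Hy.
    unfold minus, plus, opp in Hy; simpl in Hy. rewrite pp_pos; lra.
  + rewrite pp_pos by lra.
    replace ((1 + g) * Rpower x g) with (1 * Rpower x g + x * (g * Rpower x (g - 1))).
    apply is_derive_Reals.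
    apply (derivable_pt_lim_mult (fun y => y) (fun y => Rpower y g)).
    apply derivable_pt_lim_id. now apply derivable_pt_lim_power.
    assert (x * Rpower x (g - 1) = Rpower x g).
    { rewrite <- (Rpower_1 x H) at 1. rewrite <- Rpower_plus. f_equal; ring. }
    rewrite <- H0. ring.
Qed.

(** The left branch written as [y (1 + (2 y)^g)]. With [s = (2 y)^g], which runs through [0,1] on
    [0,1/2], the map is [x = y (1 + s)] and its derivative is [1 + (1 + g) s]; later estimates on
    this branch are in terms of [s]. *)
Definition lf (g y : R) : R := y + y * pp g (2 * y).
Definition dlf (g y : R) : R := 1 + (1 + g) * pp g (2 * y).

Lemma lf_derive g y : 0 < g -> is_derive (lf g) y (dlf g y).
Proof.
intros Hg.
apply (is_derive_ext (fun y => y + / 2 * ((2 * y) * pp g (2 * y)))).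
{ intros t; unfold lf. simpl. field. }
unfold dlf. replace ((1 + g) * pp g (2 * y)) with (/ 2 * (2 * ((1 + g) * pp g (2 * y)))) by field.
apply is_derive_Reals.
apply (derivable_pt_lim_plus (fun y => y) (fun y => / 2 * ((2 * y) * pp g (2 * y)))).
apply derivable_pt_lim_id.
apply (derivable_pt_lim_scal (fun y => (2 * y) * pp g (2 * y))).
rewrite (Rmult_comm 2 ((1 + g) * _)).
apply (derivable_pt_lim_comp (fun y => 2 * y) (fun y => y * pp g y) y).
pose proof (derivable_pt_lim_scal (fun y => y) 2 y 1 (derivable_pt_lim_id y)) as Q.
rewrite Rmult_1_r in Q. exact Q.
apply is_derive_Reals. now apply xpp_derive.
Qed.

Lemma dlf_cont g : 0 < g -> cont (dlf g).
Proof.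
intros. unfold dlf. apply cont_plus; auto with cdb. apply cont_mult; auto with cdb.
apply (cont_comp (pp g)); auto using pp_cont with cdb.
Qed.

Lemma lf_cont g : 0 < g -> cont (lf g).
Proof.
intros. unfold lf. apply cont_plus; auto with cdb. apply cont_mult; auto with cdb.
apply (cont_comp (pp g)); auto using pp_cont with cdb.
Qed.

Lemma dlf_ge1 g y : 0 <= g -> 1 <= dlf g y.
Proof. intros; unfold dlf. pose proof (pp_nonneg g (2 * y)). nra. Qed.

Lemma lf_0 g : lf g 0 = 0.
Proof. unfold lf; ring. Qed.

Lemma lf_half g : lf g (1/2) = 1.
Proof. unfold lf. replace (2 * (1/2)) with 1 by field. rewrite pp_one. lra. Qed.

Lemma lf_expand g u v : 0 <= g -> 0 <= u <= v -> v - u <= lf g v - lf g u.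
Proof.
intros Hg H. unfold lf. pose proof (pp_mono g (2 * u) (2 * v) Hg ltac:(lra)).
pose proof (pp_nonneg g (2 * u)). nra.
Qed.

(** Clamping to [0,1]. Precomposing with it extends functions on the interval to the whole line, so
    that [cont] never has to mention a domain. *)
Definition cl (x : R) : R := Rmax 0 (Rmin 1 x).

Lemma cl_id x : 0 <= x <= 1 -> cl x = x.
Proof. intros; unfold cl. rewrite Rmin_right, Rmax_right; lra. Qed.

Lemma cl_range x : 0 <= cl x <= 1.
Proof. unfold cl, Rmax, Rmin; repeat destruct Rle_dec; lra. Qed.

Lemma cl_lip x y : Rabs (cl x - cl y) <= Rabs (x - y).
Proof.
unfold cl, Rmax, Rmin, Rabs; repeat destruct Rle_dec; repeat destruct Rcase_abs; lra.
Qed.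

Lemma cl_cont : cont cl.
Proof. apply cont_of_lipschitz with 1. intros; rewrite Rmult_1_l; apply cl_lip. Qed.
#[export] Hint Resolve cl_cont : cdb.

(** Inverse of the left branch, made total by clamping the argument. Since the branch expands, this
    inverse is 1-Lipschitz on the whole line, hence continuous. *)
Definition yl (g x : R) : R :=
  epsilon (inhabits 0) (fun y => 0 <= y <= 1/2 /\ lf g y = cl x).

Lemma yl_cl_spec g x : 0 < g -> 0 <= yl g x <= 1/2 /\ lf g (yl g x) = cl x.
Proof.
intros Hg. unfold yl. apply epsilon_spec. pose proof (cl_range x).
destruct (IVT_cor (fun y => lf g y - cl x) 0 (1/2)) as (z & Hz & E).
- intros y. apply continuity_pt_filterlim. exact (cont_minus (lf g) (fun _ => cl x) (lf_cont g Hg) (cont_const _) y).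
- lra.
- rewrite lf_0, lf_half. nra.
- exists z; split; auto; lra.
Qed.

Section OneMap.
Variable g : R.
Hypothesis Hg : 0 < g <= 1.

Lemma yl_spec x : 0 <= x <= 1 -> 0 <= yl g x <= 1/2 /\ lf g (yl g x) = x.
Proof. intros H. rewrite <- (cl_id x H) at 4. apply yl_cl_spec; lra. Qed.

Lemma yl_lip x y : Rabs (yl g x - yl g y) <= 1 * Rabs (x - y).
Proof.
destruct (yl_cl_spec g x) as [A E]; [lra|]. destruct (yl_cl_spec g y) as [B F]; [lra|].
rewrite Rmult_1_l. eapply Rle_trans; [|apply cl_lip]. rewrite <- E, <- F.
destruct (Rle_dec (yl g x) (yl g y)).
- pose proof (lf_expand g (yl g x) (yl g y)). rewrite (Rabs_minus_sym (yl g x)), (Rabs_minus_sym (lf g (yl g x))).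
  rewrite !Rabs_pos_eq; lra.
- pose proof (lf_expand g (yl g y) (yl g x)). rewrite !Rabs_pos_eq; lra.
Qed.

Lemma yl_cont : cont (yl g).
Proof. apply cont_of_lipschitz with 1. apply yl_lip. Qed.

Lemma yl_lf y : 0 <= y <= 1/2 -> yl g (lf g y) = y.
Proof.
intros H. assert (0 <= lf g y <= 1).
{ pose proof (lf_expand g 0 y ltac:(lra)). pose proof (lf_expand g y (1/2) ltac:(lra)).
  rewrite lf_0, lf_half in *. lra. }
destruct (yl_spec (lf g y) H0) as [A E].
destruct (Rle_dec (yl g (lf g y)) y) as [L|L].
pose proof (lf_expand g (yl g (lf g y)) y); lra.
pose proof (lf_expand g y (yl g (lf g y))); lra.
Qed.

Lemma yl_mono x y : 0 <= x -> x <= y -> y <= 1 -> yl g x <= yl g y.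
Proof.
intros. destruct (yl_spec x) as [A E]; [lra|]. destruct (yl_spec y) as [B F]; [lra|].
destruct (Rle_dec (yl g x) (yl g y)) as [L|L]; auto.
pose proof (lf_expand g (yl g y) (yl g x)); lra.
Qed.

Lemma yl_strict x y : 0 <= x -> x < y -> y <= 1 -> yl g x < yl g y.
Proof.
intros. destruct (yl_mono x y) as [L|L]; try lra.
destruct (yl_spec x) as [A E]; [lra|]. destruct (yl_spec y) as [B F]; [lra|].
rewrite L in E. lra.
Qed.

Lemma yl_0 : yl g 0 = 0.
Proof. rewrite <- (lf_0 g) at 1. apply yl_lf; lra. Qed.

Lemma yl_1 : yl g 1 = 1/2.
Proof. rewrite <- (lf_half g) at 1. apply yl_lf; lra. Qed.

(** Transfer operator: a sum over the two preimages, weighted by the inverse derivatives. The point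
    enters only through its clamped value, so the image of a continuous function is again continuous
    on R. *)
Definition P (f : R -> R) (x : R) : R :=
  f (yl g x) / dlf g (yl g x) + f ((cl x + 1) / 2) / 2.

Lemma P_cont f : cont f -> cont (P f).
Proof.
intros. unfold P. apply cont_plus.
- apply cont_div. apply (cont_comp f); auto using yl_cont.
  apply (cont_comp (dlf g)); auto using yl_cont. apply dlf_cont; lra.
  intros x. pose proof (dlf_ge1 g (yl g x)). lra.
- apply cont_div; auto with cdb; try (intros; lra).
  apply (cont_comp f); auto. apply cont_div; auto with cdb; intros; lra.
Qed.

Lemma P_plus f h : P (fun x => f x + h x) = fun x => P f x + P h x.
Proof. apply functional_extensionality; intros x. unfold P. unfold Rdiv; ring. Qed.

Lemma P_minus f h : P (fun x => f x - h x) = fun x => P f x - P h x.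
Proof. apply functional_extensionality; intros x. unfold P. unfold Rdiv; ring. Qed.

Lemma P_scal f k : P (fun x => k * f x) = fun x => k * P f x.
Proof. apply functional_extensionality; intros x. unfold P. unfold Rdiv; ring. Qed.

Lemma P_le f h : (forall x, 0 <= x <= 1 -> f x <= h x) -> forall x, P f x <= P h x.
Proof.
intros K x. unfold P. destruct (yl_cl_spec g x) as [A _]; [lra|].
pose proof (dlf_ge1 g (yl g x)). pose proof (cl_range x).
apply Rplus_le_compat; apply Rmult_le_compat_r; try (left; apply Rinv_0_lt_compat); try lra;
 apply K; lra.
Qed.

Lemma lf_strict u v : 0 <= u < v -> lf g u < lf g v.
Proof. intros. pose proof (lf_expand g u v). lra. Qed.

(** Change of variables [x = lf g y], piece by piece. Piecewise continuity of the composition is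
    needed to join the integrals over two pieces, so both claims go through a single induction. *)
Lemma subst_left w a b F : cont w -> pw a b F -> 0 <= a -> b <= 1 ->
  pw (yl g a) (yl g b) (fun y => F (lf g y)) /\
  RInt (fun y => w y * F (lf g y)) (yl g a) (yl g b) =
  RInt (fun x => w (yl g x) / dlf g (yl g x) * F x) a b.
Proof.
intros Hw H.
assert (Hd : cont (fun x => w (yl g x) / dlf g (yl g x))).
{ apply cont_div. apply (cont_comp w); auto using yl_cont.
  apply (cont_comp (dlf g)); auto using yl_cont. apply dlf_cont; lra.
  intros x. pose proof (dlf_ge1 g (yl g x)). lra. }
induction H as [a b f F L C E|a e b F H1 I1 H2 I2]; intros Ha Hb.
- assert (Hab : yl g a < yl g b) by (apply yl_strict; lra).
  destruct (yl_spec a) as [A1 A2]; [lra|]. destruct (yl_spec b) as [B1 B2]; [lra|].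
  assert (M : forall y, yl g a < y < yl g b -> a < lf g y < b).
  { intros y Hy. pose proof (lf_strict (yl g a) y). pose proof (lf_strict y (yl g b)). lra. }
  split.
  + apply pw_base with (fun y => f (lf g y)).
    * auto.
    * apply (cont_comp f); auto. apply lf_cont; lra.
    * intros y Hy. apply E. auto.
  + transitivity (RInt (fun x => w (yl g x) / dlf g (yl g x) * f x) (lf g (yl g a)) (lf g (yl g b))).
    2:{ rewrite A2, B2. apply RInt_eq. lra. intros; rewrite E; auto. }
    rewrite <- (RInt_comp (fun x => w (yl g x) / dlf g (yl g x) * f x) (lf g) (dlf g)).
    * apply RInt_eq. lra. intros y Hy. rewrite E by auto.
      unfold scal; simpl; unfold mult; simpl. rewrite yl_lf by lra. field.
      pose proof (dlf_ge1 g y); lra.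
    * intros y Hy. apply cont_mult; auto.
    * intros y Hy. split. apply lf_derive; lra. apply dlf_cont; lra.
- pose proof (pw_lt _ _ _ H1). pose proof (pw_lt _ _ _ H2).
  destruct I1 as [P1 E1]; try lra. destruct I2 as [P2 E2]; try lra.
  split. apply pw_split with (yl g e); auto.
  rewrite <- (RInt_cat _ (yl g a) (yl g e) (yl g b)).
  2:{ apply pw_ex. apply pw_mult; auto. apply pw_cont; auto. eapply pw_lt; eauto. }
  2:{ apply pw_ex. apply pw_mult; auto. apply pw_cont; auto. eapply pw_lt; eauto. }
  rewrite E1, E2. apply RInt_cat; apply pw_ex; apply pw_mult; auto; apply pw_cont; auto.
Qed.

Lemma Tmap_left x : 0 <= x <= 1/2 -> Tmap g x = lf g x.
Proof.
intros H. unfold Tmap. destruct Rle_dec; try lra. unfold lf, rpow.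
destruct (Req_EM_T x 0) as [->|N]; [ring|]. destruct Req_EM_T; [lra|].
rewrite pp_pos by lra. rewrite Rpower_plus, Rpower_1 by lra.
rewrite <- Rpower_mult_distr by lra. ring.
Qed.

Lemma Tmap_right x : 1/2 < x -> Tmap g x = 2 * x - 1.
Proof. intros; unfold Tmap; destruct Rle_dec; lra. Qed.

Lemma Tmap_range x : 0 <= x <= 1 -> 0 <= Tmap g x <= 1.
Proof.
intros H. destruct (Rle_dec x (1/2)).
- rewrite Tmap_left by lra. pose proof (lf_expand g 0 x ltac:(lra)).
  pose proof (lf_expand g x (1/2) ltac:(lra)). rewrite lf_0, lf_half in *. lra.
- rewrite Tmap_right; lra.
Qed.

Lemma pw_Tmap F : pw 0 1 F -> pw 0 1 (fun x => F (Tmap g x)).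
Proof.
intros H. apply pw_split with (1/2).
- destruct (subst_left (fun _ => 0) 0 1 F (cont_const 0) H) as [A _]; try lra.
  rewrite yl_0, yl_1 in A. eapply pw_ext; eauto. intros; simpl; rewrite Tmap_left; auto; lra.
- pose proof (pw_affine 2 (-1) ltac:(lra) 0 1 F H) as A.
  replace ((0 - -1) / 2) with (1/2) in A by field. replace ((1 - -1) / 2) with 1 in A by field.
  eapply pw_ext; eauto. intros; simpl. rewrite Tmap_right; auto; lra.
Qed.

(** The interval splits at 1/2 and each branch is substituted separately. The weight [w] is
    continuous but [F] only piecewise so, because [F] later contains compositions with the
    discontinuous maps that follow. *)
Lemma duality w F : cont w -> pw 0 1 F ->
  RInt (fun x => w x * F (Tmap g x)) 0 1 = RInt (fun x => P w x * F x) 0 1.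
Proof.
intros Hw H.
assert (Q : pw 0 1 (fun x => w x * F (Tmap g x))).
{ apply pw_mult. apply pw_cont; auto; lra. now apply pw_Tmap. }
rewrite <- (RInt_cat _ 0 (1/2) 1); try (apply pw_ex; apply (pw_sub _ _ _ Q); lra).
assert (Hd : cont (fun x => w (yl g x) / dlf g (yl g x))).
{ apply cont_div. apply (cont_comp w); auto using yl_cont.
  apply (cont_comp (dlf g)); auto using yl_cont. apply dlf_cont; lra.
  intros x. pose proof (dlf_ge1 g (yl g x)). lra. }
assert (Hd' : cont (fun x => w ((x + 1) / 2) / 2)).
{ apply cont_div; auto with cdb; try (intros; lra). apply (cont_comp w); auto.
  apply cont_div; auto with cdb; intros; lra. }
destruct (subst_left w 0 1 F Hw H) as [A1 A2]; try lra. rewrite yl_0, yl_1 in A2.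
assert (E1 : RInt (fun x => w x * F (Tmap g x)) 0 (1/2) = RInt (fun x => w (yl g x) / dlf g (yl g x) * F x) 0 1).
{ rewrite <- A2. apply RInt_eq. lra. intros; rewrite Tmap_left; auto; lra. }
assert (E2 : RInt (fun x => w x * F (Tmap g x)) (1/2) 1 = RInt (fun x => w ((x + 1) / 2) / 2 * F x) 0 1).
{ pose proof (RInt_comp_lin (V := R_CompleteNormedModule) (fun x => w ((x + 1) / 2) / 2 * F x) 2 (-1) (1/2) 1) as K.
  replace (2 * (1/2) + -1) with 0 in K by lra. replace (2 * 1 + -1) with 1 in K by lra.
  rewrite <- K. 2:{ apply pw_ex, pw_mult; auto. apply pw_cont; auto; lra. }
  apply RInt_eq. lra. intros x Hx. rewrite Tmap_right by lra.
  unfold scal; simpl; unfold mult; simpl. replace ((2 * x + -1 + 1) / 2) with x by field.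
  replace (2 * x + -1) with (2 * x - 1) by ring. field. }
rewrite E1, E2. rewrite <- RInt_add.
2,3: apply pw_ex, pw_mult; auto; apply pw_cont; auto; lra.
apply RInt_eq. lra. intros x Hx. unfold P. rewrite cl_id by lra. ring.
Qed.

Lemma P_mass w : cont w -> RInt (P w) 0 1 = RInt w 0 1.
Proof.
intros H. pose proof (duality w (fun _ => 1) H (pw_const 0 1 1 ltac:(lra))) as K.
simpl in K. transitivity (RInt (fun x => P w x * 1) 0 1).
apply RInt_eq; intros; lra. rewrite <- K. apply RInt_eq; intros; lra.
Qed.

Lemma yl_step x : 0 <= x <= 1 ->
  let y := yl g x in 0 <= y <= 1/2 /\ x = y * (1 + pp g (2 * y)) /\
  0 <= pp g (2 * y) <= 1 /\ y <= x <= 2 * y.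
Proof.
intros H y. destruct (yl_spec x H) as [A E]. fold y in A, E.
pose proof (pp_nonneg g (2 * y)). pose proof (pp_le1 g (2 * y) ltac:(lra) ltac:(lra)).
unfold lf in E. repeat split; try lra; nra.
Qed.

(** [x / yl g x = 1 + s], and [s] increases with [x]. *)
Lemma yl_ratio x x' : 0 < x -> x <= x' -> x' <= 1 -> x * yl g x' <= x' * yl g x.
Proof.
intros. destruct (yl_step x) as (A & B & C & D); [lra|].
destruct (yl_step x') as (A' & B' & C' & D'); [lra|].
rewrite B at 1. rewrite B' at 2.
pose proof (yl_mono x x'). pose proof (pp_mono g (2 * yl g x) (2 * yl g x')).
assert (0 <= yl g x * yl g x') by nra. nra.
Qed.

End OneMap.

(** * The invariant cone *)

(** The exponent 2 in the last condition works for every [g <= 1] at once, and it bounds the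
    relative oscillation by [1 - (x/y)^2]. The size of the pole at 0 is not part of the cone: its
    propagation needs a bound on the mass and is treated separately through [bnd]. *)
Definition cone (f : R -> R) : Prop :=
  cont f /\ (forall x, 0 <= x <= 1 -> 0 <= f x) /\
  (forall x y, 0 <= x -> x <= y -> y <= 1 -> f y <= f x) /\
  (forall x y, 0 <= x -> x <= y -> y <= 1 -> x ^ 2 * f x <= y ^ 2 * f y).

Definition bnd (a B : R) (f : R -> R) : Prop :=
  forall x, 0 < x <= 1 -> f x <= B * Rpower x (- a).

Lemma cone_cont f : cone f -> cont f.
Proof. intros H; apply H. Qed.
#[export] Hint Resolve cone_cont : cdb.

Lemma cone_const k : 0 <= k -> cone (fun _ => k).
Proof.
intros; repeat split; auto with cdb; try (intros; lra).
intros. apply Rmult_le_compat_r; auto. apply pow_incr; lra.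
Qed.

Lemma cone_plus f h : cone f -> cone h -> cone (fun x => f x + h x).
Proof.
intros (A1 & A2 & A3 & A4) (B1 & B2 & B3 & B4). repeat split; auto with cdb.
- intros x Hx; specialize (A2 x Hx); specialize (B2 x Hx); lra.
- intros x y H1 H2 H3; specialize (A3 x y H1 H2 H3); specialize (B3 x y H1 H2 H3); lra.
- intros x y H1 H2 H3; specialize (A4 x y H1 H2 H3); specialize (B4 x y H1 H2 H3); lra.
Qed.

(* The constant that can be removed from [P g f] inside the cone: this is the coupling. *)
Lemma cone_P_sub g f d : 0 < g <= 1 -> cone f -> 0 <= d <= f 1 / 4 ->
  cone (fun x => P g f x - d).
Proof.
intros Hg (A1 & A2 & A3 & A4) Hd. repeat split.
- apply cont_minus; auto with cdb. apply P_cont; auto.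
- intros x Hx. unfold P. rewrite cl_id by auto.
  destruct (yl_step g Hg x Hx) as (Y & _).
  pose proof (A2 (yl g x) ltac:(lra)). pose proof (dlf_ge1 g (yl g x) ltac:(lra)).
  assert (0 <= f (yl g x) / dlf g (yl g x)) by (apply Rdiv_le_0_compat; lra).
  pose proof (A3 ((x + 1) / 2) 1). pose proof (A2 1 ltac:(lra)). lra.
- intros x y H1 H2 H3. apply Rplus_le_compat_r. unfold P. rewrite !cl_id by lra.
  destruct (yl_step g Hg x) as (Yx & _); [lra|]. destruct (yl_step g Hg y) as (Yy & _); [lra|].
  pose proof (yl_mono g Hg x y H1 H2 H3) as M.
  pose proof (A3 ((x + 1) / 2) ((y + 1) / 2)).
  pose proof (A3 (yl g x) (yl g y)). pose proof (A2 (yl g y)).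
  assert (dlf g (yl g x) <= dlf g (yl g y)).
  { unfold dlf. pose proof (pp_mono g (2 * yl g x) (2 * yl g y)). nra. }
  pose proof (dlf_ge1 g (yl g x) ltac:(lra)).
  apply Rplus_le_compat; [|lra].
  apply Rmult_le_compat; try lra. left; apply Rinv_0_lt_compat; lra.
  apply Rinv_le_contravar; lra.
- intros x x' H1 H2 H3.
  destruct (yl_step g Hg x) as (Y & E & S & _); [lra|].
  destruct (yl_step g Hg x') as (Y' & E' & S' & _); [lra|].
  pose proof (yl_mono g Hg x x' H1 H2 H3) as M.
  pose proof (pp_mono g (2 * yl g x) (2 * yl g x') ltac:(lra) ltac:(lra)) as MS.
  unfold P. rewrite !cl_id by lra. unfold dlf.
  set (y := yl g x) in *. set (y' := yl g x') in *.
  set (s := pp g (2 * y)) in *. set (s' := pp g (2 * y')) in *.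
  assert (L : x ^ 2 * (f y / (1 + (1 + g) * s)) <= x' ^ 2 * (f y' / (1 + (1 + g) * s'))).
  { pose proof (A4 y y' ltac:(lra) M ltac:(lra)) as Q.
    pose proof (A2 y ltac:(lra)). pose proof (A2 y' ltac:(lra)).
    (* This quotient is the factor by which the left branch changes [y^2 f y]; it is nondecreasing
       in [s >= 0] because [g <= 1]. *)
    assert (K : (1 + s) ^ 2 / (1 + (1 + g) * s) <= (1 + s') ^ 2 / (1 + (1 + g) * s')).
    { apply Rle_div_l; [nra|].
      replace ((1 + s') ^ 2 / (1 + (1 + g) * s') * (1 + (1 + g) * s))
        with (((1 + s') ^ 2 * (1 + (1 + g) * s)) / (1 + (1 + g) * s')) by (field; nra).
      apply (Rle_div_r ((1 + s) ^ 2)); [nra|].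
      assert (0 <= (s' - s) * ((2 + s + s' - (1 + g)) + (1 + g) * (s * s'))).
      { apply Rmult_le_pos; [lra|]. assert (0 <= s * s') by nra. nra. }
      nra. }
    replace (x ^ 2 * (f y / (1 + (1 + g) * s)))
      with ((y ^ 2 * f y) * ((1 + s) ^ 2 / (1 + (1 + g) * s))) by (rewrite E; field; nra).
    replace (x' ^ 2 * (f y' / (1 + (1 + g) * s')))
      with ((y' ^ 2 * f y') * ((1 + s') ^ 2 / (1 + (1 + g) * s'))) by (rewrite E'; field; nra).
    apply Rmult_le_compat; auto. nra. apply Rdiv_le_0_compat; nra. }
  (* with u = (x+1)/2: f u' >= max (f 1, (u/u')^2 f u) *)
  assert (N : x ^ 2 * (f ((x + 1) / 2) / 2 - d) <= x' ^ 2 * (f ((x' + 1) / 2) / 2 - d)).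
  { set (u := (x + 1) / 2). set (u' := (x' + 1) / 2).
    assert (Hu : x = 2 * u - 1) by (unfold u; lra). assert (Hu' : x' = 2 * u' - 1) by (unfold u'; lra).
    pose proof (A3 u' 1 ltac:(lra) ltac:(lra) ltac:(lra)) as F1.
    pose proof (A4 u u' ltac:(lra) ltac:(lra) ltac:(lra)) as F2.
    pose proof (A2 1 ltac:(lra)) as F0. pose proof (A2 u ltac:(lra)) as Fu.
    set (r := u ^ 2 / u' ^ 2).
    assert (Hr : r * u' ^ 2 = u ^ 2) by (unfold r; field; nra).
    assert (Hr0 : 0 < r). { apply Rdiv_lt_0_compat; nra. }
    assert (F3 : r * f u <= f u').
    { apply Rmult_le_reg_l with (u' ^ 2); nra. }
    assert (XR : x ^ 2 <= r * x' ^ 2).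
    { apply Rmult_le_reg_l with (u' ^ 2); [nra|].
      replace (u' ^ 2 * (r * x' ^ 2)) with (u ^ 2 * x' ^ 2) by (rewrite <- Hr; ring).
      assert (u' * x <= u * x') by (unfold u, u'; nra).
      assert (0 <= u' * x) by nra. nra. }
    (* In both cases below [r (x'^2 f u' - x^2 f u) >= f 1 (r x'^2 - x^2)]. The present inequality
       lets this cover [2 d r (x'^2 - x^2)], twice the loss caused by the constant, as soon as
       [d <= f 1 / 4]. *)
    assert (KEY : (x' ^ 2 - x ^ 2) * r <= 2 * (r * x' ^ 2 - x ^ 2)).
    { apply Rmult_le_reg_l with (u' ^ 2); [nra|].
      replace (u' ^ 2 * ((x' ^ 2 - x ^ 2) * r)) with ((x' ^ 2 - x ^ 2) * u ^ 2) by (rewrite <- Hr; ring).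
      replace (u' ^ 2 * (2 * (r * x' ^ 2 - x ^ 2))) with (2 * (u ^ 2 * x' ^ 2 - u' ^ 2 * x ^ 2)) by (rewrite <- Hr; ring).
      replace (u ^ 2 * x' ^ 2 - u' ^ 2 * x ^ 2) with ((u * x' - u' * x) * (u * x' + u' * x)) by ring.
      assert (Z1 : u * x' - u' * x = (x' - x) / 2) by (unfold u, u'; field).
      assert (Z2 : u * (x' + x) <= u * x' + u' * x) by (unfold u, u'; nra).
      rewrite Z1. replace ((x' ^ 2 - x ^ 2) * u ^ 2) with ((x' - x) * u * (u * (x' + x))) by ring.
      assert (0 <= u <= 1) by (unfold u; lra). assert (0 <= u * (x' + x)) by nra.
      assert ((x' - x) * u <= (x' - x)) by nra.
      assert (0 <= (x' - x) * u) by nra. nra. }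
    assert (D0 : 0 <= x' ^ 2 - x ^ 2) by nra.
    assert (D1 : 0 <= (x' ^ 2 - x ^ 2) * r) by (apply Rmult_le_pos; lra).
    assert (D2 : d * ((x' ^ 2 - x ^ 2) * r) <= f 1 / 4 * (2 * (r * x' ^ 2 - x ^ 2)))
      by (apply Rmult_le_compat; lra).
    assert (D3 : 0 <= x' ^ 2) by nra. assert (D4 : 0 <= x ^ 2) by nra.
    destruct (Rle_dec (f 1) (r * f u)).
    - assert (x' ^ 2 * (r * f u) <= x' ^ 2 * f u') by (apply Rmult_le_compat_l; lra).
      assert (f 1 * (r * x' ^ 2 - x ^ 2) <= r * f u * (r * x' ^ 2 - x ^ 2)) by (apply Rmult_le_compat_r; lra).
      apply Rmult_le_reg_l with r; auto. nra.
    - assert (x' ^ 2 * f 1 <= x' ^ 2 * f u') by (apply Rmult_le_compat_l; lra).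
      assert (x ^ 2 * (r * f u) <= x ^ 2 * f 1) by (apply Rmult_le_compat_l; lra).
      apply Rmult_le_reg_l with r; auto. nra. }
  lra.
Qed.

Lemma cone_P g f : 0 < g <= 1 -> cone f -> cone (P g f).
Proof.
intros Hg H. pose proof (cone_P_sub g f 0 Hg H) as K.
replace (P g f) with (fun x => P g f x - 0) by (apply functional_extensionality; intros; ring).
apply K. destruct H as (_ & H & _). specialize (H 1). lra.
Qed.

(** [f] is nonincreasing, so it is at least [f x] on [0,x]. *)
Lemma cone_mass_pt f x : cone f -> 0 <= x <= 1 -> x * f x <= RInt f 0 1.
Proof.
intros (A1 & A2 & A3 & A4) Hx.
rewrite <- (RInt_cat f 0 x 1); auto with cdb.
pose proof (RInt_lower f 0 x (f x) ltac:(lra) (cont_ex f _ _ A1) ltac:(intros; apply A3; lra)).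
pose proof (RInt_nonneg f x 1 ltac:(lra) (cont_ex f _ _ A1) ltac:(intros; apply A2; lra)). lra.
Qed.

(** On the left branch the factor [1 / (1 + (1 + g) s)] outweighs the growth [(1 + s)^a] of the pole
    and leaves a relative gain [(1 - a) / 2 * s]. The right branch adds at most the mass, that is
    [(1 - a) / 2 * B]. Since [s >= x^a], the gain is at least this amount; this is the origin of the
    mass condition. *)
Lemma bnd_P g a B f : 0 < g -> g <= a -> a < 1 -> 0 <= B -> cone f -> bnd a B f ->
  RInt f 0 1 <= (1 - a) / 2 * B -> bnd a B (P g f).
Proof.
intros Hg Ha Ha1 HB Hf Hb Hm x Hx.
destruct (yl_step g ltac:(lra) x ltac:(lra)) as (Y & E & S & Y2).
unfold P. rewrite cl_id by lra. unfold dlf.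
set (y := yl g x) in *. set (s := pp g (2 * y)) in *.
assert (Hy : 0 < y) by lra.
pose proof (cone_mass_pt f ((x + 1) / 2) Hf ltac:(lra)) as M.
assert (0 <= f ((x + 1) / 2)) by (apply Hf; lra).
assert (M2 : f ((x + 1) / 2) / 2 <= (1 - a) / 2 * B) by nra.
pose proof (Hb y ltac:(lra)) as Bf.
assert (Sx : Rpower x a <= s).
{ apply Rle_trans with (Rpower x g). apply Rpower_le1_anti; lra.
  unfold s. rewrite pp_pos by lra. apply Rpower_base_le; lra. }
set (w := Rpower x (- a)).
assert (Hw : 0 < w) by apply Rpower_pos.
assert (W1 : w * Rpower x a = 1).
{ unfold w. rewrite <- Rpower_plus. replace (- a + a) with 0 by ring. apply Rpower_O; lra. }
assert (Wy : Rpower y (- a) <= w * (1 + a * s)).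
{ assert (Rpower y (- a) = w * Rpower (1 + s) a).
  { unfold w. rewrite E at 1. rewrite <- Rpower_mult_distr by lra.
    rewrite Rmult_assoc, <- Rpower_plus. replace (- a + a) with 0 by ring.
    rewrite Rpower_O; lra. }
  rewrite H0. apply Rmult_le_compat_l. lra.
  pose proof (Rpower_bernoulli (1 + s) a ltac:(lra) ltac:(lra)). lra. }
assert (F1 : f y / (1 + (1 + g) * s) <= B * w * (1 - (1 - a) / 2 * s)).
{ apply Rle_div_l; [nra|]. apply Rle_trans with (B * (w * (1 + a * s))).
  - apply Rle_trans with (1 := Bf). apply Rmult_le_compat_l; auto.
  - rewrite <- (Rmult_assoc B w), (Rmult_assoc (B * w) (1 - _)). apply Rmult_le_compat_l; [nra|].
    assert (0 <= (1 - (1 - a) / 2 * s)) by nra.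
    assert ((1 - (1 - a) / 2 * s) * (1 + s) <= (1 - (1 - a) / 2 * s) * (1 + (1 + g) * s)).
    { apply Rmult_le_compat_l; nra. }
    assert (0 <= (1 - a) / 2 * s * (1 - s)). { apply Rmult_le_pos; nra. }
    nra. }
assert (B * (1 - a) / 2 <= B * w * ((1 - a) / 2 * s)).
{ assert (1 <= w * s) by nra. assert (0 <= B * (1 - a) / 2) by nra.
  replace (B * w * ((1 - a) / 2 * s)) with (B * (1 - a) / 2 * (w * s)) by field. nra. }
lra.
Qed.

Lemma power_int a u v : a < 1 -> 0 < u <= v ->
  ex_RInt (fun x => Rpower x (- a)) u v /\
  RInt (fun x => Rpower x (- a)) u v = (Rpower v (1 - a) - Rpower u (1 - a)) / (1 - a).
Proof.
intros Ha H.
assert (K : is_RInt (fun x => Rpower x (- a)) u v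
  (minus (Rpower v (1 - a) / (1 - a)) (Rpower u (1 - a) / (1 - a)))).
{ apply (is_RInt_derive (V := R_CompleteNormedModule) (fun x => Rpower x (1 - a) / (1 - a))).
  - intros x Hx. rewrite Rmin_left, Rmax_right in Hx by lra.
    apply is_derive_Reals.
    apply derivable_pt_lim_ext with (f := fun x => / (1 - a) * Rpower x (1 - a)).
    { intros; field; lra. }
    replace (Rpower x (- a)) with (/ (1 - a) * ((1 - a) * Rpower x (1 - a - 1))).
    apply derivable_pt_lim_scal. apply derivable_pt_lim_power; lra.
    replace (1 - a - 1) with (- a) by ring. field; lra.
  - intros x Hx. rewrite Rmin_left, Rmax_right in Hx by lra.
    apply continuity_pt_filterlim. apply derivable_continuous_pt.
    eexists. apply derivable_pt_lim_power; lra. }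
split. eexists; exact K. rewrite (is_RInt_unique _ _ _ _ K).
unfold minus, plus, opp; simpl. field; lra.
Qed.

(** The improper integral of the pole is avoided: on [0,d] the continuous [f] is bounded by some
    [M], and [d M] is made small, while on [d,e] the power is integrated exactly. *)
Lemma power_int_bound f a B e : cont f -> 0 <= a < 1 -> 0 <= B -> 0 < e <= 1 ->
  (forall x, 0 < x <= e -> f x <= B * Rpower x (- a)) ->
  RInt f 0 e <= B * Rpower e (1 - a) / (1 - a).
Proof.
intros Hf Ha HB He H. apply le_epsilon. intros eps Heps.
destruct (cont_bounded f 0 1 Hf) as (M & HM & KM).
set (d := Rmin e (eps / M)).
assert (Hd : 0 < d). { apply Rmin_glb_lt. lra. apply Rdiv_lt_0_compat; lra. }
assert (Hde : d <= e) by apply Rmin_l. assert (Hd2 : d <= eps / M) by apply Rmin_r.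
rewrite <- (RInt_cat f 0 d e); auto with cdb.
assert (RInt f 0 d <= (d - 0) * M).
{ apply RInt_upper; auto with cdb. lra. intros. apply Rle_trans with (1 := Rle_abs _). apply KM; lra. }
destruct (power_int a d e ltac:(lra) ltac:(lra)) as [E1 E2].
assert (RInt f d e <= B * RInt (fun x => Rpower x (- a)) d e).
{ rewrite <- RInt_mull by auto. apply RInt_le; auto with cdb. intros; apply H; lra. }
rewrite E2 in H1. pose proof (Rpower_pos d (1 - a)). 
assert (0 < / (1 - a)) by (apply Rinv_0_lt_compat; lra).
assert (d * M <= eps). { apply Rle_trans with (eps / M * M). nra. right; field; lra. }
assert (0 <= B * Rpower d (1 - a) / (1 - a)).
{ unfold Rdiv. apply Rmult_le_pos; nra. }
unfold Rdiv in *. nra.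
Qed.

(** * Iterates of the transfer operators: bounds on densities and spreading of mass *)

Fixpoint Pit (gs : nat -> R) (n : nat) (f : R -> R) : R -> R :=
  match n with O => f | S k => P (gs k) (Pit gs k f) end.

Definition shift (j : nat) (gs : nat -> R) : nat -> R := fun i => gs (j + i)%nat.

Lemma Pit_peel gs n f : Pit gs (S n) f = Pit (shift 1 gs) n (P (gs 0%nat) f).
Proof. induction n; simpl in *; auto. rewrite IHn. reflexivity. Qed.

Lemma Pit_add gs m n f : Pit gs (m + n) f = Pit (shift m gs) n (Pit gs m f).
Proof.
induction n; simpl. now rewrite Nat.add_0_r. rewrite Nat.add_succ_r. simpl. now rewrite IHn.
Qed.

Section Seq.
Variable alpha : R.
Hypothesis Halpha : 0 < alpha < 1.

Definition ok (gs : nat -> R) := forall k, 0 < gs k <= alpha.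

Lemma ok_shift j gs : ok gs -> ok (shift j gs).
Proof. intros H k; apply H. Qed.

Section Fix.
Variable gs : nat -> R.
Hypothesis Hgs : ok gs.

Lemma ok1 k : 0 < gs k <= 1.
Proof. pose proof (Hgs k). lra. Qed.

Lemma Pit_cont n f : cont f -> cont (Pit gs n f).
Proof. intros; induction n; simpl; auto. apply P_cont; auto using ok1. Qed.

Lemma Pit_cone n f : cone f -> cone (Pit gs n f).
Proof. intros; induction n; simpl; auto. apply cone_P; auto using ok1. Qed.

Lemma Pit_mass n f : cont f -> RInt (Pit gs n f) 0 1 = RInt f 0 1.
Proof. intros; induction n; simpl; auto. rewrite P_mass; auto using ok1, Pit_cont. Qed.

(** Mass is conserved, so the mass condition of [bnd_P] persists at every step. *)
Lemma Pit_bnd n f a B : alpha <= a -> a < 1 -> 0 <= B -> cone f -> bnd a B f ->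
  RInt f 0 1 <= (1 - a) / 2 * B -> bnd a B (Pit gs n f).
Proof.
intros; induction n; simpl; auto. pose proof (Hgs n). apply bnd_P; auto; try lra.
now apply Pit_cone. rewrite Pit_mass; auto with cdb.
Qed.

Lemma Pit_plus n f h : Pit gs n (fun x => f x + h x) = fun x => Pit gs n f x + Pit gs n h x.
Proof. induction n; simpl; auto. rewrite IHn. apply P_plus. Qed.

Lemma Pit_minus n f h : Pit gs n (fun x => f x - h x) = fun x => Pit gs n f x - Pit gs n h x.
Proof. induction n; simpl; auto. rewrite IHn. apply P_minus. Qed.

Lemma Pit_scal n f k : Pit gs n (fun x => k * f x) = fun x => k * Pit gs n f x.
Proof. induction n; simpl; auto. rewrite IHn. apply P_scal. Qed.

Lemma Pit_le n f h : (forall x, 0 <= x <= 1 -> f x <= h x) ->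
  forall x, 0 <= x <= 1 -> Pit gs n f x <= Pit gs n h x.
Proof.
intros H. induction n; simpl; auto. intros. apply P_le; auto using ok1.
Qed.
End Fix.

Definition cst1 (x : R) : R := 1.

Lemma cone_one : cone cst1.
Proof. apply cone_const; lra. Qed.

Lemma RInt_one : RInt cst1 0 1 = 1.
Proof. pose proof (RInt_cst 1 0 1). unfold cst1. lra. Qed.

(** The constant for which a density of mass 1 meets the mass condition of [bnd_P] at exponent
    [alpha] with equality. *)
Definition Bh := 2 / (1 - alpha).

Lemma Bh_ge : 2 <= Bh.
Proof. unfold Bh. apply Rle_div_r; nra. Qed.

Lemma h_bnd gs n : ok gs -> bnd alpha Bh (Pit gs n cst1).
Proof.
intros H. pose proof Bh_ge. apply Pit_bnd; auto using cone_one; try lra.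
- intros x Hx. unfold cst1. assert (1 <= Rpower x (- alpha)); [|nra].
  rewrite <- (Rpower_base1 (- alpha)). apply Rpower_neg_anti; lra.
- rewrite RInt_one. unfold Bh. right; field; lra.
Qed.

(** The pole bound leaves at most mass 1/2 on [0,e], hence at least 1/2 on [e,1], so [h e >= 1/2] by
    monotonicity; the growth of [x^2 h x] then gives [h 1 >= e^2 / 2], and [h] is smallest at 1. The
    bound depends on [alpha] alone, not on the sequence of maps. *)
Lemma h_low : exists D, 0 < D <= 1 /\ forall gs n x, ok gs -> 0 <= x <= 1 -> D <= Pit gs n cst1 x.
Proof.
pose proof Bh_ge.
set (e := Rpower (/ (2 * (Bh / (1 - alpha)))) (/ (1 - alpha))).
assert (Q : 2 < 2 * (Bh / (1 - alpha))).
{ assert (1 < Bh / (1 - alpha)). apply Rlt_div_r; lra. lra. }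
assert (He : 0 < e <= 1).
{ split. apply Rpower_pos. rewrite <- (Rpower_base1 (/ (1 - alpha))). unfold e.
  apply Rpower_base_le. split. apply Rinv_0_lt_compat; lra. apply (Rle_trans _ (/ 1)); [apply Rinv_le_contravar; lra|rewrite Rinv_1; lra].
  left; apply Rinv_0_lt_compat; lra. }
assert (E : Bh * Rpower e (1 - alpha) / (1 - alpha) = 1/2).
{ unfold e. rewrite Rpower_mult. replace (/ (1 - alpha) * (1 - alpha)) with 1 by (field; lra).
  rewrite Rpower_1 by (apply Rinv_0_lt_compat; lra). field. split; lra. }
exists (e ^ 2 / 2). split. { split. nra. nra. }
intros gs n x Hg Hx. pose proof (Pit_cone gs Hg n cst1 cone_one) as C.
set (h := Pit gs n cst1) in *.
assert (M : RInt h 0 1 = 1). { unfold h. rewrite Pit_mass; auto with cdb. apply RInt_one. apply cone_one. }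
rewrite <- (RInt_cat h 0 e 1) in M by auto with cdb.
pose proof (power_int_bound h alpha Bh e (cone_cont _ C) ltac:(lra) ltac:(lra) He) as I1.
rewrite E in I1. specialize (I1 ltac:(intros; apply (h_bnd gs n Hg); lra)).
assert (I2 : RInt h e 1 <= (1 - e) * h e).
{ apply RInt_upper; auto with cdb. lra. intros; apply C; lra. }
assert (0 <= h e) by (apply C; lra).
assert (e ^ 2 * h e <= 1 ^ 2 * h 1) by (apply C; lra).
assert (h 1 <= h x) by (apply C; lra).
assert (1/2 <= h e) by nra. assert (0 <= e ^ 2) by nra. nra.
Qed.

(* Induction on N, peeling off the first map: in P f = (P f - f 1 / 4) + f 1 / 4 the first
   summand stays in the cone, and the constant pays for the mass of f on [1/2,1]. *)
Lemma spread : exists c1, 0 < c1 <= 1 /\ forall N gs, ok gs ->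
  exists e, 0 < e <= 1 /\ alpha / 2 * (INR N + 1) <= Rpower e (- alpha) /\
  forall f, cone f -> forall x, 0 <= x <= 1 -> c1 * RInt f e 1 <= Pit gs N f x.
Proof.
(* In one step the mass on [e,1] exceeds that of the remainder on [e',1] by at most [(1/4 + 2) f 1],
   while the removed constant contributes at least [D f 1 / 4]; the value [D / 9] balances the
   two. *)
destruct h_low as (D & HD & KD). exists (D / 9). split. lra.
induction N as [|N IH]; intros gs Hg.
- exists 1. split; [lra|]. split.
  + simpl. rewrite Rpower_base1. lra.
  + intros f Hf x Hx. rewrite RInt_pt, Rmult_0_r. now apply Hf.
- destruct (IH (shift 1 gs) (ok_shift 1 gs Hg)) as (e' & He' & Ge & K).
  set (g := gs 0%nat). assert (Hg0 : 0 < g <= alpha) by apply Hg.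
  destruct (yl_step g ltac:(lra) e' ltac:(lra)) as (Y & E & S & Y2).
  exists (yl g e'). set (e := yl g e') in *. set (s := pp g (2 * e)) in *.
  split; [lra|]. split.
  (* One step back along the left branch: [e'^-alpha = e^-alpha (1 + s)^-alpha <= e^-alpha (1 -
     alpha s / 2)], and [e^-alpha s >= 1], so [e^-alpha] grows by at least [alpha / 2] each time. *)
  + rewrite S_INR.
    assert (Hs : Rpower e alpha <= s).
    { unfold s. rewrite pp_pos by lra. apply Rle_trans with (Rpower (2 * e) alpha).
      apply Rpower_base_le; lra. apply Rpower_le1_anti; lra. }
    set (w := Rpower e (- alpha)) in *. assert (0 < w) by apply Rpower_pos.
    assert (w * Rpower e alpha = 1).
    { unfold w. rewrite <- Rpower_plus. replace (- alpha + alpha) with 0 by ring. apply Rpower_O; lra. }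
    assert (W : Rpower e' (- alpha) = w * Rpower (/ (1 + s)) alpha).
    { rewrite E. rewrite <- Rpower_mult_distr by lra. unfold w. f_equal.
      unfold Rpower. f_equal. rewrite ln_Rinv by lra. ring. }
    assert (0 < / (1 + s)) by (apply Rinv_0_lt_compat; lra).
    pose proof (Rpower_bernoulli (/ (1 + s)) alpha H1 ltac:(lra)) as Bn.
    assert (/ (1 + s) <= 1 - s / 2).
    { apply Rmult_le_reg_l with (1 + s); [lra|]. rewrite Rinv_r by lra. nra. }
    assert (Rpower (/ (1 + s)) alpha <= 1 - alpha * s / 2) by nra.
    assert (w * Rpower (/ (1 + s)) alpha <= w * (1 - alpha * s / 2)) by (apply Rmult_le_compat_l; lra).
    assert (1 <= w * s) by nra.
    assert (alpha / 2 <= alpha / 2 * (w * s)) by nra.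
    rewrite W in Ge. nra.
  + intros f Hf x Hx. rewrite Pit_peel. fold g.
    assert (F1 : 0 <= f 1) by (apply Hf; lra).
    set (h := fun x => P g f x - f 1 / 4).
    assert (Hh : cone h) by (apply cone_P_sub; auto; lra).
    replace (P g f) with (fun x => h x + f 1 / 4 * cst1 x)
      by (apply functional_extensionality; intros; unfold h, cst1; ring).
    rewrite Pit_plus, Pit_scal.
    pose proof (K h Hh x Hx) as K1.
    pose proof (KD (shift 1 gs) N x (ok_shift 1 gs Hg) Hx) as K2.
    assert (cf : cont f) by auto with cdb.
    (* The left branch carries [e,1/2] onto [e',1], and its contribution to [P g f] is at most
       [h + f 1 / 4]. *)
    assert (I1 : RInt f e (1/2) <= RInt h e' 1 + f 1 / 4).
    { destruct (Req_dec e' 1) as [->|Ne].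
      { unfold e. rewrite yl_1 by lra. rewrite !RInt_pt. lra. }
      assert (e' < 1) by (destruct He' as [_ [|]]; [auto|contradiction]).
      destruct (subst_left g ltac:(lra) f e' 1 (fun _ => 1) cf (pw_const e' 1 1 ltac:(lra))) as [_ Q]; try lra.
      rewrite yl_1 in Q by lra. fold e in Q.
      apply Rle_trans with (RInt (fun y => f y * 1) e (1/2)).
      { right. apply RInt_eq; intros; lra. }
      rewrite Q. 
      assert (Hd : cont (fun x0 => f (yl g x0) / dlf g (yl g x0) * 1)).
      { apply cont_mult; auto with cdb. apply cont_div. apply (cont_comp f); auto. apply yl_cont; lra.
        apply (cont_comp (dlf g)). apply dlf_cont; lra. apply yl_cont; lra.
        intros z. pose proof (dlf_ge1 g (yl g z) ltac:(lra)). lra. }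
      assert (I3 : RInt (fun x0 => f (yl g x0) / dlf g (yl g x0) * 1) e' 1 <= RInt (fun x => h x + f 1 / 4) e' 1).
      { apply RInt_le; auto with cdb; try lra. intros z Hz. unfold h, P. rewrite cl_id by lra.
        assert (0 <= f ((z + 1) / 2)) by (apply Hf; lra). lra. }
      rewrite RInt_add, RInt_cst in I3; auto with cdb. nra. }
    assert (I2 : RInt f (1/2) 1 <= 2 * f 1).
    { replace (2 * f 1) with ((1 - 1/2) * (4 * f 1)) by field. apply RInt_upper; auto with cdb. lra.
      intros z Hz. assert (z ^ 2 * f z <= 1 ^ 2 * f 1) by (apply Hf; lra).
      assert (0 <= f z) by (apply Hf; lra). assert (1/4 <= z ^ 2) by nra. nra. }
    rewrite <- (RInt_cat f e (1/2) 1) by auto with cdb.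
    nra.
Qed.

End Seq.

(** * Loss of memory *)

Lemma Rpower_near_one q p : 1/2 <= q <= 1 -> 0 <= p -> 1 - 2 * p * (1 - q) <= Rpower q p.
Proof.
intros Hq Hp. unfold Rpower. eapply Rle_trans; [|apply exp_ineq1_le].
assert (1 - / q <= ln q).
{ pose proof (exp_ineq1_le (/ q - 1)) as E.
  assert (0 < / q) by (apply Rinv_0_lt_compat; lra).
  assert (ln (/ q) <= / q - 1).
  { rewrite <- (ln_exp (/ q - 1)). apply ln_le; lra. }
  rewrite ln_Rinv in H0; lra. }
assert (/ q - 1 <= 2 * (1 - q)).
{ apply Rmult_le_reg_l with q; [lra|]. rewrite Rmult_minus_distr_l, Rinv_r by lra. nra. }
nra.
Qed.

Lemma Rpower_inv_cancel x a : 0 < x -> Rpower x (- a) * Rpower x a = 1.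
Proof. intros. rewrite <- Rpower_plus. replace (- a + a) with 0 by ring. apply Rpower_O; auto. Qed.

Lemma interpolate u v w th : 0 <= u -> u <= v -> u <= w -> 0 < v -> 0 < w -> 0 <= th <= 1 ->
  u <= Rpower v (1 - th) * Rpower w th.
Proof.
intros Hu Hv Hw V W Ht. pose proof (Rpower_pos v (1 - th)). pose proof (Rpower_pos w th).
destruct (Req_dec u 0) as [->|N]. nra.
assert (E : u = Rpower u (1 - th) * Rpower u th).
{ rewrite <- Rpower_plus. replace (1 - th + th) with 1 by ring. rewrite Rpower_1; lra. }
rewrite E at 1. apply Rmult_le_compat; try (left; apply Rpower_pos); apply Rpower_base_le; lra.
Qed.

Section Seq.
Variable alpha : R.
Hypothesis Halpha : 0 < alpha < 1.
Notation ok := (ok alpha).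

Section A.
Variable a : R.
Hypothesis Ha : alpha <= a < 1.
Let p := (1 - a) / alpha.

Lemma p_pos : 0 < p.
Proof. apply Rdiv_lt_0_compat; lra. Qed.

(* Every block of about n/L steps either finds the mass already small, or lets both
   summands be bounded below, on the whole interval, by a fixed proportion of their mass. *)
Lemma coupling : exists C, 1 <= C /\ forall gs B f g, ok gs -> 0 < B ->
  cone f -> cone g -> bnd a B f -> bnd a B g -> RInt f 0 1 = RInt g 0 1 ->
  RInt f 0 1 <= (1 - a) / 2 * B -> forall n,
  exists r s, (cone r /\ cone s) /\ (bnd a B r /\ bnd a B s) /\
    (forall x, Pit gs n f x - Pit gs n g x = r x - s x) /\
    RInt r 0 1 = RInt s 0 1 /\ RInt r 0 1 <= (1 - a) / 2 * B /\
    RInt r 0 1 <= C * B * Rpower (INR n + 1) (- p).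
Proof.
destruct (spread alpha Halpha) as (c1 & Hc1 & SP).
pose proof p_pos as Hp.
destruct (nfloor_ex (32 * p / c1) ltac:(apply Rdiv_le_0_compat; nra)) as (L0 & _ & HL0).
(* Looking back over about [n / L] steps costs a factor [(1 - 2/L)^-p] in the bound;
   [L >= 32 p / c1] keeps it at most [1 / (1 - c1/8)], which is what one coupling gains. [L >= 4]
   gives [1 - 2/L >= 1/2]. *)
set (L := (L0 + 4)%nat).
assert (HL : 4 <= INR L /\ 32 * p / c1 <= INR L).
{ unfold L. rewrite plus_INR. simpl (INR 4). pose proof (pos_INR L0). lra. }
(* [C1] settles [n < L], where nothing has been coupled yet; [C2] is chosen so that a mass above the
   target has at most half of itself on [0,e]. *)
set (C1 := Rpower (INR L) p). set (C2 := 2 * Rpower (alpha / (2 * INR L)) (- p) / (1 - a)).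
assert (HC1 : 1 <= C1).
{ unfold C1. rewrite <- (Rpower_O (INR L)) by lra. apply Rle_Rpower; lra. }
assert (HC2 : 0 <= C2).
{ unfold C2. apply Rdiv_le_0_compat; [|lra]. pose proof (Rpower_pos (alpha / (2 * INR L)) (- p)). lra. }
exists (C1 + C2). split; [lra|].
intros gs B f g Hgs HB Hf Hg Bf Bg Efg Mf.
assert (Hn : forall n, 0 < INR n + 1) by (intros n; pose proof (pos_INR n); lra).
induction n as [n IH] using (well_founded_induction Wf_nat.lt_wf).
assert (Hw : 0 < Rpower (INR n + 1) (- p)) by apply Rpower_pos.
destruct (Nat.le_gt_cases L n) as [Ln|Ln].
- set (N := (n / L)%nat).
  assert (HLN : (L * N <= n)%nat) by (apply Nat.Div0.mul_div_le).
  assert (HLN2 : (n < L * S N)%nat) by (apply Nat.mul_succ_div_gt; lia).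
  assert (HN1 : (1 <= N)%nat) by (apply Nat.div_le_lower_bound; lia).
  assert (HNn : (N + 1 <= n)%nat) by nia.
  (* In the last [N + 1] steps, [N] serve to spread the mass, and in one more a constant is
     removed. *)
  set (m := (n - (N + 1))%nat).
  assert (Em : n = (m + S N)%nat) by (unfold m; lia).
  destruct (IH m ltac:(lia)) as (r & s & (Cr & Cs) & (Br & Bs) & E & M & MB & D).
  set (g' := shift m gs). assert (Hg' : ok g') by (apply ok_shift; auto).
  assert (EE : forall x, Pit gs n f x - Pit gs n g x = Pit g' (S N) r x - Pit g' (S N) s x).
  { intros x. rewrite Em, !Pit_add. fold g'.
    transitivity (Pit g' (S N) (fun x => Pit gs m f x - Pit gs m g x) x).
    rewrite Pit_minus; auto.
    replace (fun x => Pit gs m f x - Pit gs m g x) with (fun x => r x - s x)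
      by (apply functional_extensionality; intros; rewrite E; auto).
    rewrite Pit_minus; auto. }
  (* A mass already below the target is merely conserved by the remaining steps; nothing is
     removed. *)
  destruct (Rle_dec (RInt r 0 1) ((C1 + C2) * B * Rpower (INR n + 1) (- p))) as [Le|Gt].
  + exists (Pit g' (S N) r), (Pit g' (S N) s).
    assert (forall k, cont k -> RInt (Pit g' (S N) k) 0 1 = RInt k 0 1) by (intros; apply (Pit_mass alpha); auto).
    repeat split; try apply (Pit_cone alpha); auto; try (apply (Pit_bnd alpha); auto; lra);
      rewrite ?H; auto with cdb.
  + apply Rnot_le_lt in Gt. set (mu := RInt r 0 1) in *.
    destruct (SP N g' Hg') as (e & He & Ge & K).
    (* A quarter of the lower bound [c1 * mu / 2] valid at the point 1, as [cone_P_sub] allows. *)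
    set (d := c1 * mu / 8).
    assert (HCB : 0 < (C1 + C2) * B) by (apply Rmult_lt_0_compat; lra).
    assert (Hmu : 0 < mu) by (pose proof (Rmult_lt_0_compat _ _ HCB Hw); lra).
    assert (Re : forall k, cone k -> bnd a B k -> RInt k 0 1 = mu -> forall x, 0 <= x <= 1 -> c1 * mu / 2 <= Pit g' N k x).
    { intros k Ck Bk Mk x Hx. eapply Rle_trans; [|apply (K k Ck x Hx)].
      assert (RInt k 0 e <= mu / 2).
      { pose proof (power_int_bound k a B e (cone_cont _ Ck) ltac:(lra) ltac:(lra) He ltac:(intros; apply Bk; lra)) as I.
        apply Rle_trans with (1 := I).
        assert (Ee : Rpower e (1 - a) = Rpower (Rpower e (- alpha)) (- p)).
        { rewrite Rpower_mult. f_equal. unfold p. field. lra. }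
        assert (Q : Rpower (Rpower e (- alpha)) (- p) <= Rpower (alpha / (2 * INR L)) (- p) * Rpower (INR n + 1) (- p)).
        { rewrite Rpower_mult_distr; auto. 2: apply Rdiv_lt_0_compat; lra.
          apply Rpower_neg_anti; [|lra]. split.
          apply Rmult_lt_0_compat; auto. apply Rdiv_lt_0_compat; lra.
          eapply Rle_trans; [|exact Ge].
          apply lt_INR in HLN2. rewrite mult_INR, S_INR in HLN2.
          assert (INR n + 1 <= INR L * (INR N + 1)).
          { rewrite <- S_INR, <- (S_INR N), <- mult_INR. apply le_INR.
            assert (n < L * S N)%nat by (apply Nat.mul_succ_div_gt; lia). lia. }
          replace (alpha / (2 * INR L) * (INR n + 1)) with (alpha / 2 * ((INR n + 1) / INR L)) by (field; lra).
          apply Rmult_le_compat_l. lra. apply Rle_div_l; lra. }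
        rewrite Ee. apply Rle_trans with (C2 * B * Rpower (INR n + 1) (- p) / 2).
        2:{ assert (0 <= B * Rpower (INR n + 1) (- p)) by nra. nra. }
        unfold C2. set (X := Rpower (alpha / (2 * INR L)) (- p)) in *. set (Y := Rpower (INR n + 1) (- p)) in *.
        replace (2 * X / (1 - a) * B * Y / 2) with (B * (X * Y) / (1 - a)) by (field; lra).
        apply Rmult_le_compat_r. left; apply Rinv_0_lt_compat; lra.
        apply Rmult_le_compat_l; lra. }
      rewrite <- (RInt_cat k 0 e 1) in Mk by auto with cdb. nra. }
    pose proof (Re r Cr Br eq_refl) as Rr. pose proof (Re s Cs Bs (eq_sym M)) as Rs.
    exists (fun x => P (g' N) (Pit g' N r) x - d), (fun x => P (g' N) (Pit g' N s) x - d).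
    assert (Hd : 0 <= d) by (unfold d; nra).
    assert (G1 : 0 < g' N <= 1) by (specialize (Hg' N); lra).
    assert (Cpr : cone (Pit g' N r)) by (apply (Pit_cone alpha); auto).
    assert (Cps : cone (Pit g' N s)) by (apply (Pit_cone alpha); auto).
    assert (Mr : RInt (fun x => P (g' N) (Pit g' N r) x - d) 0 1 = mu - d).
    { rewrite RInt_sub, RInt_cst; auto with cdb. 2: apply cont_ex, P_cont; auto with cdb.
      rewrite P_mass, (Pit_mass alpha); auto with cdb. fold mu. eqR; ring. }
    assert (Ms : RInt (fun x => P (g' N) (Pit g' N s) x - d) 0 1 = mu - d).
    { rewrite RInt_sub, RInt_cst; auto with cdb. 2: apply cont_ex, P_cont; auto with cdb.
      rewrite P_mass, (Pit_mass alpha); auto with cdb. rewrite <- M. fold mu. eqR; ring. }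
    split; [split|split; [split|split; [|split; [|split]]]].
    * apply cone_P_sub; auto. specialize (Rr 1 ltac:(lra)). split; auto. unfold d. lra.
    * apply cone_P_sub; auto. specialize (Rs 1 ltac:(lra)). split; auto. unfold d. lra.
    * intros x Hx. pose proof (Pit_bnd alpha Halpha g' Hg' (S N) r a B ltac:(lra) ltac:(lra) ltac:(lra) Cr Br MB x Hx).
      simpl in H. lra.
    * intros x Hx. pose proof (Pit_bnd alpha Halpha g' Hg' (S N) s a B ltac:(lra) ltac:(lra) ltac:(lra) Cs Bs ltac:(lra) x Hx).
      simpl in H. lra.
    * intros x. rewrite EE. simpl. ring.
    * lra.
    * lra.
    * rewrite Mr. replace (mu - d) with ((1 - c1 / 8) * mu) by (unfold d; field).
      apply Rle_trans with ((1 - c1 / 8) * ((C1 + C2) * B * Rpower (INR m + 1) (- p))).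
      { apply Rmult_le_compat_l; lra. }
      replace ((1 - c1 / 8) * ((C1 + C2) * B * Rpower (INR m + 1) (- p)))
        with ((C1 + C2) * B * ((1 - c1 / 8) * Rpower (INR m + 1) (- p))) by ring.
      apply Rmult_le_compat_l. lra.
      set (q := 1 - 2 / INR L).
      assert (Hq : 1/2 <= q <= 1).
      { unfold q. assert (0 <= 2 / INR L) by (apply Rdiv_le_0_compat; lra).
        assert (2 / INR L <= 1/2) by (apply Rle_div_l; lra). lra. }
      assert (Hqm : q * (INR n + 1) <= INR m + 1).
      { assert (Enr : INR n = INR m + (INR N + 1)) by (rewrite Em at 1; rewrite plus_INR, S_INR; ring).
        assert (INR L * (INR N + 1) <= 2 * INR n).
        { rewrite <- S_INR, <- mult_INR. replace 2 with (INR 2) by reflexivity. rewrite <- mult_INR. apply le_INR. nia. }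
        assert (INR N + 1 <= 2 / INR L * (INR n + 1)).
        { apply Rmult_le_reg_l with (INR L); [lra|].
          replace (INR L * (2 / INR L * (INR n + 1))) with (2 * (INR n + 1)) by (field; lra). lra. }
        unfold q. lra. }
      apply Rle_trans with ((1 - c1 / 8) * (Rpower q (- p) * Rpower (INR n + 1) (- p))).
      { apply Rmult_le_compat_l. lra. rewrite Rpower_mult_distr; auto; try lra.
        apply Rpower_neg_anti; [|lra]. split; auto. apply Rmult_lt_0_compat; auto; lra. }
      assert (1 - c1 / 8 <= Rpower q p).
      { eapply Rle_trans; [|apply (Rpower_near_one q p); lra].
        unfold q. replace (2 * p * (1 - (1 - 2 / INR L))) with (4 * p / INR L) by (field; lra).
        assert (4 * p / INR L <= c1 / 8); [|lra].
        apply Rle_div_l; [lra|]. destruct HL as [_ HL]. apply Rle_div_l in HL; nra. }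
      pose proof (Rpower_inv_cancel q p ltac:(lra)). pose proof (Rpower_pos q (- p)).
      assert ((1 - c1 / 8) * Rpower q (- p) <= 1) by nra.
      rewrite <- Rmult_assoc. nra.
- exists (Pit gs n f), (Pit gs n g).
  rewrite !(Pit_mass alpha); auto with cdb.
  repeat split; try apply (Pit_cone alpha); auto; try (apply (Pit_bnd alpha); auto; lra).
  apply Rle_trans with (1 := Mf).
  assert (1 <= C1 * Rpower (INR n + 1) (- p)).
  { unfold C1. apply Rle_trans with (Rpower (INR L) p * Rpower (INR L) (- p)).
    rewrite Rmult_comm, Rpower_inv_cancel; lra.
    apply Rmult_le_compat_l. left; apply Rpower_pos. apply Rpower_neg_anti; [|lra]. split; auto.
    rewrite <- S_INR. apply le_INR. lia. }
  assert (0 <= C2 * Rpower (INR n + 1) (- p)) by nra.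
  replace ((C1 + C2) * B * Rpower (INR n + 1) (- p))
    with (B * (C1 * Rpower (INR n + 1) (- p)) + B * (C2 * Rpower (INR n + 1) (- p))) by ring.
  nra.
Qed.

End A.
End Seq.

(** * Regularity classes with a pole at the neutral fixed point *)

Definition Reg (a A : R) (g : R -> R) : Prop :=
  (forall x, 0 < x <= 1 -> Rabs (g x) <= A * Rpower x (- a)) /\
  (forall x y, 0 < x -> x <= y -> y <= 1 ->
     Rabs (g x - g y) <= A * Rpower x (- a) * (1 - x / y)).

Lemma Rpower_neg_ge1 x a : 0 < x <= 1 -> 0 <= a -> 1 <= Rpower x (- a).
Proof. intros. rewrite <- (Rpower_base1 (- a)). apply Rpower_neg_anti; lra. Qed.

Lemma Rpower_neg_le x a b : 0 < x <= 1 -> a <= b -> Rpower x (- a) <= Rpower x (- b).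
Proof. intros; apply Rpower_le1_anti; lra. Qed.

Lemma ratio_range x y : 0 < x -> x <= y -> 0 < x / y <= 1.
Proof.
intros. split. apply Rdiv_lt_0_compat; lra. apply (Rdiv_le_1 x y); lra.
Qed.

Lemma Reg_weaken a b A B g : Reg a A g -> 0 <= A <= B -> a <= b -> Reg b B g.
Proof.
intros [H1 H2] HA Hab.
assert (W : forall x, 0 < x <= 1 -> A * Rpower x (- a) <= B * Rpower x (- b)).
{ intros x Hx. pose proof (Rpower_pos x (- a)). pose proof (Rpower_neg_le x a b Hx Hab).
  apply Rmult_le_compat; lra. }
split; intros.
- eapply Rle_trans; [apply H1|apply W]; auto.
- eapply Rle_trans; [apply H2; auto|]. pose proof (ratio_range x y H H0).
  apply Rmult_le_compat_r. lra. apply W; lra.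
Qed.

Lemma Reg_plus a A B f g : Reg a A f -> Reg a B g -> Reg a (A + B) (fun x => f x + g x).
Proof.
intros [F1 F2] [G1 G2]. split; intros.
- specialize (F1 x H); specialize (G1 x H). eapply Rle_trans; [apply Rabs_triang|]. lra.
- specialize (F2 x y H H0 H1); specialize (G2 x y H H0 H1).
  replace (f x + g x - (f y + g y)) with ((f x - f y) + (g x - g y)) by ring.
  eapply Rle_trans; [apply Rabs_triang|]. lra.
Qed.

Lemma Reg_scal a A k f : Reg a A f -> Reg a (Rabs k * A) (fun x => k * f x).
Proof.
intros [F1 F2]. pose proof (Rabs_pos k). split; intros.
- rewrite Rabs_mult. specialize (F1 x H0). nra.
- rewrite <- Rmult_minus_distr_l, Rabs_mult. specialize (F2 x y H0 H1 H2). nra.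
Qed.

Lemma Reg_mult a b A B f g : 0 <= b -> 0 <= A -> 0 <= B -> Reg a A f -> Reg b B g ->
  Reg (a + b) (2 * A * B) (fun x => f x * g x).
Proof.
intros Hb HA HB [F1 F2] [G1 G2].
assert (E : forall x, Rpower x (- (a + b)) = Rpower x (- a) * Rpower x (- b)).
{ intros. rewrite <- Rpower_plus. f_equal; ring. }
assert (PP : forall x u, 0 <= A * Rpower x u) by (intros; apply Rmult_le_pos; auto; left; apply Rpower_pos).
assert (QQ : forall x u, 0 <= B * Rpower x u) by (intros; apply Rmult_le_pos; auto; left; apply Rpower_pos).
split; intros.
- rewrite Rabs_mult, E. specialize (F1 x H); specialize (G1 x H).
  pose proof (Rmult_le_compat _ _ _ _ (Rabs_pos (f x)) (Rabs_pos (g x)) F1 G1).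
  specialize (PP x (- a)). specialize (QQ x (- b)). nra.
- rewrite E. replace (f x * g x - f y * g y) with ((f x - f y) * g y + f x * (g x - g y)) by ring.
  eapply Rle_trans; [apply Rabs_triang|]. rewrite !Rabs_mult.
  pose proof (F2 x y H H0 H1) as F2'. pose proof (G2 x y H H0 H1) as G2'.
  assert (Gy : Rabs (g y) <= B * Rpower x (- b)).
  { eapply Rle_trans; [apply G1; lra|]. apply Rmult_le_compat_l; auto. apply Rpower_neg_anti; lra. }
  pose proof (F1 x ltac:(lra)) as F1'.
  pose proof (Rmult_le_compat _ _ _ _ (Rabs_pos _) (Rabs_pos _) F2' Gy).
  pose proof (Rmult_le_compat _ _ _ _ (Rabs_pos _) (Rabs_pos _) F1' G2'). nra.
Qed.

Lemma Reg_const a k : 0 <= a -> Reg a (Rabs k) (fun _ => k).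
Proof.
intros Ha. pose proof (Rabs_pos k). split; intros.
- pose proof (Rpower_neg_ge1 x a H0 Ha). nra.
- unfold Rminus at 1. rewrite Rplus_opp_r, Rabs_R0. pose proof (ratio_range x y H0 H1).
  pose proof (Rpower_pos x (- a)). apply Rmult_le_pos; nra.
Qed.

(** With [t = x / y], growth of [x^2 r x] means [r y >= t^2 r x], and [1 - t^2 <= 2 (1 - t)]. *)
Lemma cone_diff r x y : cone r -> 0 < x -> x <= y -> y <= 1 ->
  0 <= r x - r y <= 2 * r x * (1 - x / y).
Proof.
intros (A1 & A2 & A3 & A4) Hx Hxy Hy. split. specialize (A3 x y); lra.
pose proof (A2 x ltac:(lra)) as R0. pose proof (A4 x y ltac:(lra) Hxy Hy) as Q.
pose proof (ratio_range x y Hx Hxy) as T. set (t := x / y) in *.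
assert (E : x = t * y) by (unfold t; field; lra).
assert (t ^ 2 * r x <= r y).
{ apply Rmult_le_reg_l with (y ^ 2). nra. rewrite E in Q at 1.
  replace (y ^ 2 * (t ^ 2 * r x)) with ((t * y) ^ 2 * r x) by ring. lra. }
assert (0 <= r x * (1 - t) ^ 2) by (apply Rmult_le_pos; nra). nra.
Qed.

Lemma Reg_cone a B r : 0 <= B -> cone r -> bnd a B r -> Reg a (2 * B) r.
Proof.
intros HB Hr Hb.
assert (K : forall x, 0 < x <= 1 -> 0 <= r x <= B * Rpower x (- a)).
{ intros x Hx; split. apply Hr; lra. apply Hb; auto. }
split; intros.
- specialize (K x H). rewrite Rabs_pos_eq; lra.
- destruct (cone_diff r x y Hr H H0 H1). rewrite Rabs_pos_eq by lra.
  specialize (K x ltac:(lra)). pose proof (ratio_range x y H H0). nra.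
Qed.

(** The factor [h x] of [cone_diff] cancels in [1 / h y - 1 / h x], leaving [2 (1 - x/y) / h y].
    Hence division by a density costs no exponent, although the class of the densities themselves
    has a pole. *)
Lemma Reg_inv a D h : 0 < D -> cone h -> (forall x, 0 <= x <= 1 -> D <= h x) ->
  0 <= a -> Reg a (2 / D) (fun x => / h x).
Proof.
intros HD Hh Hl Ha.
assert (HD' : 0 < / D) by (apply Rinv_0_lt_compat; lra).
split; intros.
- specialize (Hl x ltac:(lra)). rewrite Rabs_pos_eq by (left; apply Rinv_0_lt_compat; lra).
  pose proof (Rpower_neg_ge1 x a H Ha).
  assert (/ h x <= / D) by (apply Rinv_le_contravar; lra). unfold Rdiv. nra.
- destruct (cone_diff h x y Hh H H0 H1) as [L1 L2].
  pose proof (Hl x ltac:(lra)) as Lx. pose proof (Hl y ltac:(lra)) as Ly.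
  pose proof (ratio_range x y H H0). pose proof (Rpower_neg_ge1 x a ltac:(lra) Ha) as W.
  assert (E : / h y - / h x = (h x - h y) * (/ h x * / h y)) by (field; lra).
  assert (0 < / h x) by (apply Rinv_0_lt_compat; lra). assert (0 < / h y) by (apply Rinv_0_lt_compat; lra).
  assert (/ h y <= / D) by (apply Rinv_le_contravar; lra).
  rewrite Rabs_minus_sym, E. rewrite Rabs_pos_eq by (apply Rmult_le_pos; nra).
  apply Rle_trans with (2 * h x * (1 - x / y) * (/ h x * / h y)).
  { apply Rmult_le_compat_r; nra. }
  replace (2 * h x * (1 - x / y) * (/ h x * / h y)) with (2 * (1 - x / y) * / h y) by (field; repeat split; lra).
  unfold Rdiv at 2. apply Rle_trans with (2 * (1 - x / y) * / D). nra.
  assert (0 <= 2 * (1 - x / y) * / D) by (apply Rmult_le_pos; nra). nra.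
Qed.

(** The modulus [1 - x/y] is scale invariant, which makes the class stable under inverse branches:
    such a [u] brings the ratio [x/y] closer to 1, and moves a point towards 0 by a factor of at
    most 2. *)
Lemma Reg_comp a A f (u : R -> R) : 0 <= a -> 0 <= A -> Reg a A f ->
  (forall x, 0 < x <= 1 -> x / 2 <= u x <= 1) ->
  (forall x y, 0 < x -> x <= y -> y <= 1 -> u x <= u y /\ x * u y <= y * u x) ->
  Reg a (A * Rpower (1/2) (- a)) (fun x => f (u x)).
Proof.
intros Ha HA [F1 F2] U1 U2.
assert (W : forall x, 0 < x <= 1 -> A * Rpower (u x) (- a) <= A * Rpower (1/2) (- a) * Rpower x (- a)).
{ intros x Hx. specialize (U1 x Hx). rewrite Rmult_assoc, Rpower_mult_distr by lra.
  apply Rmult_le_compat_l; auto. apply Rpower_neg_anti; lra. }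
split; intros.
- pose proof (U1 x H). eapply Rle_trans; [apply F1; lra|apply W; auto].
- pose proof (U1 x ltac:(lra)). pose proof (U1 y ltac:(lra)). destruct (U2 x y H H0 H1).
  eapply Rle_trans; [apply F2; lra|].
  pose proof (W x ltac:(lra)). pose proof (Rpower_pos (u x) (- a)).
  assert (x / y <= u x / u y).
  { apply (Rle_div_r (x / y)); [lra|]. apply Rmult_le_reg_l with y; [lra|].
    replace (y * (x / y * u y)) with (x * u y) by (field; lra). lra. }
  pose proof (ratio_range (u x) (u y) ltac:(lra) ltac:(lra)).
  apply Rmult_le_compat; try lra. apply Rmult_le_pos; lra.
Qed.

(** The values of [1 / dlf] at two points differ by at most [2 (s' - s)]. By [pp_ratio] and
    [yl_ratio], [s >= (yl g x / yl g y) s' >= (x/y) s'], and [s' <= 1], so [s' - s <= 1 - x/y]. *)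
Lemma Reg_invdlf g : 0 < g <= 1 -> Reg 0 2 (fun x => / dlf g (yl g x)).
Proof.
intros Hg.
assert (K : forall x, 0 < x <= 1 -> 1 <= dlf g (yl g x)) by (intros; apply dlf_ge1; lra).
assert (I : forall x, 0 < x <= 1 -> 0 < / dlf g (yl g x) <= 1).
{ intros x Hx; specialize (K x Hx). split. apply Rinv_0_lt_compat; lra.
  apply (Rle_trans _ (/ 1)); [apply Rinv_le_contravar; lra|rewrite Rinv_1; lra]. }
split; intros.
- specialize (I x H). pose proof (Rpower_neg_ge1 x 0 H ltac:(lra)). rewrite Rabs_pos_eq; lra.
- pose proof (Rpower_neg_ge1 x 0 ltac:(lra) ltac:(lra)) as W.
  pose proof (ratio_range x y H H0) as T.
  apply Rle_trans with (2 * (1 - x / y)); [|nra].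
  destruct (yl_step g Hg x ltac:(lra)) as (Yx & _ & Sx & Y2x). destruct (yl_step g Hg y ltac:(lra)) as (Yy & _ & Sy & Y2y).
  pose proof (yl_mono g Hg x y ltac:(lra) H0 H1) as M. pose proof (yl_ratio g Hg x y H H0 H1) as Q.
  pose proof (pp_mono g (2 * yl g x) (2 * yl g y) ltac:(lra) ltac:(lra)) as PM.
  pose proof (pp_ratio g (2 * yl g x) (2 * yl g y) ltac:(lra) ltac:(lra)) as PR.
  pose proof (I x ltac:(lra)) as Ix. pose proof (I y ltac:(lra)) as Iy.
  pose proof (K x ltac:(lra)) as Kx. pose proof (K y ltac:(lra)) as Ky.
  set (s := pp g (2 * yl g x)) in *. set (s' := pp g (2 * yl g y)) in *.
  assert (E : / dlf g (yl g x) - / dlf g (yl g y) =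
    (1 + g) * (s' - s) * (/ dlf g (yl g x) * / dlf g (yl g y))).
  { unfold dlf in *. fold s in Kx |- *. fold s' in Ky |- *. field. lra. }
  rewrite E. rewrite Rabs_pos_eq by (apply Rmult_le_pos; nra).
  assert (s' - s <= 1 - x / y).
  { assert (x / y * s' <= s); [|nra].
    apply Rmult_le_reg_l with (2 * yl g y); [lra|].
    apply Rle_trans with (2 * yl g x * s'); [|lra].
    assert (x / y * yl g y <= yl g x).
    { apply Rmult_le_reg_l with y; [lra|]. replace (y * (x / y * yl g y)) with (x * yl g y) by (field; lra). lra. }
    nra. }
  assert (0 <= (1 + g) * (s' - s) <= 2 * (1 - x / y)) by nra.
  assert (0 <= / dlf g (yl g x) * / dlf g (yl g y) <= 1) by nra.
  nra.
Qed.

(** A factor 10 would be useless under iteration; the lemma serves single steps only, while iterates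
    are controlled through the cone. *)
Lemma Reg_P g a A f : 0 < g <= 1 -> 0 <= a <= 1 -> 0 <= A -> Reg a A f -> Reg a (10 * A) (P g f).
Proof.
intros Hg Ha HA Hf.
assert (HH : Rpower (1/2) (- a) <= 2).
{ apply Rle_trans with (Rpower (1/2) (- (1))). apply Rpower_neg_le; lra.
  rewrite Rpower_Ropp, Rpower_1; lra. }
assert (R1 : Reg a (A * Rpower (1/2) (- a)) (fun x => f (yl g x))).
{ apply Reg_comp; try lra; auto.
  - intros x Hx. destruct (yl_step g Hg x ltac:(lra)) as (Yx & _ & Sx & Y2x). lra.
  - intros. split. apply yl_mono; lra. apply yl_ratio; auto. }
assert (R2 : Reg a (A * Rpower (1/2) (- a)) (fun x => f ((cl x + 1) / 2))).
{ apply Reg_comp; try lra; auto.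
  - intros x Hx. rewrite cl_id by lra. lra.
  - intros. rewrite !cl_id by lra. split; nra. }
pose proof (Rpower_pos (1/2) (- a)).
pose proof (Reg_mult a 0 (A * Rpower (1/2) (- a)) 2 _ _ ltac:(lra) ltac:(apply Rmult_le_pos; lra) ltac:(lra) R1 (Reg_invdlf g Hg)) as R3.
pose proof (Reg_scal _ _ (1/2) _ R2) as R4.
rewrite Rplus_0_r in R3. pose proof (Reg_plus _ _ _ _ _ R3 R4) as R5.
rewrite (Rabs_pos_eq (1/2)) in R5 by lra.
replace (P g f) with (fun x => f (yl g x) * / dlf g (yl g x) + 1 / 2 * f ((cl x + 1) / 2)).
2:{ apply functional_extensionality; intros; unfold P; field. pose proof (dlf_ge1 g (yl g x)); lra. }
eapply Reg_weaken; [exact R5| |lra]. split; nra.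
Qed.

(** * Decay of mean-zero functions in the regularity classes *)

Section Seq.
Variable alpha : R.
Hypothesis Halpha : 0 < alpha < 1.
Notation ok := (ok alpha).

(* Members of the cone are continuous at 0, so [g + B x^-a] and [B x^-a] are cut off at [eta]. *)
Lemma cone_trunc psi eta : 0 < eta <= 1 ->
  cont (fun x => psi (Rmax (cl x) eta)) ->
  (forall x, 0 < x <= 1 -> 0 <= psi x) ->
  (forall x y, 0 < x -> x <= y -> y <= 1 -> psi y <= psi x /\ x ^ 2 * psi x <= y ^ 2 * psi y) ->
  cone (fun x => psi (Rmax (cl x) eta)).
Proof.
intros He Hc Hp Hm.
assert (R : forall x, 0 <= x <= 1 -> 0 < Rmax (cl x) eta <= 1 /\ x <= Rmax (cl x) eta).
{ intros x Hx. rewrite cl_id by auto. unfold Rmax; destruct Rle_dec; lra. }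
assert (M : forall x y, 0 <= x -> x <= y -> y <= 1 -> Rmax (cl x) eta <= Rmax (cl y) eta).
{ intros. rewrite !cl_id by lra. unfold Rmax; repeat destruct Rle_dec; lra. }
repeat split; auto.
- intros. apply Hp, R; auto.
- intros. destruct (R x); [lra|]. destruct (R y); [lra|]. apply Hm; try lra. apply M; auto.
- intros x y H0 H1 H2. destruct (R x) as [Rx Rx']; [lra|]. destruct (R y) as [Ry Ry']; [lra|].
  specialize (M x y H0 H1 H2). destruct (Hm _ _ (proj1 Rx) M (proj2 Ry)) as [N1 N2].
  pose proof (Hp _ Rx) as Px. pose proof (Hp _ Ry) as Py.
  unfold Rmax in *. rewrite !cl_id in * by lra.
  destruct (Rle_dec x eta), (Rle_dec y eta); try nra.
  + apply Rmult_le_compat_r; auto. apply pow_incr; lra.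
  + assert (x ^ 2 <= eta ^ 2) by (apply pow_incr; lra). nra.
Qed.

(** On the logarithmic scale [g] varies at rate at most [A x^-a], while the added power decreases at
    rate [3 A x^-a]. The 3 is what the growth of [x^2 psi x] requires: [2 A] for the size of [g]
    times the increment of [x^2], and [A] for the oscillation of [g]. *)
Lemma Reg_plus_power_mono a A g : 0 < a < 1 -> 0 <= A -> Reg a A g ->
  let psi := fun x => g x + 3 * A / a * Rpower x (- a) in
  (forall x, 0 < x <= 1 -> 0 <= psi x) /\
  (forall x y, 0 < x -> x <= y -> y <= 1 -> psi y <= psi x /\ x ^ 2 * psi x <= y ^ 2 * psi y).
Proof.
intros Ha HA [G1 G2] psi.
assert (HB : 3 * A <= 3 * A / a). { apply (Rle_div_r (3 * A)); nra. }
split.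
- intros x Hx. unfold psi. specialize (G1 x Hx). apply Rabs_le_between in G1.
  pose proof (Rpower_pos x (- a)). nra.
- intros x y Hx Hxy Hy. specialize (G2 x y Hx Hxy Hy). apply Rabs_le_between in G2.
  pose proof (G1 y ltac:(lra)) as Gy. apply Rabs_le_between in Gy.
  pose proof (ratio_range x y Hx Hxy) as T. set (t := x / y) in *.
  assert (Ex : x = t * y) by (unfold t; field; lra).
  pose proof (Rpower_bernoulli t a ltac:(lra) ltac:(lra)) as Bn.
  pose proof (Rpower_pos x (- a)) as Wx. pose proof (Rpower_pos y (- a)) as Wy.
  assert (E : Rpower y (- a) = Rpower x (- a) * Rpower t a).
  { rewrite Ex at 1. rewrite <- Rpower_mult_distr by lra.
    rewrite (Rmult_comm (Rpower t (- a))), Rmult_assoc, Rpower_inv_cancel by lra. ring. }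
  unfold psi. set (B := 3 * A / a) in *. assert (HBa : B * a = 3 * A) by (unfold B; field; lra).
  set (wx := Rpower x (- a)) in *. set (wy := Rpower y (- a)) in *. split.
  + assert (wy <= wx * (1 - a * (1 - t))) by (rewrite E; apply Rmult_le_compat_l; lra).
    assert (0 <= A * wx * (1 - t)) by (apply Rmult_le_pos; nra).
    assert (B * wy <= B * (wx * (1 - a * (1 - t)))) by (apply Rmult_le_compat_l; nra).
    replace (B * (wx * (1 - a * (1 - t)))) with (B * wx - (B * a) * (wx * (1 - t))) in H1 by ring.
    rewrite HBa in H1. lra.
  + (* x w_x <= y w_y, as x^(1-a) is increasing *)
    assert (XY : x * wx <= y * wy).
    { assert (forall z, 0 < z -> z * Rpower z (- a) = Rpower z (1 - a)).
      { intros z Hz. rewrite <- (Rpower_1 z Hz) at 1. rewrite <- Rpower_plus. f_equal; ring. }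
      unfold wx, wy. rewrite !H by lra. apply Rpower_base_le; lra. }
    set (u := y * wy) in *.
    assert (Hu : 0 < u) by (unfold u; nra).
    assert (K1 : (y - x) * u <= y ^ 2 * wy - x ^ 2 * wx).
    { replace (y ^ 2 * wy) with (y * u) by (unfold u; ring). nra. }
    assert (K2 : - A * (2 * ((y - x) * u)) <= (y ^ 2 - x ^ 2) * g y).
    { assert (- (A * wy) * (y ^ 2 - x ^ 2) <= g y * (y ^ 2 - x ^ 2)) by (apply Rmult_le_compat_r; nra).
      assert (A * wy * (y ^ 2 - x ^ 2) <= A * wy * (2 * y * (y - x))) by (apply Rmult_le_compat_l; nra).
      replace (A * wy * (2 * y * (y - x))) with (A * (2 * ((y - x) * u))) in H0 by (unfold u; ring). lra. }
    assert (K3 : - A * ((y - x) * u) <= x ^ 2 * (g y - g x)).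
    { assert (x ^ 2 * (g x - g y) <= x ^ 2 * (A * wx * (1 - t))) by (apply Rmult_le_compat_l; nra).
      replace (x ^ 2 * (A * wx * (1 - t))) with (A * (x * wx) * (x * (1 - t))) in H by ring.
      assert (0 <= x * (1 - t) <= y - x) by (rewrite Ex; nra).
      assert (A * (x * wx) * (x * (1 - t)) <= A * u * (y - x)).
      { assert (0 <= x * wx) by nra. apply Rmult_le_compat; nra. }
      nra. }
    assert (3 * A * ((y - x) * u) <= B * (y ^ 2 * wy - x ^ 2 * wx)).
    { apply Rmult_le_compat; nra. }
    nra.
Qed.

Lemma Rpower_trunc_cont a eta : 0 < a -> 0 < eta -> cont (fun x => Rpower (Rmax (cl x) eta) (- a)).
Proof.
intros Ha He.
assert (M : forall x, 0 < Rmax (cl x) eta) by (intros; apply Rlt_le_trans with (1 := He), Rmax_r).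
replace (fun x => Rpower (Rmax (cl x) eta) (- a)) with (fun x => / pp a (Rmax (cl x) eta)).
2:{ apply functional_extensionality; intros. rewrite pp_pos by auto. now rewrite Rpower_Ropp. }
apply cont_inv. apply (cont_comp (pp a)); auto using pp_cont with cdb.
intros. rewrite pp_pos by auto. pose proof (Rpower_pos (Rmax (cl x) eta) a). lra.
Qed.

Lemma trunc_close g e : cont g -> 0 < e -> exists eta, 0 < eta <= 1 /\
  forall x, 0 <= x <= 1 -> Rabs (g x - g (Rmax (cl x) eta)) <= e.
Proof.
intros Hg He. destruct (cont_at g 0 (e / 2) Hg ltac:(lra)) as (d & Hd & K).
exists (Rmin 1 (d / 2)). assert (Rmin 1 (d / 2) <= d / 2) by apply Rmin_r.
split. split. apply Rmin_glb_lt; lra. apply Rmin_l.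
intros x Hx. rewrite cl_id by auto. unfold Rmax. destruct Rle_dec as [L|L].
- pose proof (K x ltac:(rewrite Rabs_pos_eq; lra)) as K1.
  pose proof (K (Rmin 1 (d / 2)) ltac:(rewrite Rabs_pos_eq; lra)) as K2.
  apply Rabs_def2 in K1. apply Rabs_def2 in K2. apply Rabs_le. lra.
- unfold Rminus; rewrite Rplus_opp_r, Rabs_R0; lra.
Qed.

Section A.
Variable a : R.
Hypothesis Ha : alpha <= a < 1.
Let p := (1 - a) / alpha.

Lemma le_of_eps X Y Z A : 0 < A -> 0 <= Z -> (forall e, 0 < e <= A -> X <= Y + e * Z) -> X <= Y.
Proof.
intros HA HZ H. apply le_epsilon. intros eps He.
set (e := Rmin A (eps / (Z + 1))).
assert (0 < e) by (apply Rmin_glb_lt; [auto|apply Rdiv_lt_0_compat; lra]).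
assert (e <= A) by apply Rmin_l. assert (E : e <= eps / (Z + 1)) by apply Rmin_r.
specialize (H e ltac:(lra)). apply Rle_div_r in E; nra.
Qed.

(** After coupling, each of the two cone members [q] satisfies both [q x <= B x^-a] and, by
    monotonicity, [q x <= M / x] with [M] a bound on its mass. The weight [th] trades exponent for
    decay between these bounds, and [cone_diff] yields the oscillation. The decomposition holds up
    to a truncation error of size [e], and its members change with [e], so only the pointwise
    inequalities pass to the limit. *)
Lemma Reg_decay th : 0 <= th <= 1 -> exists C, 0 < C /\ forall gs A g, ok gs -> 0 < A ->
  cont g -> Reg a A g -> RInt g 0 1 = 0 -> forall n,
  Reg (a * (1 - th) + th) (C * A * Rpower (INR n + 1) (- (p * th))) (Pit gs n g).
Proof.
intros Hth. destruct (coupling alpha Halpha a Ha) as (C & HC & CP). fold p in CP.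
(* [(3 + 3/a) A] bounds both summands against [x^-a]; one factor [1 / (1 - a)] comes from
   integrating this bound, and [2 / (1 - a)] from the mass condition of [bnd_P]. *)
set (K := (3 + 3 / a) * (2 / (1 - a) ^ 2)).
assert (Ha3 : 3 <= 3 / a) by (apply Rle_div_r; lra).
assert (Hk2 : 2 <= 2 / (1 - a) ^ 2) by (apply Rle_div_r; nra).
assert (HK : 0 < K) by (unfold K; nra).
exists (4 * K * C). split. nra.
intros gs A g Hgs HA Hg Rg Mg n.
set (B := K * A). assert (HB : 0 < B) by (unfold B; nra).
assert (Hn : 0 < INR n + 1) by (pose proof (pos_INR n); lra).
set (E := fun x => B * C * Rpower (INR n + 1) (- (p * th)) * Rpower x (- (a * (1 - th) + th))).
assert (DEC : forall e, 0 < e <= A -> exists r s w, cone r /\ cone s /\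
  (forall x, 0 < x <= 1 -> r x <= E x) /\ (forall x, 0 < x <= 1 -> s x <= E x) /\
  (forall x, Pit gs n g x = r x - s x + w x) /\
  (forall x, 0 < x <= 1 -> Rabs (w x) <= e * (2 * (Bh alpha * Rpower x (- alpha))))).
{ intros e He. destruct (trunc_close g e Hg ltac:(lra)) as (eta & Heta & Cl).
  set (m := fun x => Rmax (cl x) eta).
  set (B0 := 3 * A / a).
  assert (Hm : forall x, 0 < x <= 1 -> 0 < m x <= 1 /\ x <= m x).
  { intros x Hx. unfold m. rewrite cl_id by lra. unfold Rmax; destruct Rle_dec; lra. }
  assert (cgm : cont (fun x => g (m x))) by (apply (cont_comp g); unfold m; auto with cdb).
  assert (cpm : cont (fun x => Rpower (m x) (- a))) by (apply Rpower_trunc_cont; lra).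
  set (f1 := fun x => g (m x) + B0 * Rpower (m x) (- a)).
  set (f2 := fun x => 0 + B0 * Rpower (m x) (- a)).
  assert (C1 : cone f1).
  { destruct (Reg_plus_power_mono a A g) as [M1 M2]; auto; try lra.
    apply (cone_trunc (fun x => g x + B0 * Rpower x (- a)) eta); auto with cdb. }
  assert (C2 : cone f2).
  { destruct (Reg_plus_power_mono a A (fun _ => 0)) as [M1 M2]; try lra.
    { eapply Reg_weaken. apply (Reg_const a 0); lra. rewrite Rabs_R0; lra. lra. }
    apply (cone_trunc (fun x => 0 + B0 * Rpower x (- a)) eta); auto with cdb. }
  set (delta := RInt (fun x => g (m x)) 0 1).
  assert (Hdelta : Rabs delta <= e).
  { replace delta with (- (RInt (fun x => g x - g (m x)) 0 1)).
    2:{ rewrite RInt_sub; auto with cdb. rewrite Mg. fold delta. eqR; ring. }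
    rewrite Rabs_Ropp. replace e with ((1 - 0) * e) by ring. apply abs_RInt_le_const; auto with cdb. lra. }
  apply Rabs_le_between in Hdelta.
  (* Truncation spoils the zero mean by [delta]; the constants [e - delta] and [e], both
     nonnegative, make the two masses equal again. *)
  set (F1 := fun x => f1 x + (e - delta)). set (F2 := fun x => f2 x + e).
  assert (CF1 : cone F1) by (apply cone_plus; auto; apply cone_const; lra).
  assert (CF2 : cone F2) by (apply cone_plus; auto; apply cone_const; lra).
  assert (BF : forall F, cone F -> (forall x, 0 < x <= 1 -> F x <= A * Rpower (m x) (- a) + B0 * Rpower (m x) (- a) + 2 * e) ->
    bnd a B F /\ RInt F 0 1 <= (1 - a) / 2 * B).
  { intros F CF HF.
    assert (Q : forall x, 0 < x <= 1 -> F x <= (3 * A + B0) * Rpower x (- a)).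
    { intros x Hx. specialize (HF x Hx). destruct (Hm x Hx) as [m1 m2].
      pose proof (Rpower_neg_anti x (m x) a ltac:(lra) ltac:(lra)).
      pose proof (Rpower_neg_ge1 x a Hx ltac:(lra)).
      assert (0 <= B0) by (unfold B0; apply Rdiv_le_0_compat; lra).
      assert (A * Rpower (m x) (- a) <= A * Rpower x (- a)) by (apply Rmult_le_compat_l; lra).
      assert (B0 * Rpower (m x) (- a) <= B0 * Rpower x (- a)) by (apply Rmult_le_compat_l; lra).
      nra. }
    assert (BE : B = (3 * A + B0) * (2 / (1 - a) ^ 2)) by (unfold B, K, B0; field; lra).
    assert (0 <= 3 * A + B0) by (unfold B0; assert (0 <= 3 * A / a) by (apply Rdiv_le_0_compat; lra); lra).
    split.
    - intros x Hx. specialize (Q x Hx). apply Rle_trans with (1 := Q).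
      apply Rmult_le_compat_r. left; apply Rpower_pos. rewrite BE. nra.
    - pose proof (power_int_bound F a (3 * A + B0) 1 (cone_cont _ CF) ltac:(lra) H ltac:(lra) ltac:(intros; apply Q; lra)) as I.
      rewrite Rpower_base1 in I. apply Rle_trans with (1 := I). rewrite BE. right; field; lra. }
  assert (G1 : forall x, 0 < x <= 1 -> Rabs (g (m x)) <= A * Rpower (m x) (- a)).
  { intros x Hx. apply Rg. apply Hm; auto. }
  destruct (BF F1 CF1) as [BF1 MF1].
  { intros x Hx. unfold F1, f1. specialize (G1 x Hx). apply Rabs_le_between in G1. lra. }
  destruct (BF F2 CF2) as [BF2 MF2].
  { intros x Hx. unfold F2, f2. pose proof (Rpower_pos (m x) (- a)). nra. }
  assert (ME : RInt F1 0 1 = RInt F2 0 1).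
  { unfold F1, F2, f1, f2. rewrite !RInt_add, !RInt_cst; auto with cdb. fold delta. eqR; ring. }
  destruct (CP gs B F1 F2 Hgs HB CF1 CF2 BF1 BF2 ME MF1 n) as (r & s & (Cr & Cs) & (Br & Bs) & Er & Mrs & _ & Dr).
  assert (KB : forall q, cone q -> bnd a B q -> RInt q 0 1 <= C * B * Rpower (INR n + 1) (- p) ->
    forall x, 0 < x <= 1 -> q x <= E x).
  { intros q Cq Bq Mq x Hx.
    pose proof (cone_mass_pt q x Cq ltac:(lra)) as Q.
    set (M := C * B * Rpower (INR n + 1) (- p)) in *.
    assert (HM : 0 < M). { unfold M. pose proof (Rpower_pos (INR n + 1) (- p)). apply Rmult_lt_0_compat; nra. }
    pose proof (Rpower_pos x (- a)).
    eapply Rle_trans.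
    { apply (interpolate (q x) (B * Rpower x (- a)) (M / x) th); auto.
      - apply Cq; lra.
      - apply Rle_div_r; lra.
      - nra.
      - apply Rdiv_lt_0_compat; lra. }
    assert (CB : Rpower (C * B) th = Rpower C th * Rpower B th) by (rewrite Rpower_mult_distr; lra).
    assert (Cth : Rpower C th <= C).
    { rewrite <- (Rpower_1 C) at 2 by lra. apply Rle_Rpower; lra. }
    unfold M, Rdiv. rewrite <- !Rpower_mult_distr; try lra;
      try apply Rpower_pos; try (apply Rinv_0_lt_compat; lra); try (apply Rmult_lt_0_compat; try lra; apply Rpower_pos).
    rewrite !Rpower_mult.
    assert (X : Rpower (/ x) th = Rpower x (- th)).
    { unfold Rpower. rewrite ln_Rinv by lra. f_equal; ring. }
    rewrite X. unfold E.
    replace (Rpower x (- (a * (1 - th) + th))) with (Rpower x (- a * (1 - th)) * Rpower x (- th))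
      by (rewrite <- Rpower_plus; f_equal; ring).
    replace (- p * th) with (- (p * th)) by ring.
    assert (BB : Rpower B (1 - th) * Rpower B th = B).
    { rewrite <- Rpower_plus. replace (1 - th + th) with 1 by ring. apply Rpower_1; lra. }
    rewrite <- BB at 3.
    pose proof (Rpower_pos (INR n + 1) (- (p * th))). pose proof (Rpower_pos x (- a * (1 - th))).
    pose proof (Rpower_pos x (- th)). pose proof (Rpower_pos B (1 - th)). pose proof (Rpower_pos B th).
    set (z1 := Rpower (INR n + 1) (- (p * th))) in *. set (z2 := Rpower x (- a * (1 - th))) in *.
    set (z3 := Rpower x (- th)) in *. set (z4 := Rpower B (1 - th)) in *. set (z5 := Rpower B th) in *.
    replace (z4 * z2 * (Rpower C th * z5 * z1 * z3)) with (Rpower C th * (z4 * z5 * z1 * (z2 * z3))) by ring.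
    replace (z4 * z5 * C * z1 * (z2 * z3)) with (C * (z4 * z5 * z1 * (z2 * z3))) by ring.
    apply Rmult_le_compat_r; auto. left. repeat apply Rmult_lt_0_compat; auto. exact HM. }
  (* The third summand transports the truncation error, of size at most [2 e]; by positivity it is
     bounded by [2 e] times the density. *)
  exists r, s, (Pit gs n (fun x => g x - g (m x) + delta)).
  split; [auto|]. split; [auto|]. split; [apply KB; auto|]. split; [apply KB; auto; rewrite <- Mrs; auto|]. split.
  - intros x. rewrite <- Er.
    replace (Pit gs n F1 x - Pit gs n F2 x) with (Pit gs n (fun y => F1 y - F2 y) x) by (rewrite Pit_minus; auto).
    replace (Pit gs n (fun y => F1 y - F2 y) x + Pit gs n (fun x => g x - g (m x) + delta) x)
      with (Pit gs n (fun y => (F1 y - F2 y) + (g y - g (m y) + delta)) x) by (rewrite Pit_plus; auto).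
    f_equal. apply functional_extensionality; intros y. unfold F1, F2, f1, f2. ring.
  - intros x Hx. pose proof (h_bnd alpha Halpha gs n Hgs x Hx) as Hh.
    assert (W : forall y, 0 <= y <= 1 -> Rabs (g y - g (m y) + delta) <= 2 * e).
    { intros y Hy. specialize (Cl y Hy). fold (m y) in Cl. apply Rabs_le_between in Cl. apply Rabs_le. lra. }
    assert (U1 : Pit gs n (fun x => g x - g (m x) + delta) x <= Pit gs n (fun y => 2 * e * cst1 y) x).
    { apply (Pit_le alpha); auto; try lra. intros y Hy. specialize (W y Hy). apply Rabs_le_between in W. unfold cst1. lra. }
    assert (U2 : Pit gs n (fun y => - (2 * e) * cst1 y) x <= Pit gs n (fun x => g x - g (m x) + delta) x).
    { apply (Pit_le alpha); auto; try lra. intros y Hy. specialize (W y Hy). apply Rabs_le_between in W. unfold cst1. lra. }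
    rewrite Pit_scal in U1, U2. apply Rabs_le. split; nra. }
assert (HE : forall x, 0 < x <= 1 -> 0 <= E x).
{ intros x Hx. unfold E. pose proof (Rpower_pos (INR n + 1) (- (p * th))). pose proof (Rpower_pos x (- (a * (1 - th) + th))).
  repeat apply Rmult_le_pos; lra. }
assert (EE : forall x, 4 * K * C * A * Rpower (INR n + 1) (- (p * th)) * Rpower x (- (a * (1 - th) + th)) = 4 * E x).
{ intros; unfold E, B. ring. }
assert (HZ : forall x, 0 <= 2 * (Bh alpha * Rpower x (- alpha))).
{ intros x. pose proof (Bh_ge alpha Halpha). pose proof (Rpower_pos x (- alpha)). nra. }
split.
- intros x Hx. rewrite EE. apply (le_of_eps _ _ (2 * (Bh alpha * Rpower x (- alpha))) A); auto.
  intros e He. destruct (DEC e He) as (r & s & w & Cr & Cs & Er & Es & Q & W).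
  specialize (Er x Hx). specialize (Es x Hx). specialize (W x Hx). specialize (HE x Hx).
  assert (0 <= r x) by (apply Cr; lra). assert (0 <= s x) by (apply Cs; lra).
  rewrite Q. eapply Rle_trans; [apply Rabs_triang|].
  assert (Rabs (r x - s x) <= E x) by (apply Rabs_le; lra). lra.
- intros x y Hx Hxy Hy. rewrite EE.
  apply (le_of_eps _ _ (2 * (Bh alpha * Rpower x (- alpha)) + 2 * (Bh alpha * Rpower y (- alpha))) A); auto.
  { pose proof (HZ x); pose proof (HZ y); lra. }
  intros e He. destruct (DEC e He) as (r & s & w & Cr & Cs & Er & Es & Q & W).
  specialize (Er x ltac:(lra)). specialize (Es x ltac:(lra)).
  pose proof (W x ltac:(lra)). pose proof (W y ltac:(lra)).
  pose proof (cone_diff r x y Cr Hx Hxy Hy). pose proof (cone_diff s x y Cs Hx Hxy Hy).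
  pose proof (ratio_range x y Hx Hxy).
  rewrite !Q. replace (r x - s x + w x - (r y - s y + w y)) with ((r x - r y) - (s x - s y) + (w x - w y)) by ring.
  eapply Rle_trans; [apply Rabs_triang|].
  assert (Rabs (w x - w y) <= Rabs (w x) + Rabs (w y)).
  { eapply Rle_trans; [apply Rabs_triang|]. rewrite Rabs_Ropp. lra. }
  assert (2 * r x * (1 - x / y) <= 2 * E x * (1 - x / y)) by (apply Rmult_le_compat_r; lra).
  assert (2 * s x * (1 - x / y) <= 2 * E x * (1 - x / y)) by (apply Rmult_le_compat_r; lra).
  assert (Rabs (r x - r y - (s x - s y)) <= 4 * E x * (1 - x / y)) by (apply Rabs_le; lra).
  lra.
Qed.

End A.
End Seq.

(** * A central limit estimate for reverse martingale differences *)

Lemma abs_sin_le x : Rabs (sin x) <= Rabs x.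
Proof.
assert (K : forall x, 0 < x -> - x <= sin x <= x).
{ intros y Hy. destruct (MVT_cor2 sin cos 0 y Hy) as (c & E & _).
  { intros; apply derivable_pt_lim_sin. }
  rewrite sin_0, !Rminus_0_r in E. pose proof (COS_bound c). rewrite E. nra. }
destruct (Rtotal_order x 0) as [H|[->|H]].
- specialize (K (- x) ltac:(lra)). rewrite sin_neg in K. rewrite (Rabs_left x) by lra. apply Rabs_le. lra.
- rewrite sin_0. lra.
- specialize (K x H). rewrite (Rabs_pos_eq x) by lra. apply Rabs_le. lra.
Qed.

Lemma one_sub_cos x : 0 <= 1 - cos x <= x ^ 2 / 2.
Proof.
pose proof (COS_bound x). split. lra.
replace x with (2 * (x / 2)) at 1 by field. rewrite cos_2a_sin.
pose proof (abs_sin_le (x / 2)). pose proof (Rabs_pos (sin (x / 2))).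
pose proof (pow2_abs (sin (x / 2))) as E1. pose proof (pow2_abs (x / 2)) as E2.
assert (Rabs (sin (x / 2)) ^ 2 <= Rabs (x / 2) ^ 2) by (apply pow_incr; lra).
rewrite E1, E2 in H2. nra.
Qed.

Lemma mvt_abs f f' x K : (forall c, derivable_pt_lim f c (f' c)) -> f 0 = 0 ->
  (forall c, Rabs c <= Rabs x -> Rabs (f' c) <= K) -> Rabs (f x) <= K * Rabs x.
Proof.
intros Hf H0 HK. destruct (Rtotal_order x 0) as [H|[->|H]].
- destruct (MVT_cor2 f f' x 0 H) as (c & E & Hc); auto.
  rewrite H0 in E. replace (f x) with (f' c * x) by lra. rewrite Rabs_mult.
  apply Rmult_le_compat_r. apply Rabs_pos. apply HK. rewrite !Rabs_left; lra.
- rewrite H0, Rabs_R0. lra.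
- destruct (MVT_cor2 f f' 0 x H) as (c & E & Hc); auto.
  rewrite H0 in E. replace (f x) with (f' c * x) by lra. rewrite Rabs_mult.
  apply Rmult_le_compat_r. apply Rabs_pos. apply HK. rewrite !Rabs_pos_eq; lra.
Qed.

Lemma sin_taylor x : Rabs (sin x - x) <= Rabs x ^ 3 / 2.
Proof.
replace (Rabs x ^ 3 / 2) with (Rabs x ^ 2 / 2 * Rabs x) by field.
apply (mvt_abs (fun x => sin x - x) (fun x => cos x - 1)).
- intros c. apply derivable_pt_lim_minus. apply derivable_pt_lim_sin. apply derivable_pt_lim_id.
- rewrite sin_0; ring.
- intros c Hc. pose proof (one_sub_cos c). pose proof (pow2_abs c).
  assert (Rabs c ^ 2 <= Rabs x ^ 2) by (apply pow_incr; split; auto using Rabs_pos).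
  rewrite Rabs_left1; lra.
Qed.

Lemma cos_taylor x : Rabs (cos x - 1 + x ^ 2 / 2) <= x ^ 4 / 2.
Proof.
assert (E : x ^ 4 / 2 = Rabs x ^ 3 / 2 * Rabs x).
{ replace (x ^ 4) with ((x ^ 2) ^ 2) by ring. rewrite <- (pow2_abs x). field. }
rewrite E.
apply (mvt_abs (fun x => cos x - 1 + x ^ 2 / 2) (fun x => - (sin x - x))).
- intros c. apply is_derive_Reals. auto_derive; auto. field.
- rewrite cos_0; field.
- intros c Hc. rewrite Rabs_Ropp. pose proof (sin_taylor c).
  assert (Rabs c ^ 3 <= Rabs x ^ 3) by (apply pow_incr; split; auto using Rabs_pos). lra.
Qed.

Lemma pow4_ge_0 x : 0 <= x ^ 4.
Proof. replace (x ^ 4) with ((x ^ 2) ^ 2) by ring. apply pow2_ge_0. Qed.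

(** The cubic term of the expansion is split by [|d|^3 <= e d^2 + d^4 / e], so that only second and
    fourth moments are ever used, the former with a small factor. *)
Lemma cos_expand A l d e : 0 < e <= 1 ->
  Rabs (cos (A + l * d) - (cos A - l * d * sin A - l ^ 2 / 2 * d ^ 2 * cos A)) <=
  (Rabs l ^ 3 + l ^ 4) * (e * d ^ 2 + d ^ 4 / e).
Proof.
intros He. rewrite cos_plus.
replace (cos A * cos (l * d) - sin A * sin (l * d) - (cos A - l * d * sin A - l ^ 2 / 2 * d ^ 2 * cos A))
  with (cos A * (cos (l * d) - 1 + (l * d) ^ 2 / 2) + - sin A * (sin (l * d) - l * d)) by field.
eapply Rle_trans; [apply Rabs_triang|]. rewrite !Rabs_mult.
pose proof (cos_taylor (l * d)) as K1. pose proof (sin_taylor (l * d)) as K2.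
assert (C1 : Rabs (cos A) <= 1) by (apply Rabs_le, COS_bound).
assert (C2 : Rabs (- sin A) <= 1) by (rewrite Rabs_Ropp; apply Rabs_le, SIN_bound).
rewrite Rabs_mult, !Rpow_mult_distr in *.
pose proof (pow2_abs d) as Ed. set (a := Rabs d) in *. assert (0 <= a) by apply Rabs_pos.
assert (Ed4 : d ^ 4 = a ^ 4) by (replace (d ^ 4) with ((d ^ 2) ^ 2) by ring; rewrite <- Ed; ring).
rewrite <- Ed, Ed4 in *. set (b := Rabs l ^ 3) in *. assert (0 <= b) by (apply pow_le, Rabs_pos).
pose proof (pow4_ge_0 l).
assert (A3 : a ^ 3 <= e * a ^ 2 + a ^ 4 / e).
{ assert (0 <= (e - a) ^ 2) by apply pow2_ge_0. 
  apply Rmult_le_reg_l with e; [lra|].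
  replace (e * (e * a ^ 2 + a ^ 4 / e)) with (a ^ 2 * (e ^ 2 + a ^ 2)) by (field; lra).
  replace (e * a ^ 3) with (a ^ 2 * (e * a)) by ring.
  apply Rmult_le_compat_l; nra. }
assert (A4 : a ^ 4 <= e * a ^ 2 + a ^ 4 / e).
{ assert (a ^ 4 <= a ^ 4 / e). { apply (Rle_div_r (a ^ 4)); [lra|]. assert (0 <= a ^ 4) by (apply pow_le; auto). nra. }
  assert (0 <= e * a ^ 2) by (apply Rmult_le_pos; [lra|apply pow_le; auto]). lra. }
set (X := e * a ^ 2 + a ^ 4 / e) in *.
assert (0 <= a ^ 3) by (apply pow_le; auto). assert (0 <= a ^ 4) by (apply pow_le; auto).
pose proof (Rabs_pos (cos (l * d) - 1 + l ^ 2 * a ^ 2 / 2)). pose proof (Rabs_pos (sin (l * d) - l * d)).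
assert (l ^ 4 * a ^ 4 <= l ^ 4 * X) by (apply Rmult_le_compat_l; auto).
assert (b * a ^ 3 <= b * X) by (apply Rmult_le_compat_l; auto).
assert (0 <= l ^ 4 * a ^ 4) by (apply Rmult_le_pos; auto). assert (0 <= b * a ^ 3) by (apply Rmult_le_pos; auto).
nra.
Qed.

Lemma exp_neg_taylor t : 0 <= t -> 0 <= exp (- t) - 1 + t <= t ^ 2.
Proof.
intros Ht. pose proof (exp_ineq1_le (- t)). pose proof (exp_ineq1_le t). split. lra.
rewrite exp_Ropp. assert (/ exp t <= / (1 + t)) by (apply Rinv_le_contravar; lra).
assert (/ (1 + t) <= 1 - t + t ^ 2); [|lra].
apply Rmult_le_reg_l with (1 + t); [lra|]. rewrite Rinv_r by lra.
replace ((1 + t) * (1 - t + t ^ 2)) with (1 + t ^ 3) by ring. pose proof (pow_le t 3 Ht). lra.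
Qed.

Lemma exp_lip u v b : u <= b -> v <= b -> Rabs (exp u - exp v) <= exp b * Rabs (u - v).
Proof.
assert (M : forall x y, x <= y -> exp x <= exp y).
{ intros x y [H|H]. left; now apply exp_increasing. rewrite H; lra. }
assert (K : forall u v, v <= u -> u <= b -> Rabs (exp u - exp v) <= exp b * Rabs (u - v)).
{ intros x y H Hb. rewrite !Rabs_pos_eq; try lra. 2: pose proof (M y x H); lra.
  assert (exp y = exp x * exp (y - x)) by (rewrite <- exp_plus; f_equal; ring).
  pose proof (exp_ineq1_le (y - x)). pose proof (exp_pos x). pose proof (M x b Hb). nra. }
intros. destruct (Rle_dec v u). apply K; auto.
rewrite Rabs_minus_sym, (Rabs_minus_sym u). apply K; lra.
Qed.

Section Martingale.
Variables (h D q T : nat -> R -> R).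
(** [h k] is the density at time [k], and [T k] leads from time [k] to [k + 1]. By [ED1], [D k] is
    centred given the point at time [k + 1], hence given the whole future; by [ED2], its conditional
    variance is [q (S k)], a function of that point. *)
Definition Ex (k : nat) (F : R -> R) : R := RInt (fun x => h k x * F x) 0 1.
Notation E := Ex.
Notation pwf := (pw 0 1).

Hypothesis hc : forall k, cont (h k).
Hypothesis hp : forall k x, 0 <= x <= 1 -> 0 <= h k x.
Hypothesis hm : forall k, RInt (h k) 0 1 = 1.
Hypothesis Dp : forall k, pwf (D k).
Hypothesis qp : forall k, pwf (q k).
Hypothesis qn : forall k x, 0 <= x <= 1 -> 0 <= q (S k) x.
Hypothesis Tr : forall k x, 0 <= x <= 1 -> 0 <= T k x <= 1.
Hypothesis Tp : forall k F, pwf F -> pwf (fun x => F (T k x)).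
Hypothesis ET : forall k F, pwf F -> E k (fun x => F (T k x)) = E (S k) F.
Hypothesis ED1 : forall k F, pwf F -> E k (fun x => D k x * F (T k x)) = 0.
Hypothesis ED2 : forall k F, pwf F ->
  E k (fun x => D k x ^ 2 * F (T k x)) = E (S k) (fun x => q (S k) x * F x).

Lemma pw_cst k : pwf (fun _ => k).
Proof. apply pw_const; lra. Qed.

Lemma pwh k F : pwf F -> pwf (fun x => h k x * F x).
Proof. intros; apply pw_mult; auto. apply pw_cont; auto; lra. Qed.

Lemma E_add k F G : pwf F -> pwf G -> E k (fun x => F x + G x) = E k F + E k G.
Proof.
intros. unfold Ex. rewrite <- RInt_add by (apply pw_ex, pwh; auto).
apply RInt_eq. lra. intros; ring.
Qed.

Lemma E_scal k F c : pwf F -> E k (fun x => c * F x) = c * E k F.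
Proof.
intros. unfold Ex. rewrite <- RInt_mull by (apply pw_ex, pwh; auto).
apply RInt_eq. lra. intros; ring.
Qed.

Lemma E_sub k F G : pwf F -> pwf G -> E k (fun x => F x - G x) = E k F - E k G.
Proof.
intros. unfold Ex. rewrite <- RInt_sub by (apply pw_ex, pwh; auto).
apply RInt_eq. lra. intros; ring.
Qed.

Lemma E_const k c : E k (fun _ => c) = c.
Proof.
unfold Ex. transitivity (c * RInt (h k) 0 1).
rewrite <- RInt_mull by auto with cdb. apply RInt_eq. lra. intros; ring.
rewrite hm. ring.
Qed.

Lemma E_le k F G : pwf F -> pwf G -> (forall x, 0 <= x <= 1 -> F x <= G x) -> E k F <= E k G.
Proof.
intros. unfold Ex. apply RInt_le; try lra; try (apply pw_ex, pwh; auto).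
intros. apply Rmult_le_compat_l; [apply hp|apply H1]; lra.
Qed.

Lemma E_ext k F G : (forall x, 0 <= x <= 1 -> F x = G x) -> E k F = E k G.
Proof. intros. unfold Ex. apply RInt_eq. lra. intros; rewrite H; auto; lra. Qed.

Lemma E_abs k F G : pwf F -> pwf G -> (forall x, 0 <= x <= 1 -> Rabs (F x) <= G x) ->
  Rabs (E k F) <= E k G.
Proof.
intros. apply Rabs_le. split.
- replace (- E k G) with (E k (fun x => -1 * G x)) by (rewrite E_scal; auto; ring).
  apply E_le; auto. apply pw_mult; auto using pw_cst.
  intros x Hx. specialize (H1 x Hx). apply Rabs_le_between in H1. lra.
- apply E_le; auto. intros x Hx. specialize (H1 x Hx). apply Rabs_le_between in H1. lra.
Qed.

(** The recursion removes the earliest term: for a martingale in reversed time this is the one that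
    is centred given all the others. *)
Fixpoint msum (i k : nat) (y : R) : R :=
  match i with O => 0 | S i => D k y + msum i (S k) (T k y) end.

Fixpoint wsum (i k : nat) (y : R) : R :=
  match i with O => 0 | S i => q (S k) (T k y) + wsum i (S k) (T k y) end.

Lemma msum_pw i : forall k, pwf (msum i k).
Proof.
induction i; intros k; simpl. apply pw_cst. apply pw_plus; auto.
Qed.

Lemma wsum_pw i : forall k, pwf (wsum i k).
Proof.
induction i; intros k; simpl. apply pw_cst.
apply (Tp k (fun x => q (S k) x + wsum i (S k) x)). apply pw_plus; auto.
Qed.

Lemma wsum_nonneg i : forall k x, 0 <= x <= 1 -> 0 <= wsum i k x.
Proof.
induction i; intros; simpl. lra. pose proof (Tr k x H). specialize (IHi (S k) _ H0).
pose proof (qn k _ H0). lra.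
Qed.

Lemma E_wsum_S i k : E k (wsum (S i) k) = E (S k) (q (S k)) + E (S k) (wsum i (S k)).
Proof.
rewrite <- E_add; auto using wsum_pw.
apply (ET k (fun x => q (S k) x + wsum i (S k) x)). apply pw_plus; auto using wsum_pw.
Qed.

Lemma E_D2 k : E k (fun x => D k x ^ 2) = E (S k) (q (S k)).
Proof.
rewrite (E_ext k _ (fun x => D k x ^ 2 * (fun _ => 1) (T k x))) by (intros; ring).
rewrite (ED2 k (fun _ => 1) (pw_cst 1)). apply E_ext; intros; ring.
Qed.

(** The cross terms vanish by [ED1], the remaining sum being a function of the next point. *)
Lemma E_msum_sq i : forall k, E k (fun x => msum i k x ^ 2) = E k (wsum i k).
Proof.
induction i; intros k.
- simpl. apply E_ext. intros; ring.
- rewrite E_wsum_S, <- IHi, <- E_D2.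
  rewrite (E_ext k _ (fun x => (D k x ^ 2 + 2 * (D k x * msum i (S k) (T k x))) + msum i (S k) (T k x) ^ 2))
    by (intros; simpl; ring).
  pose proof (Dp k). pose proof (msum_pw i (S k)) as M. pose proof (Tp k _ M) as MT.
  rewrite E_add, E_add, E_scal; auto using pw_cst with cdb.
  rewrite (ED1 k (msum i (S k))) by auto.
  rewrite (ET k (fun x => msum i (S k) x ^ 2)) by auto with cdb. ring.
Qed.

Variables (l th e del : R).
Hypothesis He : 0 < e <= 1.
Hypothesis Hdel : 0 <= del.
Hypothesis D4 : forall k, E k (fun x => D k x ^ 4) <= del.
Hypothesis Q2 : forall k, E (S k) (fun x => q (S k) x ^ 2) <= del.

(** The compensator [exp (l^2 V / 2)] with [V] cut at 2. In the application [V] is normalised to be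
    close to 1, so the cut is rarely active, yet it bounds the exponential. *)
Definition ee (u : R) : R := exp (l ^ 2 / 2 * Rmin u 2).
Definition ZZ (i k : nat) (y : R) : R := cos (l * msum i k y + th) * ee (wsum i k y).
Definition kap : R := exp (l ^ 2) * (l ^ 2 + l ^ 4 + Rabs l ^ 3).

Lemma ee_cont : cont ee.
Proof.
unfold ee. apply (cont_comp exp); auto with cdb.
Qed.

Lemma ee_range u : 0 <= u -> 0 < ee u <= exp (l ^ 2).
Proof.
intros. split. apply exp_pos. unfold ee. pose proof (pow2_ge_0 l).
assert (Rmin u 2 <= 2) by apply Rmin_r.
destruct (Req_dec (l ^ 2 / 2 * Rmin u 2) (l ^ 2)) as [->|]; [lra|].
left. apply exp_increasing. nra.
Qed.

Lemma ZZ_pw i k : pwf (ZZ i k).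
Proof.
apply pw_mult.
- apply (pw_comp 0 1 (fun m => cos (l * m + th))). apply (cont_comp cos); auto with cdb. apply msum_pw.
- apply (pw_comp 0 1 ee). apply ee_cont. apply wsum_pw.
Qed.

(** Apart from [cos A * ee w], the subtracted terms carry a factor [d] or [Q - d^2] next to
    functions of the later point, so [ED1] and [ED2] annihilate them in mean. The effect of the cut
    at 2 appears as an increment of [w - Rmin w 2], which telescopes over the steps. *)
Lemma one_step A d Q w : 0 <= Q -> 0 <= w ->
  Rabs (cos (A + l * d) * ee (Q + w) -
    (cos A * ee w - l * (d * (sin A * ee (Q + w))) + l ^ 2 / 2 * ((Q - d ^ 2) * (cos A * ee (Q + w))))) <=
  kap * ((Q + w - Rmin (Q + w) 2) - (w - Rmin w 2) + Q ^ 2 + (e * d ^ 2 + / e * d ^ 4)).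
Proof.
intros HQ Hw.
pose proof (cos_expand A l d e He) as CE.
set (Dl := Rmin (Q + w) 2 - Rmin w 2).
assert (HD : 0 <= Dl <= Q) by (unfold Dl, Rmin; repeat destruct Rle_dec; lra).
assert (EE : ee w = ee (Q + w) * exp (- (l ^ 2 / 2 * Dl))).
{ unfold ee. rewrite <- exp_plus. f_equal. unfold Dl. ring. }
pose proof (ee_range (Q + w) ltac:(lra)) as HY. set (Y := ee (Q + w)) in *.
assert (L2 : 0 <= l ^ 2) by apply pow2_ge_0.
pose proof (exp_neg_taylor (l ^ 2 / 2 * Dl) ltac:(nra)) as XT.
set (X := exp (- (l ^ 2 / 2 * Dl))) in *.
rewrite EE.
replace (cos (A + l * d) * Y - (cos A * (Y * X) - l * (d * (sin A * Y)) + l ^ 2 / 2 * ((Q - d ^ 2) * (cos A * Y))))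
  with (Y * ((cos (A + l * d) - (cos A - l * d * sin A - l ^ 2 / 2 * d ^ 2 * cos A))
     + cos A * (- (X - 1 + l ^ 2 / 2 * Dl) - l ^ 2 / 2 * (Q - Dl)))) by field.
rewrite Rabs_mult, (Rabs_pos_eq Y) by lra.
set (R1 := cos (A + l * d) - _) in *.
assert (C1 : Rabs (cos A) <= 1) by (apply Rabs_le, COS_bound).
assert (B2 : Rabs (cos A * (- (X - 1 + l ^ 2 / 2 * Dl) - l ^ 2 / 2 * (Q - Dl))) <= l ^ 4 * Q ^ 2 + l ^ 2 * (Q - Dl)).
{ rewrite Rabs_mult. assert (0 <= l ^ 2 / 2 * (Q - Dl)) by nra.
  assert ((l ^ 2 / 2 * Dl) ^ 2 <= l ^ 4 * Q ^ 2).
  { replace (l ^ 4 * Q ^ 2) with ((l ^ 2 * Q) ^ 2) by ring. apply pow_incr. nra. }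
  assert (Rabs (- (X - 1 + l ^ 2 / 2 * Dl) - l ^ 2 / 2 * (Q - Dl)) <= l ^ 4 * Q ^ 2 + l ^ 2 * (Q - Dl)).
  { apply Rabs_le. lra. }
  pose proof (Rabs_pos (- (X - 1 + l ^ 2 / 2 * Dl) - l ^ 2 / 2 * (Q - Dl))). nra. }
assert (B3 : Rabs (R1 + cos A * (- (X - 1 + l ^ 2 / 2 * Dl) - l ^ 2 / 2 * (Q - Dl))) <=
  (l ^ 2 + l ^ 4 + Rabs l ^ 3) * ((Q - Dl) + Q ^ 2 + (e * d ^ 2 + / e * d ^ 4))).
{ eapply Rle_trans; [apply Rabs_triang|].
  assert (0 <= Rabs l ^ 3) by (apply pow_le, Rabs_pos).
  pose proof (pow4_ge_0 l).
  assert (0 < / e) by (apply Rinv_0_lt_compat; lra).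
  assert (0 <= e * d ^ 2 + / e * d ^ 4).
  { replace (d ^ 4) with ((d ^ 2) ^ 2) by ring. pose proof (pow2_ge_0 d). pose proof (pow2_ge_0 (d ^ 2)). nra. }
  replace (d ^ 4 / e) with (/ e * d ^ 4) in CE by (unfold Rdiv; ring).
  pose proof (pow2_ge_0 Q). 
  set (V := e * d ^ 2 + / e * d ^ 4) in *. set (c3 := Rabs l ^ 3) in *.
  set (c4 := l ^ 4) in *. set (c2 := l ^ 2) in *. set (Q' := Q ^ 2) in *. 
  assert (0 <= c2 * V) by nra. assert (0 <= c2 * Q') by nra.
  assert (0 <= c4 * (Q - Dl)) by nra. assert (0 <= c3 * Q') by nra. assert (0 <= c3 * (Q - Dl)) by nra.
  nra. }
unfold kap. rewrite Rmult_assoc.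
replace (Q + w - Rmin (Q + w) 2 - (w - Rmin w 2)) with (Q - Dl) by (unfold Dl; ring).
apply Rmult_le_compat; try lra. apply Rabs_pos.
Qed.

Lemma kap_nonneg : 0 <= kap.
Proof.
unfold kap. pose proof (exp_pos (l ^ 2)). pose proof (pow2_ge_0 l).
assert (0 <= Rabs l ^ 3) by (apply pow_le, Rabs_pos). pose proof (pow4_ge_0 l).
apply Rmult_le_pos; lra.
Qed.

Definition exc (w : R) : R := w - Rmin w 2.

Lemma exc_cont : cont exc.
Proof. unfold exc; auto with cdb. Qed.

(** Each step costs [e] times a variance plus at most [2 del / e] for [D^4] and [q^2]; the excess
    over the cut telescopes to its value for the full sum. *)
Lemma ZZ_bound i : forall k, Rabs (E k (ZZ i k) - cos th) <=
  kap * (E k (fun x => exc (wsum i k x)) + e * E k (wsum i k) + INR i * (2 * (del / e))).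
Proof.
assert (EXP : forall j k, pwf (fun x => exc (wsum j k x))).
{ intros. apply (pw_comp 0 1 exc). apply exc_cont. apply wsum_pw. }
pose proof kap_nonneg as KN.
induction i; intros k.
- rewrite (E_ext k (ZZ 0 k) (fun _ => cos th)).
  2:{ intros. unfold ZZ, ee. simpl msum. simpl wsum. rewrite Rmin_left by lra.
      rewrite !Rmult_0_r, Rplus_0_l, exp_0. ring. }
  rewrite E_const. unfold Rminus. rewrite Rplus_opp_r, Rabs_R0.
  rewrite (E_ext k (fun x => exc (wsum 0 k x)) (fun _ => 0)), (E_ext k (wsum 0 k) (fun _ => 0)); auto.
  2:{ intros; unfold exc; simpl. rewrite Rmin_left; lra. }
  rewrite E_const. simpl (INR 0). apply Rmult_le_pos; lra.
- specialize (IHi (S k)).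
  set (A := fun x => l * msum i (S k) x + th).
  set (w' := fun x => q (S k) x + wsum i (S k) x).
  assert (pD := Dp k). assert (pq := qp (S k)).
  assert (pA : pwf A) by (unfold A; apply pw_plus; auto using pw_cst; apply pw_mult; auto using pw_cst, msum_pw).
  assert (pw' : pwf w') by (apply pw_plus; auto using wsum_pw).
  assert (pY : pwf (fun x => ee (w' x))) by (apply (pw_comp 0 1 ee); auto using ee_cont).
  assert (pC : pwf (fun x => cos (A x) * ee (w' x))) by (apply pw_mult; auto; apply (pw_comp 0 1 cos); auto with cdb).
  assert (csin : cont sin) by (intros x; apply continuous_sin).
  assert (pS : pwf (fun x => sin (A x) * ee (w' x))) by (apply pw_mult; auto; apply (pw_comp 0 1 sin); auto).
  assert (pCT := Tp k _ pC). assert (pST := Tp k _ pS). assert (pqT := Tp k _ pq).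
  assert (pZT := Tp k _ (ZZ_pw i (S k))). cbv beta in *.
  set (B := fun x => ZZ i (S k) (T k x) - l * (D k x * (sin (A (T k x)) * ee (w' (T k x))))
     + l ^ 2 / 2 * (q (S k) (T k x) * (cos (A (T k x)) * ee (w' (T k x))) - D k x ^ 2 * (cos (A (T k x)) * ee (w' (T k x))))).
  assert (p1 : pwf (fun x => l * (D k x * (sin (A (T k x)) * ee (w' (T k x)))))) by auto using pw_cst with cdb.
  assert (p2 : pwf (fun x => q (S k) (T k x) * (cos (A (T k x)) * ee (w' (T k x))))) by auto with cdb.
  assert (p3 : pwf (fun x => D k x ^ 2 * (cos (A (T k x)) * ee (w' (T k x))))) by auto with cdb.
  assert (pB : pwf B) by (unfold B; auto using pw_cst with cdb).
  assert (EB : E k B = E (S k) (ZZ i (S k))).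
  { unfold B. rewrite E_add, E_sub, E_scal, E_scal, E_sub; auto using pw_cst with cdb.
    rewrite (ET k (ZZ i (S k))) by apply ZZ_pw.
    rewrite (ED1 k (fun x => sin (A x) * ee (w' x))) by auto.
    rewrite (ED2 k (fun x => cos (A x) * ee (w' x))) by auto.
    rewrite (ET k (fun x => q (S k) x * (cos (A x) * ee (w' x)))) by auto with cdb. ring. }
  set (err := fun x => kap * ((exc (wsum (S i) k x) - exc (wsum i (S k) (T k x))) + q (S k) (T k x) ^ 2
     + (e * D k x ^ 2 + / e * D k x ^ 4))).
  assert (pE1 := EXP (S i) k). assert (pE2 := Tp k _ (EXP i (S k))). cbv beta in pE2.
  assert (perr : pwf err) by (unfold err; auto 10 using pw_cst with cdb).
  assert (BD : Rabs (E k (ZZ (S i) k) - E (S k) (ZZ i (S k))) <= E k err).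
  { rewrite <- EB, <- E_sub; auto using ZZ_pw. apply E_abs; auto using ZZ_pw with cdb.
    intros x Hx. pose proof (Tr k x Hx) as Ht.
    pose proof (one_step (A (T k x)) (D k x) (q (S k) (T k x)) (wsum i (S k) (T k x)) (qn k _ Ht) (wsum_nonneg i (S k) _ Ht)) as OS.
    unfold B, err. unfold ZZ at 1. simpl msum. simpl wsum. unfold ZZ. fold (A (T k x)) (w' (T k x)).
    replace (l * (D k x + msum i (S k) (T k x)) + th) with (A (T k x) + l * D k x) by (unfold A; ring).
    unfold exc. fold (w' (T k x)) in OS |- *.
    replace (q (S k) (T k x) * (cos (A (T k x)) * ee (w' (T k x))) - D k x ^ 2 * (cos (A (T k x)) * ee (w' (T k x))))
      with ((q (S k) (T k x) - D k x ^ 2) * (cos (A (T k x)) * ee (w' (T k x)))) by ring.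
    exact OS. }
  assert (EV : E k err <= kap * (E k (fun x => exc (wsum (S i) k x)) - E (S k) (fun x => exc (wsum i (S k) x)) + del
     + (e * E (S k) (q (S k)) + / e * del))).
  { unfold err. rewrite E_scal, !E_add, E_sub, !E_scal; auto 10 using pw_cst with cdb.
    rewrite (ET k (fun x => exc (wsum i (S k) x))) by auto.
    rewrite (ET k (fun x => q (S k) x ^ 2)) by auto with cdb. rewrite E_D2.
    apply Rmult_le_compat_l; auto. specialize (Q2 k). specialize (D4 k).
    assert (0 < / e) by (apply Rinv_0_lt_compat; lra). nra. }
  rewrite E_wsum_S. rewrite S_INR.
  assert (del <= del / e). { apply Rle_div_r; [lra|]. nra. }
  replace (/ e * del) with (del / e) in EV by (unfold Rdiv; ring).
  replace (E k (ZZ (S i) k) - cos th) with ((E k (ZZ (S i) k) - E (S k) (ZZ i (S k))) + (E (S k) (ZZ i (S k)) - cos th)) by ring.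
  eapply Rle_trans; [apply Rabs_triang|]. 
  eapply Rle_trans. { apply Rplus_le_compat. eapply Rle_trans. exact BD. exact EV. exact IHi. }
  rewrite <- Rmult_plus_distr_l. apply Rmult_le_compat_l; auto. lra.
Qed.

(** Replacing [V] by 1: the estimate [E |V - 1| <= e + v / e] bounds the excess over the cut, the
    mean of [V] and the error in the exponential all at once. *)
Lemma clt_bound i k v : E k (fun x => (wsum i k x - 1) ^ 2) <= v ->
  Rabs (exp (l ^ 2 / 2) * E k (fun x => cos (l * msum i k x + th)) - cos th) <=
  kap * (4 * e + (3 * v + INR i * (2 * del)) / e).
Proof.
intros Hv. pose proof kap_nonneg as KN.
assert (pw1 := wsum_pw i k). assert (pm := msum_pw i k).
assert (pc : pwf (fun x => cos (l * msum i k x + th))).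
{ apply (pw_comp 0 1 (fun m => cos (l * m + th))); auto. apply (cont_comp cos); auto with cdb. }
assert (pab : pwf (fun x => Rabs (wsum i k x - 1))).
{ apply (pw_comp 0 1 (fun m => Rabs (m - 1))); auto. apply (cont_comp Rabs); auto with cdb. }
assert (pex : pwf (fun x => exc (wsum i k x))) by (apply (pw_comp 0 1 exc); auto using exc_cont).
assert (B0 : E k (fun x => Rabs (wsum i k x - 1)) <= e + v / e).
{ apply Rle_trans with (E k (fun x => e + / e * (wsum i k x - 1) ^ 2)).
  - apply E_le; auto using pw_cst with cdb. intros x _. set (u := wsum i k x - 1).
    rewrite <- (pow2_abs u). pose proof (Rabs_pos u). set (b := Rabs u) in *.
    apply Rmult_le_reg_l with e; [lra|].
    replace (e * (e + / e * b ^ 2)) with (e ^ 2 + b ^ 2) by (field; lra).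
    pose proof (pow2_ge_0 (e - b)). nra.
  - rewrite E_add, E_const, E_scal; auto using pw_cst with cdb.
    assert (0 < / e) by (apply Rinv_0_lt_compat; lra). unfold Rdiv. nra. }
set (a := E k (fun x => Rabs (wsum i k x - 1))) in *.
assert (B1 : E k (fun x => exc (wsum i k x)) <= a).
{ apply E_le; auto. intros x _. unfold exc, Rmin. destruct Rle_dec.
  pose proof (Rabs_pos (wsum i k x - 1)); lra. rewrite Rabs_pos_eq; lra. }
assert (B2 : E k (wsum i k) <= 1 + a).
{ replace (1 + a) with (E k (fun x => 1 + Rabs (wsum i k x - 1))) by (rewrite E_add, E_const; auto using pw_cst).
  apply E_le; auto using pw_cst with cdb. intros x _. pose proof (Rle_abs (wsum i k x - 1)). lra. }
assert (B3 : Rabs (exp (l ^ 2 / 2) * E k (fun x => cos (l * msum i k x + th)) - E k (ZZ i k)) <= kap * a).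
{ rewrite <- E_scal, <- E_sub; auto using ZZ_pw, pw_cst with cdb.
  unfold a. rewrite <- E_scal by auto. apply E_abs; auto using pw_cst, ZZ_pw with cdb.
  intros x Hx. unfold ZZ.
  replace (exp (l ^ 2 / 2) * cos (l * msum i k x + th) - cos (l * msum i k x + th) * ee (wsum i k x))
    with (cos (l * msum i k x + th) * (exp (l ^ 2 / 2) - ee (wsum i k x))) by ring.
  rewrite Rabs_mult.
  assert (C1 : Rabs (cos (l * msum i k x + th)) <= 1) by (apply Rabs_le, COS_bound).
  pose proof (wsum_nonneg i k x Hx). unfold ee. pose proof (pow2_ge_0 l).
  assert (M : Rmin (wsum i k x) 2 <= 2) by apply Rmin_r.
  pose proof (exp_lip (l ^ 2 / 2) (l ^ 2 / 2 * Rmin (wsum i k x) 2) (l ^ 2) ltac:(lra) ltac:(nra)) as XL.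
  assert (Rabs (l ^ 2 / 2 - l ^ 2 / 2 * Rmin (wsum i k x) 2) <= l ^ 2 * Rabs (wsum i k x - 1)).
  { replace (l ^ 2 / 2 - l ^ 2 / 2 * Rmin (wsum i k x) 2) with (l ^ 2 * ((1 - Rmin (wsum i k x) 2) / 2)) by field.
    rewrite Rabs_mult, (Rabs_pos_eq (l ^ 2)) by auto. apply Rmult_le_compat_l; auto.
    unfold Rmin, Rabs; destruct Rle_dec; repeat destruct Rcase_abs; lra. }
  pose proof (Rabs_pos (exp (l ^ 2 / 2) - exp (l ^ 2 / 2 * Rmin (wsum i k x) 2))).
  pose proof (exp_pos (l ^ 2)). pose proof (Rabs_pos (wsum i k x - 1)).
  assert (0 <= Rabs l ^ 3) by (apply pow_le, Rabs_pos).
  pose proof (pow4_ge_0 l).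
  apply Rle_trans with (exp (l ^ 2) * (l ^ 2 * Rabs (wsum i k x - 1))).
  { apply Rle_trans with (1 * Rabs (exp (l ^ 2 / 2) - exp (l ^ 2 / 2 * Rmin (wsum i k x) 2))).
    apply Rmult_le_compat_r; auto. rewrite Rmult_1_l. apply Rle_trans with (1 := XL).
    apply Rmult_le_compat_l; lra. }
  unfold kap. rewrite Rmult_assoc. apply Rmult_le_compat_l. lra. apply Rmult_le_compat_r; lra. }
pose proof (ZZ_bound i k) as ZB.
set (X := exp (l ^ 2 / 2) * _) in *.
replace (X - cos th) with ((X - E k (ZZ i k)) + (E k (ZZ i k) - cos th)) by ring.
eapply Rle_trans; [apply Rabs_triang|].
eapply Rle_trans; [apply Rplus_le_compat; [exact B3|exact ZB]|].
rewrite <- Rmult_plus_distr_l. apply Rmult_le_compat_l; auto.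
assert (0 <= a).
{ rewrite <- (E_const k 0). apply E_le; auto using pw_cst. intros; apply Rabs_pos. }
replace ((3 * v + INR i * (2 * del)) / e) with (3 * (v / e) + INR i * (2 * (del / e))) by (field; lra).
nra.
Qed.

End Martingale.

(** * Martingale decomposition of the Birkhoff sums *)

Fixpoint tsum (r : R) (i n : nat) : R :=
  match n with O => 0 | S n => Rpower (INR i + 1) (- r) + tsum r (S i) n end.

Lemma tsum_nonneg r n : forall i, 0 <= tsum r i n.
Proof.
induction n; intros; simpl. lra. pose proof (Rpower_pos (INR i + 1) (- r)).
specialize (IHn (S i)). lra.
Qed.

(** Integral comparison in the form [(r - 1) (x + 1)^-r <= x^(1 - r) - (x + 1)^(1 - r)]; the first
    term of the sum is bounded by 1. *)
Lemma tsum_bound r i n : 1 < r -> tsum r i n <= 1 + / (r - 1).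
Proof.
intros Hr. assert (HI : 0 < / (r - 1)) by (apply Rinv_0_lt_compat; lra).
assert (K : forall n i, tsum r (S i) n <= / (r - 1) * Rpower (INR i + 1) (1 - r)).
{ clear n i. induction n; intros i.
  - simpl. pose proof (Rpower_pos (INR i + 1) (1 - r)). nra.
  - change (tsum r (S i) (S n)) with (Rpower (INR (S i) + 1) (- r) + tsum r (S (S i)) n).
    specialize (IHn (S i)). rewrite S_INR in *. set (x := INR i + 1) in *.
    assert (Hx : 1 <= x) by (unfold x; pose proof (pos_INR i); lra).
    assert (E : Rpower (x + 1) (- r) = Rpower (x + 1) (1 - r) * / (x + 1)).
    { replace (- r) with ((1 - r) + - (1)) by ring. rewrite Rpower_plus. f_equal.
      rewrite Rpower_Ropp, Rpower_1; lra. }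
    assert (B : Rpower (x + 1) (1 - r) * (1 + (r - 1) * / (x + 1)) <= Rpower x (1 - r)).
    { replace (Rpower x (1 - r)) with (Rpower (x + 1) (1 - r) * Rpower (x / (x + 1)) (1 - r)).
      2:{ rewrite Rpower_mult_distr; try lra. f_equal; field; lra. apply Rdiv_lt_0_compat; lra. }
      apply Rmult_le_compat_l. left; apply Rpower_pos.
      unfold Rpower. eapply Rle_trans; [|apply exp_ineq1_le].
      assert (ln (x / (x + 1)) <= - / (x + 1)).
      { rewrite <- (ln_exp (- / (x + 1))). apply ln_le. apply Rdiv_lt_0_compat; lra.
        eapply Rle_trans; [|apply exp_ineq1_le]. right; field; lra. }
      nra. }
    rewrite E. set (w := Rpower (x + 1) (1 - r)) in *.
    apply Rmult_le_reg_l with (r - 1); [lra|].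
    rewrite Rmult_plus_distr_l, <- !Rmult_assoc, Rinv_r, Rmult_1_l by lra.
    assert ((r - 1) * tsum r (S (S i)) n <= w).
    { apply Rle_trans with ((r - 1) * (/ (r - 1) * w)). apply Rmult_le_compat_l; lra. right; field; lra. }
    lra. }
destruct n; simpl. lra.
assert (forall i, 0 < INR i + 1) by (intros j; pose proof (pos_INR j); lra).
assert (W : forall u, 0 <= u -> Rpower (INR i + 1) (- u) <= 1).
{ intros u Hu. eapply Rle_trans; [|right; apply (Rpower_base1 (- u))]. apply Rpower_neg_anti; auto. pose proof (pos_INR i); lra. }
specialize (K n i). pose proof (W r ltac:(lra)). pose proof (W (r - 1) ltac:(lra)).
replace (- (r - 1)) with (1 - r) in H1 by ring. nra.
Qed.

Lemma Pcl g f x : P g f (cl x) = P g f x.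
Proof.
assert (C : cl (cl x) = cl x) by (apply cl_id, cl_range).
unfold P, yl. now rewrite C.
Qed.

Lemma pow_bound_int F B a : cont F -> 0 <= a < 1 -> 0 <= B ->
  (forall x, 0 < x <= 1 -> F x <= B * Rpower x (- a)) -> RInt F 0 1 <= B / (1 - a).
Proof.
intros. pose proof (power_int_bound F a B 1 H H0 H1 ltac:(lra) H2) as K.
rewrite Rpower_base1 in K. lra.
Qed.

Lemma shift_shift j k gs : shift j (shift k gs) = shift (k + j) gs.
Proof. apply functional_extensionality; intros i. unfold shift. f_equal; lia. Qed.

Lemma Pit_zero gs n : Pit gs n (fun _ => 0) = fun _ => 0.
Proof.
induction n; simpl; auto. rewrite IHn. apply functional_extensionality; intros x.
unfold P, Rdiv; ring.
Qed.

Section Chain.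
Variable alpha : R.
Hypothesis Halpha : 0 < alpha < 1 / 9.
Variable beta : nat -> R.
Hypothesis Hbeta : forall k, (1 <= k)%nat -> 0 < beta k <= alpha.
Variable f : R -> R.
Variable L : R.
Hypothesis HL : 0 < L.
Hypothesis fc : cont f.
Hypothesis fb : forall x, 0 <= x <= 1 -> Rabs (f x) <= L.
Hypothesis fl : forall x y, 0 <= x <= 1 -> 0 <= y <= 1 -> Rabs (f x - f y) <= L * Rabs (x - y).

(** The maps are numbered from 1, the transfer operators from 0. *)
Definition gs : nat -> R := fun k => beta (S k).

Lemma Hgs : ok alpha gs.
Proof. intros k. apply Hbeta. lia. Qed.

Lemma gs_le1 k : 0 < gs k <= 1.
Proof. pose proof (Hgs k). lra. Qed.

Lemma alpha_lt1 : 0 < alpha < 1.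
Proof. lra. Qed.

(** Density of the image of [m] under the first [k] maps. *)
Definition h (k : nat) : R -> R := Pit gs k cst1.
Definition TT (k : nat) (x : R) : R := Tmap (gs k) x.

Lemma h_cone k : cone (h k).
Proof. apply (Pit_cone alpha alpha_lt1 gs Hgs). apply cone_one. Qed.

Lemma h_cont k : cont (h k).
Proof. apply cone_cont, h_cone. Qed.

Lemma h_mass k : RInt (h k) 0 1 = 1.
Proof. unfold h. rewrite (Pit_mass alpha alpha_lt1 gs Hgs). apply RInt_one. apply cone_cont, cone_one. Qed.

Lemma h_ge : exists Dl, 0 < Dl <= 1 /\ forall k x, Dl <= h k x.
Proof.
destruct (h_low alpha alpha_lt1) as (Dl & HD & K). exists Dl. split; auto.
intros k x. unfold h. destruct k; simpl. unfold cst1; lra.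
rewrite <- Pcl. apply (K gs (S k) (cl x) Hgs). apply cl_range.
Qed.

Lemma h_pos k x : 0 < h k x.
Proof. destruct h_ge as (Dl & HD & K). specialize (K k x). lra. Qed.

Lemma h_ne k x : h k x <> 0.
Proof. pose proof (h_pos k x). lra. Qed.

Lemma h_up k x : 0 < x <= 1 -> h k x <= Bh alpha * Rpower x (- alpha).
Proof. intros. apply (h_bnd alpha alpha_lt1); auto using Hgs. Qed.

Lemma Bh_ge2 : 2 <= Bh alpha.
Proof. apply Bh_ge, alpha_lt1. Qed.

Lemma h_Reg k : Reg alpha (2 * Bh alpha) (h k).
Proof.
pose proof Bh_ge2. apply Reg_cone; try lra. apply h_cone. intros x Hx; now apply h_up.
Qed.

Lemma hinv_Reg : exists A, 0 < A /\ forall k, Reg 0 A (fun x => / h k x).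
Proof.
destruct h_ge as (Dl & HD & K). exists (2 / Dl). split. apply Rdiv_lt_0_compat; lra.
intros k. apply (Reg_inv 0 Dl); try lra. apply h_cone. intros; apply K.
Qed.

Lemma Tcomp_pw k F : pw 0 1 F -> pw 0 1 (fun x => F (Tcomp beta k x)).
Proof.
revert F. induction k; intros F H; simpl; auto.
apply (IHk (fun x => F (Tmap (beta (S k)) x))). apply pw_Tmap; auto. apply (gs_le1 k).
Qed.

Lemma Tcomp_dual k w F : cont w -> pw 0 1 F ->
  RInt (fun x => w x * F (Tcomp beta k x)) 0 1 = RInt (fun x => Pit gs k w x * F x) 0 1.
Proof.
intros Hw. revert F. induction k; intros F H; simpl; auto.
rewrite (IHk (fun x => F (Tmap (beta (S k)) x))) by (apply pw_Tmap; auto; apply (gs_le1 k)).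
apply duality; auto. apply (gs_le1 k). apply (Pit_cont alpha alpha_lt1 gs Hgs); auto.
Qed.

Lemma Tcomp_range k x : 0 <= x <= 1 -> 0 <= Tcomp beta k x <= 1.
Proof. intros H. induction k; simpl; auto. apply Tmap_range; auto. apply (gs_le1 k). Qed.

Lemma Tcomp_int k F : pw 0 1 F -> RInt (fun x => F (Tcomp beta k x)) 0 1 = RInt (fun x => h k x * F x) 0 1.
Proof.
intros H. unfold h. rewrite <- (Tcomp_dual k cst1) by (auto; apply cone_cont, cone_one).
apply RInt_eq. lra. intros; unfold cst1; ring.
Qed.

(** * The centred observable and the potential [G] *)

Definition mean (k : nat) : R := RInt (fun x => f (Tcomp beta k x)) 0 1.
Definition fk (k : nat) (x : R) : R := f x - mean k.
Definition psi (k : nat) (x : R) : R := fk k x * h k x.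

Fixpoint G (k : nat) : R -> R :=
  match k with O => fun _ => 0 | S k => fun x => psi (S k) x + P (gs k) (G k) x end.

Lemma mean_bound k : Rabs (mean k) <= L.
Proof.
unfold mean. replace L with ((1 - 0) * L) by ring. apply abs_RInt_le_const. lra.
apply pw_ex, Tcomp_pw, pw_cont; auto; lra. intros; apply fb, Tcomp_range; lra.
Qed.

Lemma fk_cont k : cont (fk k).
Proof. unfold fk; auto with cdb. Qed.

Lemma fk_Reg k : Reg 0 (2 * L) (fk k).
Proof.
pose proof (mean_bound k) as M. split; intros.
- pose proof (Rpower_neg_ge1 x 0 H ltac:(lra)). specialize (fb x ltac:(lra)).
  assert (Rabs (fk k x) <= 2 * L); [|nra].
  unfold fk. eapply Rle_trans; [apply Rabs_triang|]. rewrite Rabs_Ropp. lra.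
- pose proof (Rpower_neg_ge1 x 0 ltac:(lra) ltac:(lra)). pose proof (ratio_range x y H H0).
  specialize (fl x y ltac:(lra) ltac:(lra)).
  replace (fk k x - fk k y) with (f x - f y) by (unfold fk; ring).
  rewrite (Rabs_left1 (x - y)) in fl by lra.
  assert (y - x <= 1 - x / y). { assert (x = x / y * y) by (field; lra). nra. }
  apply Rle_trans with (L * (1 - x / y)). nra.
  assert (0 <= L * (1 - x / y)) by (apply Rmult_le_pos; lra). nra.
Qed.

Lemma psi_cont k : cont (psi k).
Proof. unfold psi; auto using fk_cont, h_cont with cdb. Qed.

Lemma psi_mean k : RInt (psi k) 0 1 = 0.
Proof.
unfold psi, fk.
transitivity (RInt (fun x => h k x * f x - mean k * h k x) 0 1).
apply RInt_eq. lra. intros; ring.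
rewrite RInt_sub, RInt_mull, h_mass; auto using h_cont with cdb.
unfold mean. rewrite Tcomp_int. eqR; ring. apply pw_cont; auto; lra.
Qed.

Definition Apsi : R := 2 * (2 * L) * (2 * Bh alpha).

Lemma Apsi_pos : 0 < Apsi.
Proof. pose proof Bh_ge2. unfold Apsi. nra. Qed.

Lemma psi_Reg k : Reg alpha Apsi (psi k).
Proof.
pose proof Bh_ge2. rewrite <- (Rplus_0_l alpha). apply Reg_mult; try lra. apply fk_Reg. apply h_Reg.
Qed.

Lemma G_cont k : cont (G k).
Proof. induction k; simpl; auto using psi_cont, P_cont, gs_le1 with cdb. Qed.

Definition kappa : R := alpha + 1 / 9.

(** The induction concerns [G k] followed by [i] further transfer operators: since [G (S k)] is a
    mean-zero term plus [P] of [G k], the second summand reappears with [i + 1]. The constants add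
    up to [tsum r i k], and [i = 0] is the claim. *)
Lemma G_Reg : exists A, 0 < A /\ forall k, Reg kappa A (G k).
Proof.
(* With this weight [alpha (1 - th) + th = kappa], and the decay exponent [(1 - alpha) / alpha * th]
   becomes [1 / (9 alpha)]. *)
set (th := 1 / 9 / (1 - alpha)).
assert (Hth : 0 <= th <= 1).
{ unfold th. split. apply Rdiv_le_0_compat; lra. apply Rle_div_l; lra. }
destruct (Reg_decay alpha alpha_lt1 alpha ltac:(lra) th Hth) as (C & HC & RD).
set (r := 1 / 9 / alpha).
assert (Hr : 1 < r) by (apply Rlt_div_r; lra).
assert (HI : 0 < / (r - 1)) by (apply Rinv_0_lt_compat; lra).
pose proof Apsi_pos as HA.
assert (K : forall k i, Reg kappa (C * Apsi * tsum r i k) (Pit (shift k gs) i (G k))).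
{ induction k; intros i.
  - simpl. rewrite Pit_zero, Rmult_0_r. rewrite <- Rabs_R0 at 1. apply Reg_const. unfold kappa; lra.
  - simpl tsum. rewrite Rmult_plus_distr_l. simpl G. rewrite Pit_plus.
    apply Reg_plus.
    + specialize (RD (shift (S k) gs) Apsi (psi (S k)) (ok_shift alpha (S k) gs Hgs) HA (psi_cont _) (psi_Reg _) (psi_mean _) i).
      replace (alpha * (1 - th) + th) with kappa in RD by (unfold th, kappa; field; lra).
      replace ((1 - alpha) / alpha * th) with r in RD by (unfold th, r; field; lra). exact RD.
    + specialize (IHk (S i)). rewrite Pit_peel, shift_shift in IHk.
      replace (k + 1)%nat with (S k) in IHk by lia.
      replace (shift k gs 0) with (gs k) in IHk by (unfold shift; f_equal; lia). exact IHk. }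
assert (HCA : 0 < C * Apsi) by (apply Rmult_lt_0_compat; lra).
exists (C * Apsi * (1 + / (r - 1))). split. apply Rmult_lt_0_compat; lra.
intros k. specialize (K k 0%nat). simpl in K. eapply Reg_weaken; [exact K| |lra].
pose proof (tsum_bound r 0 k Hr). pose proof (tsum_nonneg r k 0). split.
apply Rmult_le_pos; lra. apply Rmult_le_compat_l; lra.
Qed.

(** * Martingale differences and their conditional variances *)

Definition PG (k : nat) : R -> R := P (gs k) (G k).
Definition HG (k : nat) (x : R) : R := G k x / h k x.
(** Conditional expectation of [HG (pred k)] given the point at time [k]. The value at [k = 0] is
    only a default. *)
Definition U (k : nat) (x : R) : R := PG (pred k) x / h k x.
Definition G2 (k : nat) (x : R) : R := G k x ^ 2 / h k x.
(** Conditional second moment of [HG (pred k)] minus the square of its conditional mean, given the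
    point at time [k]; [G2] is the square of [HG] times the density. *)
Definition q (k : nat) (x : R) : R := P (gs (pred k)) (G2 (pred k)) x / h k x - U k x ^ 2.
Definition D (k : nat) (x : R) : R := HG k x - U (S k) (TT k x).

Lemma div_h_cont F k : cont F -> cont (fun x => F x / h k x).
Proof. intros; apply cont_div; auto using h_cont, h_ne. Qed.

Lemma H_cont k : cont (HG k).
Proof. apply div_h_cont, G_cont. Qed.

Lemma PG_cont k : cont (PG k).
Proof. apply P_cont; auto using gs_le1, G_cont. Qed.

Lemma U_cont k : cont (U k).
Proof. apply div_h_cont, PG_cont. Qed.

Lemma G2_cont k : cont (G2 k).
Proof. apply (div_h_cont (fun x => G k x ^ 2)); auto using G_cont with cdb. Qed.

Lemma q_cont k : cont (q k).
Proof.
apply cont_minus. apply (div_h_cont (P (gs (pred k)) (G2 (pred k)))).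
apply P_cont; auto using gs_le1, G2_cont. auto using U_cont with cdb.
Qed.

Lemma TT_pw k F : pw 0 1 F -> pw 0 1 (fun x => F (TT k x)).
Proof. intros; apply pw_Tmap; auto using gs_le1. Qed.

Lemma TT_range k x : 0 <= x <= 1 -> 0 <= TT k x <= 1.
Proof. apply Tmap_range, gs_le1. Qed.

Lemma TT_dual k w F : cont w -> pw 0 1 F ->
  RInt (fun x => w x * F (TT k x)) 0 1 = RInt (fun x => P (gs k) w x * F x) 0 1.
Proof. intros; apply duality; auto using gs_le1. Qed.

Lemma pw_of_cont g : cont g -> pw 0 1 g.
Proof. intros; apply pw_cont; auto; lra. Qed.

Lemma D_pw k : pw 0 1 (D k).
Proof. apply pw_minus. apply pw_of_cont, H_cont. apply TT_pw, pw_of_cont, U_cont. Qed.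

Lemma E_TT k F : pw 0 1 F -> Ex h k (fun x => F (TT k x)) = Ex h (S k) F.
Proof. intros. apply TT_dual; auto using h_cont. Qed.

Lemma hU k x : h (S k) x * U (S k) x = PG k x.
Proof. unfold U. simpl pred. field. apply h_ne. Qed.

Lemma hH k x : h k x * HG k x = G k x.
Proof. unfold HG. field. apply h_ne. Qed.

(** By duality both halves of [D k] contribute the integral of [PG k * F]; for the second half
    because [P] sends [h k] to [h (S k)], which cancels the denominator of [U]. *)
Lemma mart_D1 k F : pw 0 1 F -> Ex h k (fun x => D k x * F (TT k x)) = 0.
Proof.
intros HF. unfold Ex.
assert (pU := pw_of_cont _ (U_cont (S k))). assert (pG := pw_of_cont _ (G_cont k)). assert (ph := pw_of_cont _ (h_cont k)).
assert (pUF : pw 0 1 (fun x => U (S k) x * F x)) by auto with cdb.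
assert (p1 := TT_pw k _ HF). assert (p2 := TT_pw k _ pUF). cbv beta in p1, p2.
transitivity (RInt (fun x => G k x * F (TT k x) - h k x * (U (S k) (TT k x) * F (TT k x))) 0 1).
{ apply RInt_eq. lra. intros x _. unfold D. rewrite <- (hH k x). ring. }
rewrite RInt_sub by auto with cdb.
rewrite TT_dual, (TT_dual k (h k) (fun x => U (S k) x * F x)); auto using G_cont, h_cont.
rewrite <- RInt_sub by (apply pw_ex, pw_mult; auto; apply pw_of_cont; first [apply PG_cont | apply (h_cont (S k))]).
transitivity (RInt (fun _ => 0) 0 1). 2: rewrite RInt_cst; eqR; ring.
apply RInt_eq. lra. intros x _. change (P (gs k) (h k) x) with (h (S k) x).
rewrite <- Rmult_assoc, hU. unfold PG. ring.
Qed.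

(** Expanding the square and dualising the three terms gives [P G2 - 2 PG U + h U^2]; as [PG = h U]
    at time [S k], this is [h q]. *)
Lemma mart_D2 k F : pw 0 1 F ->
  Ex h k (fun x => D k x ^ 2 * F (TT k x)) = Ex h (S k) (fun x => q (S k) x * F x).
Proof.
intros HF. unfold Ex.
assert (pU := pw_of_cont _ (U_cont (S k))). assert (pG := pw_of_cont _ (G_cont k)). assert (ph := pw_of_cont _ (h_cont k)).
assert (pG2 := pw_of_cont _ (G2_cont k)).
assert (pUF : pw 0 1 (fun x => U (S k) x * F x)) by auto with cdb.
assert (pUF2 : pw 0 1 (fun x => U (S k) x ^ 2 * F x)) by auto with cdb.
assert (p1 := TT_pw k _ HF). assert (p2 := TT_pw k _ pUF). assert (p3 := TT_pw k _ pUF2). cbv beta in p1, p2, p3.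
assert (pPG := pw_of_cont _ (PG_cont k)). assert (pPG2 : pw 0 1 (P (gs k) (G2 k))) by (apply pw_of_cont, P_cont; auto using gs_le1, G2_cont).
assert (ph' := pw_of_cont _ (h_cont (S k))).
transitivity (RInt (fun x => (G2 k x * F (TT k x) - 2 * (G k x * (U (S k) (TT k x) * F (TT k x))))
   + h k x * (U (S k) (TT k x) ^ 2 * F (TT k x))) 0 1).
{ apply RInt_eq. lra. intros x _. unfold D, G2. rewrite <- (hH k x). field. apply h_ne. }
rewrite RInt_add, RInt_sub, RInt_mull by (apply pw_ex; auto 10 using pw_cst with cdb).
rewrite TT_dual, (TT_dual k (G k) (fun x => U (S k) x * F x)), (TT_dual k (h k) (fun x => U (S k) x ^ 2 * F x)); auto using G_cont, h_cont, G2_cont.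
fold (PG k). change (P (gs k) (h k)) with (h (S k)).
rewrite <- RInt_mull, <- RInt_sub, <- RInt_add by (apply pw_ex; auto 10 using pw_cst with cdb).
apply RInt_eq. lra. intros x _. unfold q. simpl pred.
rewrite <- (hU k x). field. apply h_ne.
Qed.

(* Cauchy-Schwarz over the two preimages of [x]. *)
Lemma q_nonneg k x : 0 <= x <= 1 -> 0 <= q (S k) x.
Proof.
intros Hx. unfold q, U. simpl pred.
replace (P (gs k) (G2 k) x / h (S k) x - (PG k x / h (S k) x) ^ 2)
  with ((P (gs k) (G2 k) x * h (S k) x - PG k x ^ 2) * / h (S k) x ^ 2) by (field; apply h_ne).
apply Rmult_le_pos. 2:{ left; apply Rinv_0_lt_compat, pow_lt, h_pos. }
change (h (S k) x) with (P (gs k) (h k) x). unfold PG, P, G2.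
set (y := yl (gs k) x). set (z := (cl x + 1) / 2).
pose proof (h_pos k y) as Hy. pose proof (h_pos k z) as Hz.
pose proof (dlf_ge1 (gs k) y ltac:(pose proof (gs_le1 k); lra)) as Hd.
set (w := / dlf (gs k) y). assert (0 < w) by (apply Rinv_0_lt_compat; lra).
unfold Rdiv. fold w. set (a := G k y) in *. set (b := G k z) in *. set (u := h k y) in *. set (v := h k z) in *.
replace ((a ^ 2 * / u * w + b ^ 2 * / v * / 2) * (u * w + v * / 2) - (a * w + b * / 2) ^ 2)
  with (w * / 2 * (a * v - b * u) ^ 2 * (/ u * / v)) by (field; lra).
assert (0 < / u) by (apply Rinv_0_lt_compat; lra). assert (0 < / v) by (apply Rinv_0_lt_compat; lra).
pose proof (pow2_ge_0 (a * v - b * u)).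
apply Rmult_le_pos; [|nra]. apply Rmult_le_pos; nra.
Qed.

Lemma kappa_range : 1 / 9 < kappa < 2 / 9.
Proof. unfold kappa; lra. Qed.

(** Division by the density keeps the exponent [kappa], because the inverse density has exponent
    0. *)
Lemma HU_Reg : exists A, 0 < A /\ (forall k, Reg kappa A (HG k)) /\ (forall k, Reg kappa A (U (S k))).
Proof.
destruct G_Reg as (A & HA & RG). destruct hinv_Reg as (B & HB & RI). pose proof kappa_range.
exists (2 * (10 * A) * B). split. nra. split; intros k.
- pose proof (Reg_mult kappa 0 A B (G k) (fun x => / h k x) ltac:(lra) ltac:(lra) ltac:(lra) (RG k) (RI k)) as R.
  rewrite Rplus_0_r in R. eapply Reg_weaken; [exact R| |lra]. nra.
- rewrite <- (Rplus_0_r kappa). apply (Reg_mult kappa 0 (10 * A) B (PG k) (fun x => / h (S k) x)); auto; try lra.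
  apply Reg_P; auto using gs_le1; lra.
Qed.

Lemma Reg_pow2 a A g : 0 <= a -> 0 <= A -> Reg a A g -> Reg (2 * a) (2 * A * A) (fun x => g x ^ 2).
Proof.
intros. replace (2 * a) with (a + a) by ring.
replace (fun x => g x ^ 2) with (fun x => g x * g x) by (apply functional_extensionality; intros; ring).
apply Reg_mult; auto.
Qed.

(** Covariances need both forms: [h q] is pushed forward, [q] is integrated against. In
    [h q = P (G^2 / h) - PG^2 / h] densities occur only as divisors, so the exponent is [2 kappa]
    and not [2 kappa + alpha]. *)
Lemma q_Reg : exists A, 0 < A /\ (forall k, Reg (2 * kappa) A (fun x => h (S k) x * q (S k) x)) /\
  (forall k, Reg (2 * kappa) A (q (S k))).
Proof.
destruct G_Reg as (A & HA & RG). destruct hinv_Reg as (B & HB & RI). pose proof kappa_range.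
assert (RPG : forall k, Reg kappa (10 * A) (PG k)) by (intros; apply Reg_P; auto using gs_le1; lra).
assert (R1 : forall k, Reg (2 * kappa) (10 * (2 * (2 * A * A) * B)) (P (gs k) (G2 k))).
{ intros k. apply Reg_P; auto using gs_le1; try lra. nra.
  rewrite <- (Rplus_0_r (2 * kappa)).
  apply (Reg_mult (2 * kappa) 0 (2 * A * A) B (fun x => G k x ^ 2) (fun x => / h k x)); auto; try lra; try nra.
  apply Reg_pow2; auto; lra. }
assert (R2 : forall k, Reg (2 * kappa) (2 * (2 * (10 * A) * (10 * A)) * B) (fun x => PG k x ^ 2 * / h (S k) x)).
{ intros k. rewrite <- (Rplus_0_r (2 * kappa)).
  apply (Reg_mult (2 * kappa) 0 (2 * (10 * A) * (10 * A)) B (fun x => PG k x ^ 2) (fun x => / h (S k) x)); auto; try lra; try nra.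
  apply Reg_pow2; auto; lra. }
set (A1 := 10 * (2 * (2 * A * A) * B)) in *. set (A2 := 2 * (2 * (10 * A) * (10 * A)) * B) in *.
assert (HA1 : 0 < A1) by (unfold A1; repeat apply Rmult_lt_0_compat; lra).
assert (HA2 : 0 < A2) by (unfold A2; repeat apply Rmult_lt_0_compat; lra).
assert (R3 : forall k, Reg (2 * kappa) (A1 + A2) (fun x => h (S k) x * q (S k) x)).
{ intros k. pose proof (Reg_plus _ _ _ _ _ (R1 k) (Reg_scal _ _ (-1) _ (R2 k))) as R.
  replace (Rabs (-1)) with 1 in R by (rewrite Rabs_left; lra). rewrite Rmult_1_l in R.
  replace (fun x => h (S k) x * q (S k) x) with (fun x => P (gs k) (G2 k) x + -1 * (PG k x ^ 2 * / h (S k) x)); auto.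
  apply functional_extensionality; intros x. unfold q, U. simpl pred. field. apply h_ne. }
exists ((A1 + A2) + 2 * (A1 + A2) * B).
assert (0 < (A1 + A2) * B) by (apply Rmult_lt_0_compat; lra).
split. lra. split; intros k.
- eapply Reg_weaken; [apply R3| |]; lra.
- pose proof (Reg_mult (2 * kappa) 0 (A1 + A2) B _ _ ltac:(lra) ltac:(lra) ltac:(lra) (R3 k) (RI (S k))) as R.
  rewrite Rplus_0_r in R. eapply Reg_weaken.
  replace (q (S k)) with (fun x => h (S k) x * q (S k) x * / h (S k) x). exact R.
  apply functional_extensionality; intros x. field. apply h_ne. lra. lra.
Qed.

(** The density contributes [alpha] to the exponent that has to stay below 1. *)
Lemma E_pow_bound a A g k n : 0 <= a -> 0 <= A -> cont g -> INR n * a + alpha < 1 ->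
  (forall x, 0 < x <= 1 -> Rabs (g x) <= A * Rpower x (- a)) ->
  Ex h k (fun x => g x ^ n) <= A ^ n * Bh alpha / (1 - (INR n * a + alpha)).
Proof.
intros Ha HA Hg Hn HR. pose proof Bh_ge2. pose proof (pos_INR n).
apply pow_bound_int; auto using h_cont with cdb.
- split; [|auto]. nra.
- pose proof (pow_le A n HA). nra.
- intros x Hx. specialize (HR x Hx). pose proof (h_up k x Hx) as Hh. pose proof (h_pos k x).
  assert (E : Rpower x (- (INR n * a + alpha)) = Rpower x (- a) ^ n * Rpower x (- alpha)).
  { rewrite <- Rpower_pow by apply Rpower_pos. rewrite Rpower_mult, <- Rpower_plus. f_equal; ring. }
  rewrite E.
  assert (g x ^ n <= A ^ n * Rpower x (- a) ^ n).
  { rewrite <- Rpow_mult_distr. apply Rle_trans with (1 := Rle_abs _). rewrite <- RPow_abs.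
    apply pow_incr. split; auto. apply Rabs_pos. }
  apply Rle_trans with (h k x * (A ^ n * Rpower x (- a) ^ n)). apply Rmult_le_compat_l; lra.
  replace (A ^ n * Bh alpha * (Rpower x (- a) ^ n * Rpower x (- alpha)))
    with ((Bh alpha * Rpower x (- alpha)) * (A ^ n * Rpower x (- a) ^ n)) by ring.
  apply Rmult_le_compat_r; auto. rewrite <- Rpow_mult_distr. apply pow_le.
  apply Rmult_le_pos; auto. left; apply Rpower_pos.
Qed.

Lemma h_nonneg k x : 0 <= x <= 1 -> 0 <= h k x.
Proof. intros; left; apply h_pos. Qed.

(** The tightest condition is that for the fourth moments of [HG] and [U], [4 kappa + alpha < 1]; it
    coincides with the one for [q^2], since [q] has exponent [2 kappa]. The second moment of [HG] is
    for the boundary term of the martingale approximation. *)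
Lemma moments : exists C, 0 < C /\ (forall k, Ex h k (fun x => D k x ^ 4) <= C) /\
  (forall k, Ex h (S k) (fun x => q (S k) x ^ 2) <= C) /\
  (forall k, Ex h k (fun x => HG k x ^ 2) <= C).
Proof.
destruct HU_Reg as (A & HA & RH & RU). destruct q_Reg as (B & HB & _ & RQ).
pose proof kappa_range. pose proof Bh_ge2.
set (c4 := A ^ 4 * Bh alpha / (1 - (INR 4 * kappa + alpha))).
set (c2 := B ^ 2 * Bh alpha / (1 - (INR 2 * (2 * kappa) + alpha))).
set (c1 := A ^ 2 * Bh alpha / (1 - (INR 2 * kappa + alpha))).
assert (KH4 : INR 4 * kappa + alpha < 1) by (simpl; unfold kappa in *; lra).
assert (KH2 : INR 2 * (2 * kappa) + alpha < 1) by (simpl; unfold kappa in *; lra).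
assert (KH1 : INR 2 * kappa + alpha < 1) by (simpl; unfold kappa in *; lra).
assert (P4 : 0 < c4) by (apply Rdiv_lt_0_compat; [apply Rmult_lt_0_compat; [apply pow_lt; auto|]|]; lra).
assert (P2 : 0 < c2) by (apply Rdiv_lt_0_compat; [apply Rmult_lt_0_compat; [apply pow_lt; auto|]|]; lra).
assert (P1 : 0 < c1) by (apply Rdiv_lt_0_compat; [apply Rmult_lt_0_compat; [apply pow_lt; auto|]|]; lra).
exists (16 * c4 + c2 + c1). split. lra. split; [|split]; intros k.
- assert (M1 := E_pow_bound kappa A (HG k) k 4 ltac:(lra) ltac:(lra) (H_cont k) KH4 (proj1 (RH k))).
  assert (M2 := E_pow_bound kappa A (U (S k)) (S k) 4 ltac:(lra) ltac:(lra) (U_cont (S k)) KH4 (proj1 (RU k))).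
  fold c4 in M1, M2.
  assert (pU := pw_of_cont _ (U_cont (S k))). assert (pU4 : pw 0 1 (fun x => U (S k) x ^ 4)) by auto with cdb.
  assert (pUT := TT_pw k _ pU4). cbv beta in pUT.
  assert (pH4 : pw 0 1 (fun x => HG k x ^ 4)) by (apply pw_pow, pw_of_cont, H_cont).
  rewrite <- (E_TT k (fun x => U (S k) x ^ 4)) in M2 by auto.
  apply Rle_trans with (Ex h k (fun x => 8 * HG k x ^ 4 + 8 * U (S k) (TT k x) ^ 4)).
  + apply (E_le h h_cont h_nonneg); auto using D_pw, pw_cst with cdb.
    intros x _. unfold D. set (a := HG k x). set (b := U (S k) (TT k x)).
    assert (S2 : (a - b) ^ 2 <= 2 * (a ^ 2 + b ^ 2)) by (pose proof (pow2_ge_0 (a + b)); nra).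
    replace ((a - b) ^ 4) with (((a - b) ^ 2) ^ 2) by ring.
    assert (((a - b) ^ 2) ^ 2 <= (2 * (a ^ 2 + b ^ 2)) ^ 2) by (apply pow_incr; split; auto using pow2_ge_0).
    pose proof (pow2_ge_0 (a ^ 2 - b ^ 2)). nra.
  + rewrite (E_add h h_cont), !(E_scal h h_cont) by auto using pw_cst with cdb. lra.
- pose proof (E_pow_bound (2 * kappa) B (q (S k)) (S k) 2 ltac:(lra) ltac:(lra) (q_cont _) KH2 (proj1 (RQ k))) as M.
  fold c2 in M. lra.
- pose proof (E_pow_bound kappa A (HG k) k 2 ltac:(lra) ltac:(lra) (H_cont _) KH1 (proj1 (RH k))) as M.
  fold c1 in M. lra.
Qed.

(** * Covariances of the conditional variances *)

Definition qbar (k : nat) : R := Ex h k (q k).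
Definition qt (k : nat) (x : R) : R := q k x - qbar k.

Lemma qt_cont k : cont (qt k).
Proof. unfold qt; auto using q_cont with cdb. Qed.

(** Duality moves the map onto the weight [g], so the induction replaces [g] by its image under [P];
    [j] records how many steps of decay have been used up. *)
Lemma covariance_sum C r : 0 <= C -> forall i k j g, cont g ->
  (forall m, Rabs (RInt (fun x => Pit (shift k gs) (S m) g x * qt (k + S m) x) 0 1) <= C * Rpower (INR (j + m) + 1) (- r)) ->
  Rabs (RInt (fun x => g x * wsum qt TT i k x) 0 1) <= C * tsum r j i.
Proof.
intros HC. induction i; intros k j g Hg HB.
- simpl. rewrite Rmult_0_r. right.
  rewrite (RInt_eq _ (fun _ => 0)); try lra. rewrite RInt_cst, Rmult_0_r. apply Rabs_R0. intros; simpl; ring.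
- assert (qp : forall k, pw 0 1 (qt k)) by (intros; apply pw_of_cont, qt_cont).
  assert (W : forall i k, pw 0 1 (wsum qt TT i k)) by (apply wsum_pw; auto using TT_pw).
  simpl wsum. rewrite (TT_dual k g (fun x => qt (S k) x + wsum qt TT i (S k) x)); auto with cdb.
  set (Pg := P (gs k) g). assert (cPg : cont Pg) by (apply P_cont; auto using gs_le1).
  rewrite (RInt_eq _ (fun x => Pg x * qt (S k) x + Pg x * wsum qt TT i (S k) x)); try lra.
  2: intros; ring.
  assert (pPg := pw_of_cont _ cPg).
  rewrite RInt_add by auto with cdb. simpl tsum. rewrite Rmult_plus_distr_l.
  assert (E0 : shift k gs 0 = gs k) by (unfold shift; f_equal; lia).
  eapply Rle_trans; [apply Rabs_triang|]. apply Rplus_le_compat.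
  + specialize (HB 0%nat). simpl in HB. rewrite E0 in HB. fold Pg in HB.
    replace (k + 1)%nat with (S k) in HB by lia. rewrite Nat.add_0_r in HB. exact HB.
  + apply IHi; auto. intros m. specialize (HB (S m)). rewrite Pit_peel, shift_shift, E0 in HB. fold Pg in HB.
    replace (k + 1)%nat with (S k) in HB by lia. replace (k + S (S m))%nat with (S k + S m)%nat in HB by lia.
    replace (S j + m)%nat with (j + S m)%nat by lia. exact HB.
Qed.

Lemma qbar_bound : exists C, 0 < C /\ forall k, Rabs (qbar (S k)) <= C.
Proof.
destruct q_Reg as (A & HA & RQ & _). pose proof kappa_range.
exists (A / (1 - 2 * kappa)). split. apply Rdiv_lt_0_compat; lra.
intros k. unfold qbar, Ex. specialize (RQ k).
assert (cq : cont (fun x => h (S k) x * q (S k) x)) by auto using h_cont, q_cont with cdb.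
eapply Rle_trans; [apply abs_RInt_le; auto with cdb; lra|].
apply pow_bound_int; try lra. apply (cont_comp Rabs); auto with cdb. intros; apply RQ; auto.
Qed.

(** [h qt] has mean zero and exponent [2 kappa]. Transporting it raises the exponent by [tau] in
    exchange for the decay [n^-(tau/alpha)], and multiplication by [qt] adds another [2 kappa]. *)
Lemma cov_decay : exists C r, 0 < C /\ 1 < r /\ forall k m,
  Rabs (RInt (fun x => Pit (shift (S k) gs) (S m) (fun x => h (S k) x * qt (S k) x) x * qt (S k + S m) x) 0 1)
   <= C * Rpower (INR (0 + m) + 1) (- r).
Proof.
destruct q_Reg as (A & HA & RQ1 & RQ2). destruct qbar_bound as (B & HB & KB). pose proof kappa_range.
pose proof Bh_ge2.
(* The midpoint between [alpha], above which the decay is summable, and [1 - 4 kappa], below which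
   the product stays integrable. *)
set (tau := (alpha + 1 - 4 * kappa) / 2).
assert (Ht : alpha < tau /\ 4 * kappa + tau < 1) by (unfold tau, kappa in *; lra).
set (a := 2 * kappa). set (th := tau / (1 - a)).
assert (Hth : 0 <= th <= 1).
{ unfold th, a. split. apply Rdiv_le_0_compat; lra. apply Rle_div_l; lra. }
destruct (Reg_decay alpha alpha_lt1 a ltac:(unfold a, kappa in *; lra) th Hth) as (C & HC & RD).
set (r := tau / alpha). assert (Hr : 1 < r) by (apply Rlt_div_r; lra).
set (A1 := A + B * (2 * Bh alpha)). assert (HA1 : 0 < A1) by (unfold A1; nra).
set (A2 := A + B). 
exists (C * A1 * A2 / (1 - (4 * kappa + tau))), r.
split. { apply Rdiv_lt_0_compat; [|lra]. unfold A2. repeat apply Rmult_lt_0_compat; lra. }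
split; auto. intros k m.
set (g := fun x => h (S k) x * qt (S k) x).
assert (cg : cont g) by (unfold g; auto using h_cont, qt_cont with cdb).
assert (Rg : Reg a A1 g).
{ pose proof (Reg_scal alpha _ (- qbar (S k)) _ (h_Reg (S k))) as R.
  assert (R' : Reg a (B * (2 * Bh alpha)) (fun x => - qbar (S k) * h (S k) x)).
  { eapply Reg_weaken; [exact R| |unfold a, kappa; lra]. rewrite Rabs_Ropp. specialize (KB k). pose proof (Rabs_pos (qbar (S k))). nra. }
  pose proof (Reg_plus _ _ _ _ _ (RQ1 k) R') as R2.
  replace g with (fun x => h (S k) x * q (S k) x + - qbar (S k) * h (S k) x); auto.
  apply functional_extensionality; intros x. unfold g, qt. ring. }
assert (Mg : RInt g 0 1 = 0).
{ rewrite (RInt_eq g (fun x => h (S k) x * q (S k) x - qbar (S k) * h (S k) x)); try lra.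
  2: intros; unfold g, qt; ring.
  assert (cont (fun x => h (S k) x * q (S k) x)) by auto using h_cont, q_cont with cdb.
  rewrite RInt_sub, RInt_mull, h_mass; auto using h_cont with cdb.
  unfold qbar, Ex. eqR; ring.
  }
assert (Rqt : forall x, 0 < x <= 1 -> Rabs (qt (S k + S m) x) <= A2 * Rpower x (- a)).
{ intros x Hx. replace (S k + S m)%nat with (S (k + S m)) by lia. unfold qt.
  eapply Rle_trans; [apply Rabs_triang|]. rewrite Rabs_Ropp.
  pose proof (proj1 (RQ2 (k + S m)%nat) x Hx) as Q1. fold a in Q1. specialize (KB (k + S m)%nat).
  pose proof (Rpower_neg_ge1 x a Hx ltac:(unfold a; lra)). unfold A2. nra. }
specialize (RD (shift (S k) gs) A1 g (ok_shift alpha (S k) gs Hgs) HA1 cg Rg Mg (S m)).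
replace (a * (1 - th) + th) with (a + tau) in RD by (unfold th, a; field; lra).
replace ((1 - a) / alpha * th) with r in RD by (unfold th, r, a; field; lra).
set (Pg := Pit (shift (S k) gs) (S m) g) in *.
assert (cP : cont Pg) by (apply (Pit_cont alpha alpha_lt1); auto; apply ok_shift, Hgs).
assert (Hm : 0 < INR m + 1) by (pose proof (pos_INR m); lra).
assert (W : Rpower (INR (S m) + 1) (- r) <= Rpower (INR (0 + m) + 1) (- r)).
{ apply Rpower_neg_anti; [|lra]. rewrite S_INR. simpl. lra. }
set (w := Rpower (INR (0 + m) + 1) (- r)) in *. set (w1 := Rpower (INR (S m) + 1) (- r)) in *.
assert (0 < w1) by apply Rpower_pos.
replace (C * A1 * A2 / (1 - (4 * kappa + tau)) * w) with (C * A1 * A2 * w / (1 - (4 * kappa + tau))) by (field; lra).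
assert (cq := qt_cont (S k + S m)).
eapply Rle_trans; [apply abs_RInt_le; auto with cdb; lra|].
assert (HA2 : 0 < A2) by (unfold A2; lra).
assert (0 < C * A1) by nra.
apply pow_bound_int; try (unfold kappa in *; lra).
- apply (cont_comp Rabs); auto with cdb.
- repeat apply Rmult_le_pos; lra.
- intros x Hx. rewrite Rabs_mult.
  pose proof (proj1 RD x Hx) as R1. specialize (Rqt x Hx).
  pose proof (Rmult_le_compat _ _ _ _ (Rabs_pos _) (Rabs_pos _) R1 Rqt) as M.
  apply Rle_trans with (1 := M).
  replace (Rpower x (- (4 * kappa + tau))) with (Rpower x (- (a + tau)) * Rpower x (- a)) by (rewrite <- Rpower_plus; f_equal; unfold a; ring).
  pose proof (Rpower_pos x (- (a + tau))) as X1. pose proof (Rpower_pos x (- a)) as X2.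
  set (x1 := Rpower x (- (a + tau))) in *. set (x2 := Rpower x (- a)) in *.
  replace (C * A1 * w1 * x1 * (A2 * x2)) with (C * A1 * A2 * (x1 * x2) * w1) by ring.
  replace (C * A1 * A2 * w * (x1 * x2)) with (C * A1 * A2 * (x1 * x2) * w) by ring.
  apply Rmult_le_compat_l; auto. repeat apply Rmult_le_pos; lra.
Qed.

Lemma wsum_qt i : forall k x, wsum qt TT i k x = wsum q TT i k x - Ex h k (wsum q TT i k).
Proof.
induction i; intros k x.
- simpl. rewrite (E_const h h_cont h_mass). ring.
- rewrite (E_wsum_S h q TT h_cont (fun k => pw_of_cont _ (q_cont k)) TT_pw E_TT).
  simpl. rewrite IHi. unfold qt, qbar. ring.
Qed.

(** The square is expanded after the first term only: each step adds one variance and twice the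
    covariance with the sum of all later terms, both bounded uniformly in time, so the total is
    linear in [i]. *)
Lemma variance_bound : exists C, 0 < C /\ forall i k,
  Ex h k (fun x => (wsum q TT i k x - Ex h k (wsum q TT i k)) ^ 2) <= C * INR i.
Proof.
destruct cov_decay as (C & r & HC & Hr & CD). destruct moments as (M & HM & _ & M2 & _).
destruct qbar_bound as (B & HB & KB).
pose proof (Rinv_0_lt_compat (r - 1) ltac:(lra)).
set (K := 2 * (M + B ^ 2) + 2 * (C * (1 + / (r - 1)))). pose proof (pow2_ge_0 B).
assert (HK : 0 < K) by (unfold K; nra).
exists K. split; auto.
assert (Q : forall i k, Ex h k (fun x => wsum qt TT i k x ^ 2) <= K * INR i).
{ assert (qp : forall k, pw 0 1 (qt k)) by (intros; apply pw_of_cont, qt_cont).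
  assert (W : forall i k, pw 0 1 (wsum qt TT i k)) by (apply wsum_pw; auto using TT_pw).
  induction i; intros k.
  - simpl. rewrite (E_ext h k _ (fun _ => 0)) by (intros; ring). rewrite (E_const h h_cont h_mass). lra.
  - simpl wsum. rewrite (E_TT k (fun x => (qt (S k) x + wsum qt TT i (S k) x) ^ 2)) by auto with cdb.
    rewrite (E_ext h (S k) _ (fun x => (qt (S k) x ^ 2 + 2 * (qt (S k) x * wsum qt TT i (S k) x)) + wsum qt TT i (S k) x ^ 2))
      by (intros; ring).
    rewrite !(E_add h h_cont), (E_scal h h_cont) by auto using pw_cst with cdb.
    specialize (IHi (S k)). rewrite S_INR.
    assert (N1 : Ex h (S k) (fun x => qt (S k) x ^ 2) <= 2 * (M + B ^ 2)).
    { apply Rle_trans with (Ex h (S k) (fun x => 2 * q (S k) x ^ 2 + 2 * B ^ 2)).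
      - apply (E_le h h_cont h_nonneg); auto using pw_cst, pw_of_cont, q_cont with cdb.
        intros x _. unfold qt. specialize (KB k). apply Rabs_le_between in KB.
        set (b := qbar (S k)) in *. assert (b ^ 2 <= B ^ 2) by nra.
        pose proof (pow2_ge_0 (q (S k) x + b)). nra.
      - rewrite (E_add h h_cont), (E_scal h h_cont), (E_const h h_cont h_mass) by auto using pw_cst, pw_of_cont, q_cont with cdb.
        specialize (M2 k). lra. }
    assert (N2 : Ex h (S k) (fun x => qt (S k) x * wsum qt TT i (S k) x) <= C * (1 + / (r - 1))).
    { eapply Rle_trans; [apply Rle_abs|]. unfold Ex.
      rewrite (RInt_eq _ (fun x => (fun x => h (S k) x * qt (S k) x) x * wsum qt TT i (S k) x)); try lra.
      2: intros; ring.
      eapply Rle_trans.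
      apply (covariance_sum C r ltac:(lra) i (S k) 0 (fun x => h (S k) x * qt (S k) x)).
      auto using h_cont, qt_cont with cdb. apply CD.
      apply Rmult_le_compat_l; [lra|]. apply tsum_bound; auto. }
    unfold K in *. nra. }
intros i k. eapply Rle_trans; [|apply (Q i k)]. right. apply E_ext. intros. now rewrite wsum_qt.
Qed.

(** * From the martingale to the Birkhoff sums *)

Fixpoint SS (n : nat) (x : R) : R :=
  match n with O => 0 | S k => SS k x + fk (S k) (Tcomp beta (S k) x) end.

Lemma HU_fk k x : HG (S k) x - U (S k) x = fk (S k) x.
Proof. unfold HG, U. simpl. unfold psi, PG. field. apply h_ne. Qed.

(** [HG (S k) - U (S k) = fk (S k)] is the recursion for [G] divided by the density, so the sum of
    the differences telescopes up to two boundary terms. *)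
Lemma SS_msum i : forall k x,
  SS (k + i) x - SS k x = msum D TT i k (Tcomp beta k x) + HG (k + i) (Tcomp beta (k + i) x) - HG k (Tcomp beta k x).
Proof.
induction i; intros k x.
- rewrite Nat.add_0_r. simpl. ring.
- specialize (IHi (S k) x). replace (k + S i)%nat with (S k + i)%nat by lia.
  change (msum D TT (S i) k (Tcomp beta k x))
    with (HG k (Tcomp beta k x) - U (S k) (Tcomp beta (S k) x) + msum D TT i (S k) (Tcomp beta (S k) x)).
  assert (E : SS (S k) x = SS k x + (HG (S k) (Tcomp beta (S k) x) - U (S k) (Tcomp beta (S k) x))).
  { rewrite HU_fk. reflexivity. }
  lra.
Qed.

Lemma SS_decomp n x : SS n x = msum D TT n 0 x + HG n (Tcomp beta n x).
Proof.
pose proof (SS_msum n 0 x) as E. simpl in E. unfold HG at 2 in E. simpl in E.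
replace (0 / h 0 x) with 0 in E by (unfold Rdiv; ring). lra.
Qed.

Lemma SS_pw n : pw 0 1 (SS n).
Proof.
induction n; simpl. apply pw_cst. apply pw_plus; auto.
apply (Tcomp_pw (S n) (fk (S n))). apply pw_of_cont, fk_cont.
Qed.

Lemma msum_scale a i : forall k x, msum (fun k x => a * D k x) TT i k x = a * msum D TT i k x.
Proof. induction i; intros; simpl. ring. rewrite IHi. ring. Qed.

Lemma wsum_scale a i : forall k x, wsum (fun k x => a * q k x) TT i k x = a * wsum q TT i k x.
Proof. induction i; intros; simpl. ring. rewrite IHi. ring. Qed.

Lemma Ex0 F : Ex h 0 F = RInt F 0 1.
Proof. unfold Ex. apply RInt_eq. lra. intros; unfold h; simpl; unfold cst1. ring. Qed.

Definition sg (n : nat) : R := RInt (fun x => SS n x ^ 2) 0 1.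

(** One small parameter [e] governs everything. Smallness of [n / sigma_n^4] controls the variance
    of [V] and the fourth moments after normalisation; smallness of [1 / sigma_n^2] controls the
    boundary term [HG n], which is bounded in L^2. *)
Lemma trig_estimate : exists C, 0 < C /\ forall n l th e, 0 < e <= 1 -> 0 < sg n ->
  C * INR n * / sg n ^ 2 <= e ^ 2 -> C * / sg n <= e ^ 2 ->
  Rabs (RInt (fun x => cos (l * (SS n x / sqrt (sg n)) + th)) 0 1 - exp (- (l ^ 2 / 2)) * cos th)
  <= (2 * Rabs l + 66 * kap l) * e.
Proof.
destruct moments as (C0 & HC0 & M4 & Mq & MH). destruct variance_bound as (C1 & HC1 & VB).
exists (C0 + C1). split. lra. intros n l th e He Hs Hn Hn2.
set (s := sg n) in *. set (a := / sqrt s).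
assert (Hsq : 0 < sqrt s) by (apply sqrt_lt_R0; auto).
assert (Ha : 0 < a) by (apply Rinv_0_lt_compat; auto).
assert (Ha2 : a ^ 2 = / s). { unfold a. rewrite pow_inv. f_equal. apply pow2_sqrt; lra. }
assert (Ha4 : a ^ 4 = / s ^ 2). { replace (a ^ 4) with ((a ^ 2) ^ 2) by ring. rewrite Ha2. apply pow_inv. }
assert (H2 : 0 < / s) by (apply Rinv_0_lt_compat; auto).
assert (H4 : 0 < / s ^ 2) by (apply Rinv_0_lt_compat, pow_lt; auto).
pose proof (pos_INR n) as Pn.
assert (Hnn : 0 <= INR n * / s ^ 2) by (apply Rmult_le_pos; lra).
assert (pS := SS_pw n). assert (qp : forall k, pw 0 1 (q k)) by (intros; apply pw_of_cont, q_cont).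
assert (pm := msum_pw D TT D_pw TT_pw n 0). assert (pww := wsum_pw q TT qp TT_pw n 0).
set (m := msum D TT n 0) in *. set (w := wsum q TT n 0) in *.
set (Hn' := fun x => HG n (Tcomp beta n x)).
assert (pH : pw 0 1 Hn') by (apply (Tcomp_pw n (HG n)), pw_of_cont, H_cont).
assert (EH : RInt (fun x => Hn' x ^ 2) 0 1 <= C0).
{ unfold Hn'. rewrite (Tcomp_int n (fun x => HG n x ^ 2)). apply MH. apply pw_pow, pw_of_cont, H_cont. }
assert (Sm : forall x, SS n x = m x + Hn' x) by (intros; apply SS_decomp).
assert (EW : Ex h 0 w = RInt (fun x => m x ^ 2) 0 1).
{ rewrite <- Ex0. symmetry. apply (E_msum_sq h D q TT h_cont D_pw qp TT_pw E_TT mart_D1 mart_D2). }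
assert (ie : 0 < / e) by (apply Rinv_0_lt_compat; lra).
(* The mean of [V] differs from 1 only through the boundary term [H], whose cross term is split by
   [2 |S H| <= e S^2 + H^2 / e]. *)
assert (B1 : Rabs (a ^ 2 * Ex h 0 w - 1) <= 3 * e).
{ assert (D1 : Rabs (RInt (fun x => m x ^ 2) 0 1 - s) <= e * s + 2 * / e * C0).
  { unfold s at 1, sg. rewrite <- RInt_sub by auto with cdb.
    eapply Rle_trans; [apply abs_RInt_le; auto with cdb; lra|].
    apply Rle_trans with (RInt (fun x => e * SS n x ^ 2 + 2 * / e * Hn' x ^ 2) 0 1).
    - apply RInt_le; try lra; auto with cdb.
      + apply pw_ex. apply (pw_comp 0 1 Rabs). apply cont_abs. auto with cdb.
      + intros x _. rewrite Sm. set (u := m x). set (v := Hn' x).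
        replace (u ^ 2 - (u + v) ^ 2) with (- (2 * ((u + v) * v)) + v ^ 2) by ring.
        assert (1 <= / e). { rewrite <- Rinv_1. apply Rinv_le_contravar; lra. }
        assert (e * / e = 1) by (field; lra).
        assert (v ^ 2 <= / e * v ^ 2) by (pose proof (pow2_ge_0 v); nra).
        assert (Y : forall y, y ^ 2 = v ^ 2 -> 2 * ((u + v) * y) <= e * (u + v) ^ 2 + / e * v ^ 2).
        { intros y Hy. rewrite <- Hy. pose proof (pow2_ge_0 (e * (u + v) - y)).
          apply Rmult_le_reg_l with e; [lra|].
          replace (e * (e * (u + v) ^ 2 + / e * y ^ 2)) with (e ^ 2 * (u + v) ^ 2 + y ^ 2) by (field; lra). nra. }
        pose proof (Y v eq_refl). pose proof (Y (- v) ltac:(ring)). pose proof (pow2_ge_0 v).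
        apply Rabs_le. lra.
    - rewrite RInt_add, !RInt_mull by (apply pw_ex; auto using pw_cst with cdb).
      fold (sg n). fold s. nra. }
  replace (a ^ 2 * Ex h 0 w - 1) with (/ s * (RInt (fun x => m x ^ 2) 0 1 - s)) by (rewrite EW, Ha2; field; lra).
  rewrite Rabs_mult, (Rabs_pos_eq (/ s)) by lra.
  apply Rle_trans with (/ s * (e * s + 2 * / e * C0)). apply Rmult_le_compat_l; lra.
  replace (/ s * (e * s + 2 * / e * C0)) with (e + 2 * / e * (C0 * / s)) by (field; lra).
  assert (C0 * / s <= e ^ 2) by nra.
  apply Rle_trans with (e + 2 * / e * e ^ 2). apply Rplus_le_compat_l. apply Rmult_le_compat_l; lra.
  right; field; lra. }
(* [2 e^2] comes from the variance and [2 (3 e)^2] from the deviation of the mean. *)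
set (v := 20 * e ^ 2).
assert (BV : Ex h 0 (fun x => (a ^ 2 * w x - 1) ^ 2) <= v).
{ set (d := a ^ 2 * Ex h 0 w - 1) in *.
  apply Rle_trans with (Ex h 0 (fun x => 2 * a ^ 4 * (w x - Ex h 0 w) ^ 2 + 2 * d ^ 2)).
  - apply (E_le h h_cont h_nonneg); auto 10 using pw_cst with cdb.
    intros x _. set (u := w x - Ex h 0 w).
    replace (a ^ 2 * w x - 1) with (a ^ 2 * u + d) by (unfold u, d; ring).
    replace (2 * a ^ 4 * u ^ 2) with (2 * (a ^ 2 * u) ^ 2) by ring.
    pose proof (pow2_ge_0 (a ^ 2 * u - d)). nra.
  - rewrite (E_add h h_cont), (E_scal h h_cont), (E_const h h_cont h_mass) by auto 10 using pw_cst with cdb.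
    specialize (VB n 0%nat). fold w in VB. rewrite Ha4.
    assert (d ^ 2 <= 9 * e ^ 2).
    { rewrite <- pow2_abs. replace (9 * e ^ 2) with ((3 * e) ^ 2) by ring. apply pow_incr. split; auto. apply Rabs_pos. }
    assert (/ s ^ 2 * (C1 * INR n) <= e ^ 2) by nra.
    assert (/ s ^ 2 * Ex h 0 (fun x => (w x - Ex h 0 w) ^ 2) <= / s ^ 2 * (C1 * INR n)).
    { apply Rmult_le_compat_l; lra. }
    unfold v. lra. }
assert (CB := clt_bound h (fun k x => a * D k x) (fun k x => a ^ 2 * q k x) TT h_cont h_nonneg h_mass).
assert (sD : forall k, pw 0 1 (fun x => a * D k x)) by (intros; pose proof (D_pw k); auto using pw_cst with cdb).
assert (sq : forall k, pw 0 1 (fun x => a ^ 2 * q k x)) by (intros; auto using pw_cst with cdb).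
specialize (CB sD sq).
assert (sn : forall k x, 0 <= x <= 1 -> 0 <= a ^ 2 * q (S k) x).
{ intros. apply Rmult_le_pos. apply pow2_ge_0. apply q_nonneg; auto. }
specialize (CB sn TT_range TT_pw E_TT).
assert (s1 : forall k F, pw 0 1 F -> Ex h k (fun x => a * D k x * F (TT k x)) = 0).
{ intros k F HF. pose proof (TT_pw k F HF). pose proof (D_pw k).
  rewrite (E_ext h k _ (fun x => a * (D k x * F (TT k x)))) by (intros; ring).
  rewrite (E_scal h h_cont), mart_D1; auto with cdb. ring. }
assert (s2 : forall k F, pw 0 1 F -> Ex h k (fun x => (a * D k x) ^ 2 * F (TT k x)) = Ex h (S k) (fun x => a ^ 2 * q (S k) x * F x)).
{ intros k F HF. pose proof (TT_pw k F HF). pose proof (D_pw k).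
  rewrite (E_ext h k _ (fun x => a ^ 2 * (D k x ^ 2 * F (TT k x)))) by (intros; ring).
  rewrite (E_ext h (S k) _ (fun x => a ^ 2 * (q (S k) x * F x))) by (intros; ring).
  rewrite !(E_scal h h_cont), mart_D2; auto with cdb. }
specialize (CB s1 s2 l th e (C0 * a ^ 4) He).
assert (s3 : 0 <= C0 * a ^ 4) by (rewrite Ha4; nra).
specialize (CB s3).
assert (s4 : forall k, Ex h k (fun x => (a * D k x) ^ 4) <= C0 * a ^ 4).
{ intros k. pose proof (D_pw k).
  rewrite (E_ext h k _ (fun x => a ^ 4 * D k x ^ 4)) by (intros; ring).
  rewrite (E_scal h h_cont) by auto with cdb. specialize (M4 k). rewrite Ha4. nra. }
assert (s5 : forall k, Ex h (S k) (fun x => (a ^ 2 * q (S k) x) ^ 2) <= C0 * a ^ 4).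
{ intros k. rewrite (E_ext h (S k) _ (fun x => a ^ 4 * q (S k) x ^ 2)) by (intros; ring).
  rewrite (E_scal h h_cont) by auto with cdb. specialize (Mq k). rewrite Ha4. nra. }
specialize (CB s4 s5 n 0%nat v).
rewrite (E_ext h 0 _ (fun x => (a ^ 2 * w x - 1) ^ 2)) in CB.
2:{ intros. rewrite wsum_scale. reflexivity. }
specialize (CB BV).
rewrite (E_ext h 0 _ (fun x => cos (l * (a * m x) + th))) in CB.
2:{ intros. rewrite msum_scale. reflexivity. }
rewrite Ex0 in CB.
pose proof (kap_nonneg l) as KN.
(* [66 = 4 + 3 * 20 + 2], the last summand coming from the fourth moments. *)
assert (CB' : Rabs (exp (l ^ 2 / 2) * RInt (fun x => cos (l * (a * m x) + th)) 0 1 - cos th) <= kap l * (66 * e)).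
{ eapply Rle_trans; [exact CB|]. apply Rmult_le_compat_l; auto.
  assert (C0 * a ^ 4 * INR n <= e ^ 2) by (rewrite Ha4; nra).
  apply Rle_trans with (4 * e + (3 * v + 2 * e ^ 2) / e).
  - apply Rplus_le_compat_l. apply Rmult_le_compat_r. left; auto. lra.
  - unfold v. right; field; lra. }
set (I := RInt (fun x => cos (l * (a * m x) + th)) 0 1) in *.
assert (B2 : Rabs (I - exp (- (l ^ 2 / 2)) * cos th) <= kap l * (66 * e)).
{ assert (X : exp (- (l ^ 2 / 2)) * exp (l ^ 2 / 2) = 1).
  { rewrite <- exp_plus. replace (- (l ^ 2 / 2) + l ^ 2 / 2) with 0 by ring. apply exp_0. }
  replace (I - exp (- (l ^ 2 / 2)) * cos th) with (exp (- (l ^ 2 / 2)) * (exp (l ^ 2 / 2) * I - cos th))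
    by (rewrite Rmult_minus_distr_l, <- Rmult_assoc, X; ring).
  rewrite Rabs_mult, Rabs_pos_eq by (left; apply exp_pos).
  assert (exp (- (l ^ 2 / 2)) <= 1).
  { pose proof (exp_ineq1_le (l ^ 2 / 2)). pose proof (pow2_ge_0 l). pose proof (exp_pos (- (l ^ 2 / 2))). nra. }
  pose proof (exp_pos (- (l ^ 2 / 2))). pose proof (Rabs_pos (exp (l ^ 2 / 2) * I - cos th)). nra. }
assert (pc : forall F, pw 0 1 F -> pw 0 1 (fun x => cos (l * (a * F x) + th))).
{ intros F HF. apply (pw_comp 0 1 (fun y => cos (l * (a * y) + th))); auto. apply (cont_comp cos); auto with cdb. }
assert (B3 : Rabs (RInt (fun x => cos (l * (a * SS n x) + th)) 0 1 - I) <= Rabs l * (2 * e)).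
{ unfold I. rewrite <- RInt_sub by auto with cdb.
  eapply Rle_trans; [apply abs_RInt_le; [lra|]; apply ex_sub; auto with cdb|].
  apply Rle_trans with (RInt (fun x => Rabs l * (e + / e * a ^ 2 * Hn' x ^ 2)) 0 1).
  - apply RInt_le; try lra.
    + apply pw_ex. apply (pw_comp 0 1 Rabs). apply cont_abs. auto with cdb.
    + apply pw_ex; auto using pw_cst with cdb.
    + intros x _. rewrite Sm.
      assert (CL : forall A B, Rabs (cos A - cos B) <= Rabs (A - B)).
      { intros A B. rewrite form2. rewrite !Rabs_mult, Rabs_left by lra.
        pose proof (abs_sin_le ((A - B) / 2)) as S1.
        assert (S2 : Rabs (sin ((A + B) / 2)) <= 1) by (apply Rabs_le, SIN_bound).
        replace (Rabs (A - B)) with (2 * Rabs ((A - B) / 2)).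
        2:{ unfold Rdiv. rewrite Rabs_mult, (Rabs_pos_eq (/ 2)); lra. }
        pose proof (Rabs_pos (sin ((A - B) / 2))). nra. }
      eapply Rle_trans; [apply CL|].
      replace (l * (a * (m x + Hn' x)) + th - (l * (a * m x) + th)) with (l * (a * Hn' x)) by ring.
      rewrite Rabs_mult. apply Rmult_le_compat_l. apply Rabs_pos.
      set (u := a * Hn' x). replace (/ e * a ^ 2 * Hn' x ^ 2) with (/ e * u ^ 2) by (unfold u; ring).
      rewrite <- (pow2_abs u). set (b := Rabs u). pose proof (pow2_ge_0 (e - b)). pose proof (pow2_ge_0 b).
      apply Rmult_le_reg_l with e; [lra|].
      replace (e * (e + / e * b ^ 2)) with (e ^ 2 + b ^ 2) by (field; lra).
      pose proof (pow2_ge_0 e). nra.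
  - rewrite RInt_mull, RInt_add, RInt_cst, RInt_mull by (apply pw_ex; auto using pw_cst with cdb).
    apply Rmult_le_compat_l. apply Rabs_pos. rewrite Ha2.
    assert (C0 * / s <= e ^ 2) by nra.
    assert (/ e * / s * RInt (fun x => Hn' x ^ 2) 0 1 <= / e * / s * C0).
    { apply Rmult_le_compat_l; auto. nra. }
    assert (F5 : / e * (C0 * / s) <= / e * e ^ 2) by (apply Rmult_le_compat_l; lra).
    replace (/ e * e ^ 2) with e in F5 by (field; lra). lra. }
replace (fun x => cos (l * (SS n x / sqrt s) + th)) with (fun x => cos (l * (a * SS n x) + th)).
2:{ apply functional_extensionality; intros x. f_equal. unfold a, Rdiv. ring. }
replace (RInt (fun x => cos (l * (a * SS n x) + th)) 0 1 - exp (- (l ^ 2 / 2)) * cos th)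
  with ((RInt (fun x => cos (l * (a * SS n x) + th)) 0 1 - I) + (I - exp (- (l ^ 2 / 2)) * cos th)) by ring.
eapply Rle_trans; [apply Rabs_triang|]. lra.
Qed.

Lemma Rpower_vanish u eps : 0 < u -> 0 < eps -> exists N, forall n, (N <= n)%nat ->
  0 < INR n /\ Rpower (INR n) (- u) <= eps.
Proof.
intros Hu He. set (x := Rpower eps (- / u)). assert (0 < x) by apply Rpower_pos.
destruct (nfloor_ex x ltac:(lra)) as (N & _ & HN). exists (S N). intros n Hn.
apply le_INR in Hn. rewrite S_INR in Hn. split. lra.
apply Rle_trans with (Rpower x (- u)). apply Rpower_neg_anti; lra.
unfold x. rewrite Rpower_mult. replace (- / u * - u) with 1 by (field; lra). rewrite Rpower_1; lra.
Qed.

(** [sigma_n^2 >= c n^b] bounds [n / sigma_n^4] by [n^(1 - 2 b) / c^2], which vanishes for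
    [b > 1/2]. *)
Lemma trig_clt c b : 0 < c -> 1 / 2 < b ->
  (exists N, forall n, (N <= n)%nat -> sg n >= c * Rpower (INR n) b) ->
  forall l th, Un_cv (fun n => RInt (fun x => cos (l * (SS n x / sqrt (sg n)) + th)) 0 1)
    (exp (- (l ^ 2 / 2)) * cos th).
Proof.
intros Hc Hb (N & HN) l th eps Heps.
destruct trig_estimate as (C & HC & TE).
pose proof (kap_nonneg l) as KN.
set (K := 2 * Rabs l + 66 * kap l + 1). pose proof (Rabs_pos l).
assert (HK : 1 <= K) by (unfold K; lra).
set (e := Rmin 1 (eps / (2 * K))).
assert (He : 0 < e <= 1).
{ split. apply Rmin_glb_lt. lra. apply Rdiv_lt_0_compat; lra. apply Rmin_l. }
assert (HeK : K * e < eps).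
{ apply Rle_lt_trans with (K * (eps / (2 * K))). apply Rmult_le_compat_l. lra. apply Rmin_r.
  replace (K * (eps / (2 * K))) with (eps / 2) by (field; lra). lra. }
assert (He2 : 0 < e ^ 2) by (apply pow_lt; lra).
destruct (Rpower_vanish (2 * b - 1) (e ^ 2 * c ^ 2 / C) ltac:(lra)) as (N1 & K1).
{ apply Rdiv_lt_0_compat; auto. apply Rmult_lt_0_compat; auto. apply pow_lt; auto. }
destruct (Rpower_vanish b (e ^ 2 * c / C) ltac:(lra)) as (N2 & K2).
{ apply Rdiv_lt_0_compat; auto. apply Rmult_lt_0_compat; auto. }
exists (N + N1 + N2)%nat. intros n Hn. unfold Rdist.
specialize (HN n ltac:(lia)). destruct (K1 n ltac:(lia)) as [Pn W1]. destruct (K2 n ltac:(lia)) as [_ W2].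
set (x := INR n) in *. set (s := sg n) in *.
assert (Wp : 0 < Rpower x b) by apply Rpower_pos.
assert (Wc : 0 < c * Rpower x b) by (apply Rmult_lt_0_compat; auto).
assert (I1 : / s <= / (c * Rpower x b)) by (apply Rinv_le_contravar; lra).
assert (I0 : 0 < / s) by (apply Rinv_0_lt_compat; lra).
assert (E1 : / (c * Rpower x b) = / c * Rpower x (- b)) by (rewrite Rpower_Ropp; field; lra).
rewrite E1 in I1.
apply Rle_lt_trans with (2 := HeK). eapply Rle_trans; [apply (TE n l th e He)|].
- fold s; lra.
- fold s x. rewrite <- pow_inv.
  assert (/ s ^ 1 * / s <= (/ c * Rpower x (- b)) * (/ c * Rpower x (- b))).
  { rewrite pow_1. apply Rmult_le_compat; lra. }
  assert (E2 : x * Rpower x (- b) ^ 2 = Rpower x (- (2 * b - 1))).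
  { replace (- (2 * b - 1)) with (1 + - b + - b) by ring. rewrite !Rpower_plus, Rpower_1 by auto. ring. }
  apply Rle_trans with (C * / c ^ 2 * (x * Rpower x (- b) ^ 2)).
  + replace (C * / c ^ 2 * (x * Rpower x (- b) ^ 2)) with (C * x * ((/ c * Rpower x (- b)) * (/ c * Rpower x (- b)))) by (field; lra).
    apply Rmult_le_compat_l. apply Rmult_le_pos; lra. replace ((/ s) ^ 2) with (/ s ^ 1 * / s) by (rewrite pow_1; ring). auto.
  + rewrite E2. apply Rle_trans with (C * / c ^ 2 * (e ^ 2 * c ^ 2 / C)).
    apply Rmult_le_compat_l; auto. apply Rmult_le_pos. lra. left; apply Rinv_0_lt_compat, pow_lt; auto.
    right; field; lra.
- fold s. apply Rle_trans with (C * (/ c * (e ^ 2 * c / C))).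
  apply Rmult_le_compat_l. lra. eapply Rle_trans; [exact I1|]. apply Rmult_le_compat_l; auto.
  left; apply Rinv_0_lt_compat; auto. right; field; lra.
- apply Rmult_le_compat_r. lra. unfold K; lra.
Qed.

End Chain.

(** * Gaussian integrals and trigonometric test functions *)

Lemma taylor2 g g' g'' x d M :
  (forall y, derivable_pt_lim g y (g' y)) -> (forall y, derivable_pt_lim g' y (g'' y)) ->
  (forall y, Rabs (y - x) <= Rabs d -> Rabs (g'' y) <= M) ->
  Rabs (g (x + d) - g x - d * g' x) <= M * d ^ 2.
Proof.
intros D1 D2 HM.
assert (TR : forall u u' c, (forall y, derivable_pt_lim u y (u' y)) ->
  derivable_pt_lim (fun d => u (x + d)) c (u' (x + c))).
{ intros u u' c Hu. rewrite <- (Rmult_1_r (u' (x + c))).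
  apply (derivable_pt_lim_comp (fun d => x + d) u). 2: apply Hu.
  replace 1 with (0 + 1) by ring. apply (derivable_pt_lim_plus (fun _ => x) (fun d => d)).
  apply derivable_pt_lim_const. apply derivable_pt_lim_id. }
replace (M * d ^ 2) with (M * Rabs d * Rabs d) by (rewrite <- (pow2_abs d); ring).
apply (mvt_abs (fun d => g (x + d) - g x - d * g' x) (fun d => g' (x + d) - g' x)).
- intros c. apply (derivable_pt_lim_minus (fun d => g (x + d) - g x) (fun d => d * g' x)).
  + rewrite <- (Rminus_0_r (g' (x + c))). apply (derivable_pt_lim_minus (fun d => g (x + d)) (fun _ => g x)).
    apply TR; auto. apply derivable_pt_lim_const.
  + apply is_derive_Reals. auto_derive; auto. ring.
- rewrite Rplus_0_r. ring.
- intros c Hc. apply Rle_trans with (M * Rabs c).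
  + apply (mvt_abs (fun d => g' (x + d) - g' x) (fun d => g'' (x + d))).
    * intros e. rewrite <- (Rminus_0_r (g'' (x + e))). apply (derivable_pt_lim_minus (fun d => g' (x + d)) (fun _ => g' x)).
      apply TR; auto. apply derivable_pt_lim_const.
    * rewrite Rplus_0_r. ring.
    * intros e Hce. apply HM. replace (x + e - x) with e by ring. lra.
  + apply Rmult_le_compat_l; auto. eapply Rle_trans; [apply Rabs_pos|apply (HM x)].
    rewrite Rminus_diag, Rabs_R0. apply Rabs_pos.
Qed.

(** The remainder is quadratic in [d] uniformly in [t], and remains so after integration. *)
Lemma RInt_param_derive (F dF : R -> R -> R) a b x M : a <= b ->
  (forall y, cont (F y)) -> cont (dF x) ->
  (forall d t, Rabs d <= 1 -> a <= t <= b -> Rabs (F (x + d) t - F x t - d * dF x t) <= M * d ^ 2) ->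
  derivable_pt_lim (fun y => RInt (F y) a b) x (RInt (dF x) a b).
Proof.
intros Hab HF HdF HM e He.
set (K := (b - a) * Rabs M + 1). pose proof (Rabs_pos M).
assert (HK : 0 < K) by (unfold K; nra).
set (d0 := Rmin 1 (e / K)).
assert (Hd0 : 0 < d0) by (apply Rmin_glb_lt; [lra|apply Rdiv_lt_0_compat; auto]).
exists (mkposreal d0 Hd0). intros d Hd Hd'. simpl in Hd'.
assert (D1 : Rabs d <= 1) by (apply Rlt_le, Rlt_le_trans with (1 := Hd'), Rmin_l).
assert (D2 : Rabs d < e / K) by (apply Rlt_le_trans with (1 := Hd'), Rmin_r).
assert (0 < Rabs d) by (apply Rabs_pos_lt; auto).
assert (Q : Rabs (RInt (F (x + d)) a b - RInt (F x) a b - d * RInt (dF x) a b) <= (b - a) * (Rabs M * d ^ 2)).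
{ rewrite <- RInt_mull, <- !RInt_sub by auto with cdb.
  apply abs_RInt_le_const; auto with cdb. intros t Ht. apply Rle_trans with (1 := HM d t D1 Ht).
  apply Rmult_le_compat_r. apply pow2_ge_0. apply Rle_abs. }
replace ((RInt (F (x + d)) a b - RInt (F x) a b) / d - RInt (dF x) a b)
  with (/ d * (RInt (F (x + d)) a b - RInt (F x) a b - d * RInt (dF x) a b)) by (field; auto).
rewrite Rabs_mult, Rabs_inv.
apply Rmult_lt_reg_l with (Rabs d); auto. rewrite <- Rmult_assoc, Rinv_r, Rmult_1_l by lra.
apply Rle_lt_trans with (1 := Q). rewrite <- (pow2_abs d).
assert (Rabs d * K < e) by (apply Rlt_div_r in D2; auto).
replace ((b - a) * (Rabs M * Rabs d ^ 2)) with (Rabs d * (Rabs d * ((b - a) * Rabs M))) by ring.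
apply Rmult_lt_compat_l; auto. apply Rle_lt_trans with (2 := H1).
apply Rmult_le_compat_l. lra. unfold K; lra.
Qed.

Definition gd (s : R) : R := exp (- s ^ 2 / 2).

Lemma gd_derive s : derivable_pt_lim gd s (- s * gd s).
Proof. apply is_derive_Reals. unfold gd. auto_derive; auto. simpl; unfold Rdiv; field. Qed.

Lemma gd_cont : cont gd.
Proof. unfold gd. apply (cont_comp exp); auto with cdb. apply cont_div; auto with cdb; intros; lra. Qed.
#[local] Hint Resolve gd_cont : cdb.

Lemma gd_pos s : 0 < gd s.
Proof. apply exp_pos. Qed.

Lemma gd_le1 s : gd s <= 1.
Proof.
unfold gd. pose proof (pow2_ge_0 s). destruct (Req_dec (- s ^ 2 / 2) 0) as [->|].
rewrite exp_0; lra. left. rewrite <- exp_0. apply exp_increasing. lra.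
Qed.

Lemma cont_sin : cont sin.
Proof. intros x; apply continuous_sin. Qed.
#[local] Hint Resolve cont_sin : cdb.

(* The function of [l] on the left, times exp(l^2/2), has derivative of size exp(l^2/2 - A^2/2). *)
Lemma gauss_fourier A l th : 0 <= A ->
  Rabs (RInt (fun s => cos (l * s + th) * gd s) (- A) A - exp (- (l ^ 2 / 2)) * (cos th * RInt gd (- A) A))
  <= 2 * Rabs l * gd A.
Proof.
intros HA.
set (F := fun l => RInt (fun s => cos (l * s + th) * gd s) (- A) A).
assert (cc : forall l, cont (fun s => cos (l * s + th) * gd s)).
{ intros. apply cont_mult; auto with cdb. apply (cont_comp cos); auto with cdb. }
assert (cs : forall l, cont (fun s => sin (l * s + th) * gd s)).
{ intros. apply cont_mult; auto with cdb. apply (cont_comp sin); auto with cdb. }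
assert (DF : forall l, derivable_pt_lim F l (RInt (fun s => - s * sin (l * s + th) * gd s) (- A) A)).
{ intros y.
  apply (RInt_param_derive (fun l s => cos (l * s + th) * gd s) (fun l s => - s * sin (l * s + th) * gd s) _ _ y (A ^ 2)).
  - lra.
  - intros; auto.
  - apply cont_mult; auto with cdb. apply cont_mult; auto with cdb. apply (cont_comp sin); auto with cdb.
  - intros d s Hd Hs.
    replace (cos ((y + d) * s + th) * gd s - cos (y * s + th) * gd s - d * (- s * sin (y * s + th) * gd s))
      with ((cos ((y + d) * s + th) - cos (y * s + th) - d * (- s * sin (y * s + th))) * gd s) by ring.
    rewrite Rabs_mult, (Rabs_pos_eq (gd s)) by (left; apply gd_pos).
    pose proof (gd_le1 s). pose proof (gd_pos s).
    assert (T : Rabs (cos ((y + d) * s + th) - cos (y * s + th) - d * (- s * sin (y * s + th))) <= A ^ 2 * d ^ 2).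
    { apply (taylor2 (fun y => cos (y * s + th)) (fun y => - s * sin (y * s + th)) (fun y => - s * (s * cos (y * s + th)))).
      - intros z. apply is_derive_Reals. auto_derive; auto. ring.
      - intros z. apply is_derive_Reals. auto_derive; auto. ring.
      - intros z _. replace (- s * (s * cos (z * s + th))) with (- (s ^ 2 * cos (z * s + th))) by ring.
        rewrite Rabs_Ropp, Rabs_mult, (Rabs_pos_eq (s ^ 2)) by apply pow2_ge_0.
        assert (Rabs (cos (z * s + th)) <= 1) by (apply Rabs_le, COS_bound).
        assert (s ^ 2 <= A ^ 2) by nra. pose proof (pow2_ge_0 s). pose proof (Rabs_pos (cos (z * s + th))). nra. }
    pose proof (Rabs_pos (cos ((y + d) * s + th) - cos (y * s + th) - d * (- s * sin (y * s + th)))). nra. }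
(* Integration by parts turns the derivative of [F] into [bt - l F], with [bt] the boundary terms;
   the factor [exp (l^2/2)] then removes the second part. *)
set (bt := fun l => sin (l * A + th) * gd A - sin (l * - A + th) * gd (- A)).
assert (IP : forall l, RInt (fun s => - s * sin (l * s + th) * gd s) (- A) A = bt l - l * F l).
{ intros y.
  assert (FT : RInt (fun s => y * (cos (y * s + th) * gd s) + - s * sin (y * s + th) * gd s) (- A) A = bt y).
  { apply is_RInt_unique.
    apply (is_RInt_derive (V := R_CompleteNormedModule) (fun s => sin (y * s + th) * gd s)).
    - intros s _. apply is_derive_Reals.
      replace (y * (cos (y * s + th) * gd s) + - s * sin (y * s + th) * gd s)
        with ((y * cos (y * s + th)) * gd s + sin (y * s + th) * (- s * gd s)) by ring.
      apply (derivable_pt_lim_mult (fun s => sin (y * s + th)) gd). 2: apply gd_derive.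
      apply is_derive_Reals. auto_derive; auto. ring.
    - intros s _. apply cont_plus. auto with cdb.
      apply cont_mult; auto with cdb. apply cont_mult; auto with cdb. apply (cont_comp sin); auto with cdb. }
  rewrite RInt_add, RInt_mull in FT; auto with cdb. fold (F y) in FT. lra.
  apply cont_ex. apply cont_mult; auto with cdb. apply cont_mult; auto with cdb. apply (cont_comp sin); auto with cdb. }
assert (GA : gd (- A) = gd A) by (unfold gd; f_equal; field).
assert (BT : forall l, Rabs (bt l) <= 2 * gd A).
{ intros y. unfold bt. rewrite GA. pose proof (gd_pos A). pose proof (SIN_bound (y * A + th)). pose proof (SIN_bound (y * - A + th)).
  apply Rabs_le. nra. }
set (W := fun l => F l * exp (l ^ 2 / 2)).
assert (DW : forall l, derivable_pt_lim W l (bt l * exp (l ^ 2 / 2))).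
{ intros y. replace (bt y * exp (y ^ 2 / 2)) with ((bt y - y * F y) * exp (y ^ 2 / 2) + F y * (y * exp (y ^ 2 / 2))) by ring.
  apply (derivable_pt_lim_mult F (fun l => exp (l ^ 2 / 2))). rewrite <- IP. apply DF.
  apply is_derive_Reals. auto_derive; auto. simpl; unfold Rdiv; field. }
assert (B : Rabs (W l - W 0) <= 2 * gd A * exp (l ^ 2 / 2) * Rabs l).
{ apply (mvt_abs (fun l => W l - W 0) (fun l => bt l * exp (l ^ 2 / 2))).
  - intros c. rewrite <- (Rminus_0_r (bt c * exp (c ^ 2 / 2))). apply (derivable_pt_lim_minus W (fun _ => W 0)); auto.
    apply derivable_pt_lim_const.
  - ring.
  - intros c Hc. rewrite Rabs_mult, (Rabs_pos_eq (exp _)) by (left; apply exp_pos).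
    apply Rmult_le_compat; auto. apply Rabs_pos. left; apply exp_pos.
    assert (c ^ 2 <= l ^ 2). { rewrite <- (pow2_abs c), <- (pow2_abs l). apply pow_incr. split; auto. apply Rabs_pos. }
    destruct (Req_dec (c ^ 2) (l ^ 2)) as [->|]; [lra|]. left; apply exp_increasing. lra. }
assert (W0 : W 0 = cos th * RInt gd (- A) A).
{ unfold W, F. replace (0 ^ 2 / 2) with 0 by field. rewrite exp_0, Rmult_1_r, <- RInt_mull by auto with cdb.
  apply RInt_eq. lra. intros. f_equal. f_equal. ring. }
rewrite <- W0.
set (ex := exp (- (l ^ 2 / 2))). assert (Hex : 0 < ex) by apply exp_pos.
assert (EX : ex * exp (l ^ 2 / 2) = 1).
{ unfold ex. rewrite <- exp_plus. replace (- (l ^ 2 / 2) + l ^ 2 / 2) with 0 by ring. apply exp_0. }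
fold (F l).
replace (F l - ex * W 0) with (ex * (W l - W 0)).
2:{ unfold W at 1. rewrite Rmult_minus_distr_l. replace (ex * (F l * exp (l ^ 2 / 2))) with (F l * (ex * exp (l ^ 2 / 2))) by ring. rewrite EX. ring. }
rewrite Rabs_mult, (Rabs_pos_eq ex) by lra.
apply Rle_trans with (ex * (2 * gd A * exp (l ^ 2 / 2) * Rabs l)). apply Rmult_le_compat_l; lra.
right. replace (ex * (2 * gd A * exp (l ^ 2 / 2) * Rabs l)) with (2 * Rabs l * gd A * (ex * exp (l ^ 2 / 2))) by ring.
rewrite EX. ring.
Qed.

Lemma gd_small e : 0 < e -> exists A0, 0 < A0 /\ forall A, A0 <= A -> gd A <= e.
Proof.
intros He. exists (2 / e + 2). assert (0 < 2 / e) by (apply Rdiv_lt_0_compat; lra). split. lra.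
intros A HA. unfold gd. replace (- A ^ 2 / 2) with (- (A ^ 2 / 2)) by field. rewrite exp_Ropp.
pose proof (exp_ineq1_le (A ^ 2 / 2)).
assert (2 / e <= A ^ 2) by nra.
assert (/ e <= exp (A ^ 2 / 2)). { apply Rle_trans with (1 + A ^ 2 / 2); [|lra]. unfold Rdiv in *. lra. }
rewrite <- (Rinv_inv e). apply Rinv_le_contravar; auto. apply Rinv_0_lt_compat; auto.
Qed.

(* With J x = int_0^x gd and K x = int_0^1 exp(-x^2(1+t^2)/2)/(1+t^2) dt, J^2 + 2 K is constant. *)
Lemma gauss_half e : 0 < e -> exists A0, 0 < A0 /\ forall A, A0 <= A ->
  Rabs (RInt gd 0 A - sqrt (PI / 2)) <= e.
Proof.
intros He.
set (J := fun x => RInt gd 0 x).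
set (k := fun x t => exp (- (x ^ 2 * ((1 + t ^ 2) / 2))) / (1 + t ^ 2)).
set (dk := fun x t => - x * exp (- (x ^ 2 * ((1 + t ^ 2) / 2)))).
assert (t2 : forall t, 1 <= 1 + t ^ 2) by (intros t; pose proof (pow2_ge_0 t); lra).
assert (ce : forall x, cont (fun t => exp (- (x ^ 2 * ((1 + t ^ 2) / 2))))).
{ intros x. apply (cont_comp exp); auto with cdb. apply cont_opp. apply cont_mult; auto with cdb.
  apply cont_div; auto with cdb; intros; lra. }
assert (ck : forall x, cont (k x)).
{ intros x. unfold k. apply cont_div; auto with cdb. intros t; pose proof (t2 t); lra. }
assert (cdk : forall x, cont (dk x)) by (intros; unfold dk; auto with cdb).
assert (DK : forall x, derivable_pt_lim (fun x => RInt (k x) 0 1) x (RInt (dk x) 0 1)).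
{ intros x. set (M := 4 * (Rabs x + 1) ^ 2 + 4).
  apply (RInt_param_derive k dk 0 1 x M); auto. lra.
  intros d t Hd Ht.
  apply (taylor2 (fun x => k x t) (fun x => dk x t) (fun x => (- 1 + x ^ 2 * (1 + t ^ 2)) * exp (- (x ^ 2 * ((1 + t ^ 2) / 2))))).
  - intros y. apply is_derive_Reals. unfold k, dk. auto_derive. pose proof (t2 t); simpl in *; lra.
    simpl; unfold Rdiv; field. pose proof (t2 t); simpl in *; lra.
  - intros y. apply is_derive_Reals. unfold dk. auto_derive; auto. simpl; unfold Rdiv; field.
  - intros y Hy. rewrite Rabs_mult, (Rabs_pos_eq (exp _)) by (left; apply exp_pos).
    assert (T : 0 <= y ^ 2 * ((1 + t ^ 2) / 2)) by (pose proof (pow2_ge_0 y); pose proof (t2 t); nra).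
    assert (E1 : exp (- (y ^ 2 * ((1 + t ^ 2) / 2))) <= 1).
    { destruct (Req_dec (y ^ 2 * ((1 + t ^ 2) / 2)) 0) as [->|]. rewrite Ropp_0, exp_0; lra.
      apply Rle_trans with (exp 0); [left; apply exp_increasing|rewrite exp_0]; lra. }
    assert (Ya : Rabs y <= Rabs x + 1).
    { replace y with ((y - x) + x) by ring. eapply Rle_trans; [apply Rabs_triang|]. lra. }
    assert (Y2 : y ^ 2 <= (Rabs x + 1) ^ 2). { rewrite <- (pow2_abs y). apply pow_incr. split; auto. apply Rabs_pos. }
    assert (Rabs (- 1 + y ^ 2 * (1 + t ^ 2)) <= M).
    { pose proof (pow2_ge_0 y). assert (t ^ 2 <= 1) by nra. pose proof (pow2_ge_0 t). assert (0 <= y ^ 2 * (1 + t ^ 2) <= 2 * y ^ 2) by nra. apply Rabs_le. unfold M. lra. }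
    pose proof (exp_pos (- (y ^ 2 * ((1 + t ^ 2) / 2)))). pose proof (Rabs_pos (- 1 + y ^ 2 * (1 + t ^ 2))). nra. }
assert (DJ : forall x, derivable_pt_lim J x (gd x)).
{ intros x. apply is_derive_Reals. apply (is_derive_RInt (V := R_CompleteNormedModule) gd (RInt gd 0) 0 x).
  - exists (mkposreal 1 Rlt_0_1). intros y _. apply (RInt_correct (V := R_CompleteNormedModule)). auto with cdb.
  - apply gd_cont. }
assert (SUB : forall x, RInt (dk x) 0 1 = - (gd x * J x)).
{ intros x.
  assert (Q : x * RInt (fun t => gd (x * t)) 0 1 = J x).
  { pose proof (RInt_comp_lin (V := R_CompleteNormedModule) gd x 0 0 1) as C.
    rewrite !Rmult_0_r, !Rplus_0_r, Rmult_1_r in C.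
    unfold J. rewrite <- C by auto with cdb.
    rewrite <- RInt_mull by (apply cont_ex; apply (cont_comp gd); auto with cdb).
    apply RInt_eq. lra. intros. rewrite Rplus_0_r. reflexivity. }
  rewrite <- Q. replace (- (gd x * (x * RInt (fun t => gd (x * t)) 0 1))) with ((- x * gd x) * RInt (fun t => gd (x * t)) 0 1) by ring.
  rewrite <- RInt_mull by (apply cont_ex; apply (cont_comp gd); auto with cdb).
  apply RInt_eq. lra. intros t _. unfold dk, gd. rewrite Rmult_assoc, <- exp_plus. f_equal. f_equal. field. }
set (Z := fun x => J x ^ 2 + 2 * RInt (k x) 0 1).
assert (DZ : forall x, derivable_pt_lim Z x 0).
{ intros x. replace 0 with ((gd x * J x + J x * gd x) + 2 * RInt (dk x) 0 1) by (rewrite SUB; ring).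
  apply (derivable_pt_lim_plus (fun x => J x ^ 2) (fun x => 2 * RInt (k x) 0 1)).
  - apply (derivable_pt_lim_ext (fun x => J x * J x)). intros; ring. apply (derivable_pt_lim_mult J J); auto.
  - apply (derivable_pt_lim_scal (fun x => RInt (k x) 0 1)); auto. }
assert (ZC : forall x, Z x = Z 0).
{ intros x. assert (Rabs (Z x - Z 0) <= 0 * Rabs x).
  { apply (mvt_abs (fun x => Z x - Z 0) (fun _ => 0)).
    - intros c. pose proof (derivable_pt_lim_minus Z (fun _ => Z 0) c 0 0 (DZ c) (derivable_pt_lim_const _ _)) as Q.
      rewrite Rminus_0_r in Q. exact Q.
    - ring.
    - intros; rewrite Rabs_R0; lra. }
  rewrite Rmult_0_l in H. pose proof (Rabs_pos (Z x - Z 0)). assert (Rabs (Z x - Z 0) = 0) by lra.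
  apply Rabs_eq_0 in H1. lra. }
assert (Z0 : Z 0 = PI / 2).
{ unfold Z, J. rewrite RInt_pt.
  assert (RInt (k 0) 0 1 = PI / 4).
  { rewrite <- atan_1. replace (atan 1) with (atan 1 - atan 0) by (rewrite atan_0; ring).
    apply is_RInt_unique. apply (is_RInt_derive (V := R_CompleteNormedModule) atan).
    - intros t _. apply is_derive_Reals. unfold k. replace (0 ^ 2 * ((1 + t ^ 2) / 2)) with 0 by ring.
      rewrite Ropp_0, exp_0. replace (1 / (1 + t ^ 2)) with (/ (1 + t ^ 2)) by (unfold Rdiv; ring).
      apply derivable_pt_lim_atan.
    - intros t _. apply ck. }
  rewrite H. field. }
pose proof PI_RGT_0 as HP.
assert (HS : 0 < sqrt (PI / 2)) by (apply sqrt_lt_R0; lra).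
set (S := sqrt (PI / 2)) in *.
destruct (gd_small (e * S / 2)) as (A0 & HA0 & GS). { apply Rdiv_lt_0_compat; nra. }
exists A0. split; auto. intros A HA. fold (J A).
assert (JP : 0 <= J A). { apply RInt_nonneg; auto with cdb. lra. intros; left; apply gd_pos. }
assert (KB : 0 <= RInt (k A) 0 1 <= gd A).
{ assert (B : forall t, 0 < t < 1 -> 0 <= k A t <= gd A).
  { intros t Ht. unfold k, gd. pose proof (t2 t). pose proof (exp_pos (- (A ^ 2 * ((1 + t ^ 2) / 2)))).
    assert (exp (- (A ^ 2 * ((1 + t ^ 2) / 2))) <= exp (- A ^ 2 / 2)).
    { assert (- (A ^ 2 * ((1 + t ^ 2) / 2)) <= - A ^ 2 / 2).
      { pose proof (pow2_ge_0 A). pose proof (pow2_ge_0 t). nra. }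
      destruct H1 as [H1|H1]. left; apply exp_increasing; auto. rewrite H1; lra. }
    split. apply Rdiv_le_0_compat; lra. apply Rle_div_l; [lra|]. pose proof (exp_pos (- A ^ 2 / 2)). nra. }
  split. apply RInt_nonneg; auto with cdb; try lra. intros; apply B; auto.
  replace (gd A) with ((1 - 0) * gd A) by ring. apply RInt_upper; auto with cdb; try lra. intros; apply B; auto. }
assert (E : J A ^ 2 + 2 * RInt (k A) 0 1 = S ^ 2).
{ change (Z A = S ^ 2). rewrite ZC, Z0. unfold S. rewrite pow2_sqrt; lra. }
specialize (GS A HA).
assert (JS : J A <= S). { apply Rsqr_incr_0_var; [unfold Rsqr; nra|lra]. }
rewrite Rabs_left1 by lra.
assert ((S - J A) * S <= e * S).
{ assert ((S - J A) * (S + J A) <= e * S) by nra. nra. }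
apply Rmult_le_reg_r with S; auto. lra.
Qed.

Lemma gd_even A : RInt gd (- A) 0 = RInt gd 0 A.
Proof.
pose proof (RInt_comp_lin (V := R_CompleteNormedModule) gd (-1) 0 (- A) 0) as C.
replace (-1 * - A + 0) with A in C by ring. replace (-1 * 0 + 0) with 0 in C by ring.
specialize (C (cont_ex _ _ _ gd_cont)).
assert (E : -1 * RInt gd (- A) 0 = RInt gd A 0).
{ rewrite <- C. rewrite <- RInt_mull by auto with cdb.
  apply RInt_ext. intros. unfold scal; simpl; unfold mult; simpl. f_equal. unfold gd. f_equal. field. }
pose proof (RInt_cat gd A 0 A (cont_ex _ _ _ gd_cont) (cont_ex _ _ _ gd_cont)) as Q.
rewrite RInt_pt in Q. lra.
Qed.

Lemma sqrt_2PI : sqrt (2 * PI) = 2 * sqrt (PI / 2).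
Proof.
pose proof PI_RGT_0. replace (2 * PI) with (2 ^ 2 * (PI / 2)) by field.
rewrite sqrt_mult_alt by lra. rewrite sqrt_pow2; lra.
Qed.

Lemma gauss_full e : 0 < e -> exists A0, 0 < A0 /\ forall A, A0 <= A ->
  Rabs (RInt gd (- A) A - sqrt (2 * PI)) <= e.
Proof.
intros He. destruct (gauss_half (e / 2)) as (A0 & HA0 & K). lra.
exists A0. split; auto. intros A HA. specialize (K A HA).
rewrite <- (RInt_cat gd (- A) 0 A), gd_even, sqrt_2PI by auto with cdb.
replace (RInt gd 0 A + RInt gd 0 A - 2 * sqrt (PI / 2)) with (2 * (RInt gd 0 A - sqrt (PI / 2))) by ring.
rewrite Rabs_mult, (Rabs_pos_eq 2); lra.
Qed.

(** By symmetry the half-line below 0 carries half of the mass in the limit, so the distribution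
    function can be written with a proper integral from 0. *)
Lemma std_normal_cdf t : std_normal_cdf_is t (1/2 + / sqrt (2 * PI) * RInt gd 0 t).
Proof.
intros e He. pose proof PI_RGT_0.
assert (HS : 0 < sqrt (PI / 2)) by (apply sqrt_lt_R0; lra).
pose proof sqrt_2PI as SQ.
destruct (gauss_half (e * sqrt (PI / 2))) as (A0 & HA0 & K). nra.
exists (- A0). intros a Ha. rewrite RI_RInt by (apply cont_ex, gd_cont). fold gd.
change (fun s => exp (- s ^ 2 / 2)) with gd.
specialize (K (- a) ltac:(lra)).
rewrite <- (RInt_cat gd a 0 t) by auto with cdb.
rewrite <- (Ropp_involutive a) at 1. rewrite gd_even.
assert (Hi : 0 < / sqrt (2 * PI)) by (apply Rinv_0_lt_compat; lra).
replace (/ sqrt (2 * PI) * (RInt gd 0 (- a) + RInt gd 0 t) - (1 / 2 + / sqrt (2 * PI) * RInt gd 0 t))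
  with (/ sqrt (2 * PI) * (RInt gd 0 (- a) - sqrt (PI / 2))) by (rewrite SQ; field; lra).
rewrite Rabs_mult, Rabs_pos_eq by lra.
apply Rle_lt_trans with (/ sqrt (2 * PI) * (e * sqrt (PI / 2))). apply Rmult_le_compat_l; lra.
replace (/ sqrt (2 * PI) * (e * sqrt (PI / 2))) with (e / 2) by (rewrite SQ; field; lra). lra.
Qed.

(* [TP p v]: [p] is a trigonometric polynomial and [v] its standard Gaussian expectation. *)
Inductive TP : (R -> R) -> R -> Prop :=
| TP_cos l th : TP (fun x => cos (l * x + th)) (exp (- (l ^ 2 / 2)) * cos th)
| TP_plus p v q w : TP p v -> TP q w -> TP (fun x => p x + q x) (v + w)
| TP_scal k p v : TP p v -> TP (fun x => k * p x) (k * v).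

Lemma TP_one : exists v, TP (fun _ => 1) v.
Proof.
eexists. replace (fun _ : R => 1) with (fun x => cos (0 * x + 0)). apply TP_cos.
apply functional_extensionality; intros. rewrite Rmult_0_l, Rplus_0_r. apply cos_0.
Qed.

Lemma TP_eq p q v : TP p v -> (forall x, p x = q x) -> TP q v.
Proof. intros H E. now rewrite <- (functional_extensionality _ _ E). Qed.

(** Product-to-sum formula. Only the existence of a value is recorded: [TP_gauss] identifies any
    such value with the Gaussian expectation, so none has to be computed. *)
Lemma TP_mult p v q w : TP p v -> TP q w -> exists u, TP (fun x => p x * q x) u.
Proof.
intros Hp Hq. induction Hp as [l th|p1 v1 p2 v2 H1 [u1 I1] H2 [u2 I2]|k p v H [u I]].
- induction Hq as [l' th'|p1 v1 p2 v2 H1 [u1 I1] H2 [u2 I2]|k p v H [u I]].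
  + eexists. eapply TP_eq.
    apply (TP_scal (1/2) _ _ (TP_plus _ _ _ _ (TP_cos (l + l') (th + th')) (TP_cos (l - l') (th - th')))).
    intros x. simpl.
    replace ((l + l') * x + (th + th')) with ((l * x + th) + (l' * x + th')) by ring.
    replace ((l - l') * x + (th - th')) with ((l * x + th) - (l' * x + th')) by ring.
    rewrite cos_plus, cos_minus. field.
  + eexists. eapply TP_eq. apply (TP_plus _ _ _ _ I1 I2). intros; simpl; ring.
  + eexists. eapply TP_eq. apply (TP_scal k _ _ I). intros; simpl; ring.
- eexists. eapply TP_eq. apply (TP_plus _ _ _ _ I1 I2). intros; simpl; ring.
- eexists. eapply TP_eq. apply (TP_scal k _ _ I). intros; simpl; ring.
Qed.

Lemma TP_pow p v n : TP p v -> exists u, TP (fun x => p x ^ n) u.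
Proof.
intros H. induction n as [|n [u I]]; simpl. apply TP_one. eapply TP_mult; eauto.
Qed.

Lemma TP_cont p v : TP p v -> cont p.
Proof.
induction 1; auto with cdb. apply (cont_comp cos); auto with cdb.
Qed.

Lemma TP_gauss p v : TP p v -> forall e, 0 < e -> exists A0, 0 < A0 /\ forall A, A0 <= A ->
  Rabs (RInt (fun s => p s * gd s) (- A) A - sqrt (2 * PI) * v) <= e.
Proof.
induction 1 as [l th|p v q w H1 I1 H2 I2|k p v H I]; intros e He.
- destruct (gauss_full (e / 2)) as (A1 & HA1 & K1). lra.
  pose proof (Rabs_pos l).
  destruct (gd_small (e / (4 * (Rabs l + 1)))) as (A2 & HA2 & K2). apply Rdiv_lt_0_compat; lra.
  exists (A1 + A2). split. lra. intros A HA. specialize (K1 A ltac:(lra)). specialize (K2 A ltac:(lra)).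
  pose proof (gauss_fourier A l th ltac:(lra)) as GF. pose proof (gd_pos A).
  set (ex := exp (- (l ^ 2 / 2))) in *.
  assert (0 < ex <= 1).
  { split. apply exp_pos. pose proof (gd_le1 l) as Q. unfold gd in Q. unfold ex.
    replace (- (l ^ 2 / 2)) with (- l ^ 2 / 2) by field. auto. }
  replace (RInt (fun s => cos (l * s + th) * gd s) (- A) A - sqrt (2 * PI) * (ex * cos th))
    with ((RInt (fun s => cos (l * s + th) * gd s) (- A) A - ex * (cos th * RInt gd (- A) A))
       + (ex * cos th) * (RInt gd (- A) A - sqrt (2 * PI))) by ring.
  eapply Rle_trans; [apply Rabs_triang|]. rewrite (Rabs_mult (ex * cos th)).
  assert (C1 : Rabs (ex * cos th) <= 1).
  { rewrite Rabs_mult, Rabs_pos_eq by lra. assert (Rabs (cos th) <= 1) by (apply Rabs_le, COS_bound).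
    pose proof (Rabs_pos (cos th)). nra. }
  assert (2 * Rabs l * gd A <= e / 2).
  { apply Rle_trans with (2 * (Rabs l + 1) * (e / (4 * (Rabs l + 1)))). apply Rmult_le_compat; lra.
    right; field; lra. }
  pose proof (Rabs_pos (RInt gd (- A) A - sqrt (2 * PI))). pose proof (Rabs_pos (ex * cos th)). nra.
- destruct (I1 (e / 2)) as (A1 & HA1 & K1). lra. destruct (I2 (e / 2)) as (A2 & HA2 & K2). lra.
  exists (A1 + A2). split. lra. intros A HA. specialize (K1 A ltac:(lra)). specialize (K2 A ltac:(lra)).
  pose proof (TP_cont _ _ H1). pose proof (TP_cont _ _ H2).
  rewrite (RInt_eq _ (fun s => p s * gd s + q s * gd s)); try lra. 2: intros; ring.
  rewrite RInt_add by auto with cdb.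
  match goal with |- Rabs (?a + ?b - _) <= _ => replace (a + b - sqrt (2 * PI) * (v + w)) with ((a - sqrt (2 * PI) * v) + (b - sqrt (2 * PI) * w)) by ring end.
  eapply Rle_trans; [apply Rabs_triang|]. lra.
- pose proof (Rabs_pos k). destruct (I (e / (Rabs k + 1))) as (A1 & HA1 & K1). apply Rdiv_lt_0_compat; lra.
  exists A1. split; auto. intros A HA. specialize (K1 A HA). pose proof (TP_cont _ _ H).
  rewrite (RInt_eq _ (fun s => k * (p s * gd s))); try lra. 2: intros; ring.
  rewrite RInt_mull by auto with cdb.
  match goal with |- Rabs (k * ?a - _) <= _ => replace (k * a - sqrt (2 * PI) * (k * v)) with (k * (a - sqrt (2 * PI) * v)) by ring;
    pose proof (Rabs_pos (a - sqrt (2 * PI) * v)) end.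
  rewrite Rabs_mult. apply Rle_trans with ((Rabs k + 1) * (e / (Rabs k + 1))). apply Rmult_le_compat; lra.
  right; field; lra.
Qed.

Lemma TP_limit (X : nat -> R -> R) : (forall n, pw 0 1 (X n)) ->
  (forall l th, Un_cv (fun n => RInt (fun x => cos (l * X n x + th)) 0 1) (exp (- (l ^ 2 / 2)) * cos th)) ->
  forall p v, TP p v -> Un_cv (fun n => RInt (fun x => p (X n x)) 0 1) v.
Proof.
intros HX HC p v H.
assert (PX : forall q w n, TP q w -> pw 0 1 (fun x => q (X n x))).
{ intros. apply pw_comp; auto. eapply TP_cont; eauto. }
induction H as [l th|p v q w H1 I1 H2 I2|k p v H I].
- apply HC.
- apply (Un_cv_ext (fun n => RInt (fun x => p (X n x)) 0 1 + RInt (fun x => q (X n x)) 0 1)).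
  { intros n. symmetry. apply RInt_add; apply pw_ex; eauto. }
  now apply CV_plus.
- apply (Un_cv_ext (fun n => k * RInt (fun x => p (X n x)) 0 1)).
  { intros n. symmetry. apply RInt_mull; apply pw_ex; eauto. }
  apply (CV_mult (fun _ => k)); auto. intros e He. exists 0%nat. intros. unfold Rdist. rewrite Rminus_diag, Rabs_R0. lra.
Qed.

Lemma bernoulli_sub x m : 0 <= x <= 1 -> 1 - INR m * x <= (1 - x) ^ m <= 1 /\ (1 - x) ^ m * (1 + INR m * x) <= 1.
Proof.
intros Hx. induction m as [|m [[I1 I2] I3]]. simpl; lra.
rewrite S_INR. simpl. pose proof (pos_INR m). assert (0 <= (1 - x) ^ m) by (apply pow_le; lra).
assert (0 <= INR m * x) by nra. split. split; nra.
assert ((1 - x) * (1 + (INR m + 1) * x) <= 1 + INR m * x) by nra. nra.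
Qed.

(** The polynomial [(1 - y^n)^m] known from elementary proofs of the Stone-Weierstrass theorem, with
    a trigonometric [y] increasing from 0 to 1 on [-R0,R0]. Being periodic, [y] cannot separate
    beyond that interval, so there only the bounds 0 and 1 are claimed. *)
Lemma separation R0 u v e : - R0 < u -> u < v -> v < R0 -> 0 < e < 1 ->
  exists p w, TP p w /\ (forall x, 0 <= p x <= 1) /\ (forall x, - R0 <= x <= u -> 1 - e <= p x) /\
  (forall x, v <= x <= R0 -> p x <= e).
Proof.
intros H1 H2 H3 He. pose proof PI_RGT_0 as HP.
set (l := PI / (2 * R0)).
assert (Hl : 0 < l) by (apply Rdiv_lt_0_compat; lra).
assert (HlR : l * (R0 + R0) = PI) by (unfold l; field; lra).
set (y := fun x => (1 - cos (l * x + l * R0)) / 2).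
assert (yr : forall x, 0 <= y x <= 1) by (intros x; unfold y; pose proof (COS_bound (l * x + l * R0)); lra).
assert (ym : forall x x', - R0 <= x -> x < x' -> x' <= R0 -> y x < y x').
{ intros. unfold y. assert (cos (l * x' + l * R0) < cos (l * x + l * R0)); [|lra].
  apply cos_decreasing_1; nra. }
set (a := y u). set (b := y v).
assert (Ha : 0 < a). { unfold a. pose proof (ym (- R0) u). pose proof (yr (- R0)). lra. }
assert (Hab : a < b) by (apply ym; lra). assert (Hb : b <= 1) by apply yr.
(* [n] makes [(a/b)^n] small, and [m] lies between [c] and [2 c] with [c = 1 / (e b^n)]. Then
   [m a^n <= e], so the power stays near 1 up to [u], and [m b^n >= 1/e], so it is at most [e] from
   [v] on. *)
destruct (pow_lt_1_zero (a / b) ltac:(rewrite Rabs_pos_eq; [apply Rlt_div_l; lra|left; apply Rdiv_lt_0_compat; lra]) (e ^ 2 / 2) ltac:(nra)) as (n & Kn).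
specialize (Kn n ltac:(lia)). rewrite Rabs_pos_eq in Kn by (apply pow_le; left; apply Rdiv_lt_0_compat; lra).
assert (Bn : 0 < b ^ n) by (apply pow_lt; lra).
assert (Bn1 : b ^ n <= 1). { rewrite <- (pow1 n). apply pow_incr. lra. }
assert (Eab : (a / b) ^ n * b ^ n = a ^ n). { rewrite <- Rpow_mult_distr. f_equal. field; lra. }
set (c := / (e * b ^ n)).
assert (Hc : 1 <= c). { unfold c. rewrite <- Rinv_1. apply Rinv_le_contravar; nra. }
destruct (nfloor_ex c ltac:(lra)) as (m0 & M1 & M2). set (m := S m0).
assert (HM : c <= INR m <= 2 * c) by (unfold m; rewrite S_INR; lra).
assert (HcB : c * (e * b ^ n) = 1) by (unfold c; field; split; lra).
assert (exists w0, TP y w0).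
{ destruct TP_one as (w1 & T1). eexists. eapply TP_eq.
  apply (TP_plus _ _ _ _ (TP_scal (1/2) _ _ T1) (TP_scal (-1/2) _ _ (TP_cos l (l * R0)))).
  intros x; unfold y; simpl; field. }
destruct H as (w0 & Ty). destruct (TP_pow y w0 n Ty) as (w1 & Tn). destruct TP_one as (w2 & T1).
destruct (TP_pow (fun x => 1 - y x ^ n) (w2 + -1 * w1) m) as (w3 & T3).
{ eapply TP_eq. apply (TP_plus _ _ _ _ T1 (TP_scal (-1) _ _ Tn)). intros; simpl; ring. }
assert (yn : forall x, 0 <= y x ^ n <= 1).
{ intros x. split. apply pow_le, yr. rewrite <- (pow1 n). apply pow_incr, yr. }
exists (fun x => (1 - y x ^ n) ^ m), w3. split; [auto|]. split; [|split].
- intros x. split. apply pow_le. specialize (yn x); lra. apply (bernoulli_sub _ m (yn x)).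
- intros x Hx. destruct (bernoulli_sub _ m (yn x)) as [[B1 _] _].
  assert (y x <= a). { destruct (Req_dec x u) as [->|]; [apply Rle_refl|]. left; apply ym; lra. }
  assert (y x ^ n <= a ^ n) by (apply pow_incr; split; auto; apply yr).
  assert (INR m * y x ^ n <= 2 * c * a ^ n). { apply Rmult_le_compat; [apply pos_INR|apply yn|lra|auto]. }
  assert (2 * c * a ^ n <= e).
  { rewrite <- Eab. apply Rle_trans with (2 * c * (e ^ 2 / 2 * b ^ n)).
    apply Rmult_le_compat_l. lra. apply Rmult_le_compat_r; lra.
    replace (2 * c * (e ^ 2 / 2 * b ^ n)) with (e * (c * (e * b ^ n))) by field. rewrite HcB; lra. }
  lra.
- intros x Hx. destruct (bernoulli_sub _ m (yn x)) as [_ B2].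
  assert (b <= y x). { destruct (Req_dec x v) as [->|]; [apply Rle_refl|]. left; apply ym; lra. }
  assert (b ^ n <= y x ^ n) by (apply pow_incr; lra).
  assert (c * b ^ n <= INR m * y x ^ n) by (apply Rmult_le_compat; lra).
  assert (0 <= (1 - y x ^ n) ^ m) by (apply pow_le; specialize (yn x); lra).
  set (z := (1 - y x ^ n) ^ m) in *.
  assert (1 <= e * (1 + INR m * y x ^ n)) by nra.
  assert (z <= e * (z * (1 + INR m * y x ^ n))) by nra. nra.
Qed.

(** * Lebesgue outer measure and Riemann integrals *)

(** Cousin's lemma, by a supremum argument; it takes the place of extracting finite subcovers
    below. *)
Lemma cousin (Q : R -> R -> Prop) a b : a < b ->
  (forall c e d, a <= c -> c < e -> e < d -> d <= b -> Q c e -> Q e d -> Q c d) ->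
  (forall x, a <= x <= b -> exists del, 0 < del /\
     forall c d, a <= c -> c <= x -> x <= d -> d <= b -> c < d -> d - c < del -> Q c d) ->
  Q a b.
Proof.
intros Hab Hadd Hloc.
set (S := fun y => a < y <= b /\ Q a y).
destruct (Hloc a ltac:(lra)) as (d0 & Hd0 & L0).
set (y0 := Rmin b (a + d0 / 2)).
assert (Y0 : a < y0) by (apply Rmin_glb_lt; lra).
assert (Y0b : y0 <= b) by apply Rmin_l. assert (Y0d : y0 <= a + d0 / 2) by apply Rmin_r.
assert (S0 : S y0). { split. lra. apply L0; lra. }
destruct (completeness S) as (s & Hs1 & Hs2).
{ exists b. intros y Hy. apply Hy. }
{ exists y0. auto. }
assert (Hs : a < s <= b). { split. apply Rlt_le_trans with y0; auto. apply Hs2. intros y Hy; apply Hy. }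
destruct (Hloc s ltac:(lra)) as (d & Hd & Ld).
assert (Qs : Q a s).
{ assert (exists y, S y /\ s - d < y) as (y & Sy & Hy).
  { apply NNPP. intros N. assert (s <= s - d); [|lra]. apply Hs2. intros y Hy.
    apply Rnot_lt_le. intros K. apply N. exists y; auto. }
  pose proof (Hs1 y Sy) as Hys. destruct Sy as [Hy1 Hy2].
  destruct (Req_dec y s) as [->|Ne]; auto.
  apply (Hadd a y s); try lra. auto. apply Ld; lra. }
destruct (Req_dec s b) as [->|Ne]; auto.
exfalso. set (z := Rmin b (s + d / 2)).
assert (Z1 : s < z) by (apply Rmin_glb_lt; lra).
assert (Z2 : z <= b) by apply Rmin_l. assert (Z3 : z <= s + d / 2) by apply Rmin_r.
assert (S z). { split. lra. apply (Hadd a s z); try lra. auto. apply Ld; lra. }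
specialize (Hs1 z H). lra.
Qed.

Definition overlap (a b c d : R) : R := Rmax 0 (Rmin b d - Rmax a c).

Lemma overlap_nonneg a b c d : 0 <= overlap a b c d.
Proof. apply Rmax_l. Qed.

Lemma overlap_cat a b c e d : c <= e <= d -> overlap a b c e + overlap a b e d <= overlap a b c d.
Proof. intros. unfold overlap, Rmax, Rmin. repeat destruct Rle_dec; lra. Qed.

Lemma overlap_mono a b c d c' d' : c <= c' -> d' <= d -> overlap a b c' d' <= overlap a b c d.
Proof. intros. unfold overlap, Rmax, Rmin. repeat destruct Rle_dec; lra. Qed.

Lemma overlap_le a b c d : a <= b -> overlap a b c d <= b - a.
Proof. intros. unfold overlap, Rmax, Rmin. repeat destruct Rle_dec; lra. Qed.

Lemma overlap_full a b c d : a <= c -> d <= b -> c <= d -> overlap a b c d = d - c.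
Proof. intros. unfold overlap, Rmax, Rmin. repeat destruct Rle_dec; lra. Qed.

Lemma sum_term_le (f : nat -> R) n : (forall k, 0 <= f k) -> forall m, (n <= m)%nat -> f n <= sum_f_R0 f m.
Proof.
intros Hf. induction m; intros H.
- replace n with 0%nat by lia. simpl. lra.
- simpl. destruct (Nat.eq_dec n (S m)) as [->|N].
  + pose proof (cond_pos_sum f m Hf). lra.
  + specialize (IHm ltac:(lia)). specialize (Hf (S m)). lra.
Qed.

Section Cover.
Variables u v : nat -> R.
Hypothesis Huv : forall n, u n <= v n.
Definition osum (c d : R) (M : nat) : R := sum_f_R0 (fun n => overlap (u n) (v n) c d) M.

Lemma osum_cat c e d M : c <= e <= d -> osum c e M + osum e d M <= osum c d M.
Proof.
intros H. unfold osum. rewrite <- plus_sum. apply sum_Rle. intros; now apply overlap_cat.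
Qed.

Lemma osum_nonneg c d M : 0 <= osum c d M.
Proof. apply cond_pos_sum. intros; apply overlap_nonneg. Qed.

(** Near a point with [f <= 0] the integral is negligible; near any other point a single interval of
    the cover contains the whole neighbourhood, and [f <= 1]. Asking for the bound from some [N] on
    makes it additive, as [cousin] requires. *)
Lemma cover_cont f a b e : cont f -> a < b -> 0 < e -> (forall x, a <= x <= b -> f x <= 1) ->
  (forall x, a <= x <= b -> f x <= 0 \/ exists n, u n < x < v n) ->
  exists N, forall M, (N <= M)%nat -> RInt f a b <= osum a b M + e * (b - a).
Proof.
intros Hf Hab He H1 H2.
apply (cousin (fun c d => exists N, forall M, (N <= M)%nat -> RInt f c d <= osum c d M + e * (d - c))); auto.
- intros c x d _ Hcx Hxd _ (N1 & K1) (N2 & K2). exists (N1 + N2)%nat. intros M HM.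
  specialize (K1 M ltac:(lia)). specialize (K2 M ltac:(lia)).
  pose proof (osum_cat c x d M ltac:(lra)). rewrite <- (RInt_cat f c x d) by auto with cdb. lra.
- intros x Hx. destruct (H2 x Hx) as [L|(n & Hn)].
  + destruct (cont_at f x e Hf He) as (del & Hdel & K). exists del. split; auto.
    intros c d Hc Hcx Hxd Hd Hcd Hs. exists 0%nat. intros M _. pose proof (osum_nonneg c d M).
    assert (RInt f c d <= (d - c) * e); [|lra].
    apply RInt_upper; auto with cdb; try lra. intros y Hy.
    specialize (K y ltac:(apply Rabs_def1; lra)). apply Rabs_def2 in K. lra.
  + exists (Rmin (x - u n) (v n - x)). split. apply Rmin_glb_lt; lra.
    intros c d Hc Hcx Hxd Hd Hcd Hs. exists n. intros M HM.
    assert (d - c < x - u n) by (apply Rlt_le_trans with (1 := Hs), Rmin_l).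
    assert (d - c < v n - x) by (apply Rlt_le_trans with (1 := Hs), Rmin_r).
    assert (RInt f c d <= (d - c) * 1).
    { apply RInt_upper; auto with cdb; try lra. intros y Hy. apply H1; lra. }
    pose proof (sum_term_le (fun n => overlap (u n) (v n) c d) n (fun k => overlap_nonneg _ _ _ _) M HM) as S.
    simpl in S. rewrite overlap_full in S by lra. fold (osum c d M) in S.
    assert (0 <= e * (d - c)) by (apply Rmult_le_pos; lra). lra.
Qed.

Lemma cover_pw a b G : pw a b G -> forall e, 0 < e -> (forall x, a < x < b -> G x <= 1) ->
  (forall x, a < x < b -> G x <= 0 \/ exists n, u n < x < v n) ->
  exists N, forall M, (N <= M)%nat -> RInt G a b <= osum a b M + e.
Proof.
induction 1 as [a b f F L C E|a c b F H1 I1 H2 I2]; intros e He HG HC.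
(* The hypotheses hold only inside the piece, so a margin [eta] is cut off at both ends, where
   [F <= 1] bounds the loss. *)
- set (eta := Rmin (e / 4) ((b - a) / 4)).
  assert (Heta : 0 < eta) by (apply Rmin_glb_lt; lra).
  assert (E1 : eta <= e / 4) by apply Rmin_l. assert (E2 : eta <= (b - a) / 4) by apply Rmin_r.
  destruct (cover_cont f (a + eta) (b - eta) (e / (2 * (b - a))) C) as (N & K); try lra.
  { apply Rdiv_lt_0_compat; lra. }
  { intros x Hx. rewrite <- E by lra. apply HG; lra. }
  { intros x Hx. rewrite <- E by lra. apply HC; lra. }
  exists N. intros M HM. specialize (K M HM).
  rewrite (RInt_eq F f) by (auto; lra).
  rewrite <- (RInt_cat f a (a + eta) b), <- (RInt_cat f (a + eta) (b - eta) b) by auto with cdb.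
  assert (RInt f a (a + eta) <= (a + eta - a) * 1).
  { apply RInt_upper; auto with cdb; try lra. intros; rewrite <- E by lra; apply HG; lra. }
  assert (RInt f (b - eta) b <= (b - (b - eta)) * 1).
  { apply RInt_upper; auto with cdb; try lra. intros; rewrite <- E by lra; apply HG; lra. }
  assert (osum (a + eta) (b - eta) M <= osum a b M).
  { apply sum_Rle. intros; apply overlap_mono; lra. }
  assert (e / (2 * (b - a)) * (b - eta - (a + eta)) <= e / 2).
  { replace (e / 2) with (e / (2 * (b - a)) * (b - a)) by (field; lra).
    apply Rmult_le_compat_l. left; apply Rdiv_lt_0_compat; lra. lra. }
  lra.
- pose proof (pw_lt _ _ _ H1). pose proof (pw_lt _ _ _ H2).
  destruct (I1 (e / 2)) as (N1 & K1); try lra; try (intros; apply HG || apply HC; lra).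
  destruct (I2 (e / 2)) as (N2 & K2); try lra; try (intros; apply HG || apply HC; lra).
  exists (N1 + N2)%nat. intros M HM. specialize (K1 M ltac:(lia)). specialize (K2 M ltac:(lia)).
  rewrite <- (RInt_cat F a c b) by auto with cdb. pose proof (osum_cat a c b M ltac:(lra)). lra.
Qed.
End Cover.

(** [G] lies below the indicator of [A] on (0,1), so its integral is at most the total length of any
    cover of [A]. *)
Lemma outer_lower (A : R -> Prop) G v : pw 0 1 G -> (forall x, 0 < x < 1 -> G x <= 1) ->
  (forall x, 0 < x < 1 -> ~ A x -> G x <= 0) -> lebesgue_outer_is A v -> RInt G 0 1 <= v.
Proof.
intros HG H1 H2 [_ Hv]. apply Hv. intros s (a & b & Hab & HA & Hs).
apply le_epsilon. intros e He.
destruct (cover_pw a b 0 1 G HG e He H1) as (N & K).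
{ intros x Hx. destruct (classic (A x)) as [Ax|Ax]; auto. }
specialize (K N (Nat.le_refl _)).
assert (osum a b 0 1 N <= sum_f_R0 (fun n => b n - a n) N).
{ apply sum_Rle. intros; apply overlap_le; auto. }
assert (sum_f_R0 (fun n => b n - a n) N <= s).
{ apply sum_incr; auto. intros n; specialize (Hab n); lra. }
lra.
Qed.

Definition good (l : list (R * R)) : Prop := forall p, In p l -> fst p <= snd p.
Definition covers (l : list (R * R)) (A : R -> Prop) : Prop :=
  forall x, A x -> exists p, In p l /\ fst p < x < snd p.
Fixpoint len (l : list (R * R)) : R :=
  match l with nil => 0 | p :: l => (snd p - fst p) + len l end.

Lemma len_app l1 l2 : len (l1 ++ l2) = len l1 + len l2.
Proof. induction l1; simpl; lra. Qed.

Lemma good_app l1 l2 : good l1 -> good l2 -> good (l1 ++ l2).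
Proof. intros G1 G2 p H. apply in_app_or in H. destruct H; auto. Qed.

(** The list is continued by the empty interval [(0, 0)], which changes neither the covered points
    nor the total length. *)
Lemma list_cover l A : good l -> covers l A -> cover_length A (len l).
Proof.
intros G C.
exists (fun n => fst (nth n l (0, 0))), (fun n => snd (nth n l (0, 0))). split; [|split].
- intros n. destruct (nth_in_or_default n l (0, 0)) as [H| ->]; auto. simpl; lra.
- intros x Hx. destruct (C x Hx) as (p & Hp & K). destruct (In_nth l p (0, 0) Hp) as (n & _ & E).
  exists n. now rewrite E.
- assert (Q : forall m, (length l <= m)%nat -> sum_f_R0 (fun n => snd (nth n l (0, 0)) - fst (nth n l (0, 0))) m = len l).
  { clear G C. induction l as [|p l IH]; intros m Hm.
    - simpl len. induction m; simpl; try lra. simpl in IHm. rewrite IHm; [|simpl; lia]. lra.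
    - destruct m as [|m]; [simpl in Hm; lia|]. rewrite decomp_sum by lia. simpl pred.
      simpl len. simpl nth at 1 2. f_equal. apply IH. simpl in Hm; lia. }
  intros e He. exists (length l). intros m Hm. rewrite Q by lia. unfold Rdist. rewrite Rminus_diag, Rabs_R0; lra.
Qed.

Lemma fcover_cont f a b e : cont f -> a < b -> 0 < e < 1 -> (forall x, a < x < b -> 0 <= f x) ->
  exists l, good l /\ covers l (fun x => a <= x <= b /\ 1 <= f x) /\ len l <= RInt f a b + e * (b - a).
Proof.
intros Hf Hab He H0.
apply (cousin (fun c d => exists l, good l /\ covers l (fun x => c <= x <= d /\ 1 <= f x) /\ len l <= RInt f c d + e * (d - c))); auto.
- intros c x d _ Hcx Hxd _ (l1 & G1 & C1 & L1) (l2 & G2 & C2 & L2). exists (l1 ++ l2).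
  split; [now apply good_app|]. split.
  + intros y [Hy Fy]. destruct (Rle_dec y x).
    * destruct (C1 y) as (p & I & K). split; auto; lra. exists p. split; auto. apply in_or_app; auto.
    * destruct (C2 y) as (p & I & K). split; auto; lra. exists p. split; auto. apply in_or_app; auto.
  + rewrite len_app, <- (RInt_cat f c x d) by auto with cdb. lra.
- intros x Hx. destruct (Rlt_dec (f x) 1) as [L|L].
  + destruct (cont_at f x (1 - f x) Hf ltac:(lra)) as (del & Hdel & K). exists del. split; auto.
    intros c d Hc Hcx Hxd Hd Hcd Hs. exists nil. split; [intros p Hp; destruct Hp|]. split.
    * intros y [Hy Fy]. specialize (K y ltac:(apply Rabs_def1; lra)). apply Rabs_def2 in K. lra.
    * simpl. assert (0 <= RInt f c d). { apply RInt_nonneg; auto with cdb. lra. intros; apply H0; lra. }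
      assert (0 <= e * (d - c)) by (apply Rmult_le_pos; lra). lra.
  + destruct (cont_at f x (e / 2) Hf ltac:(lra)) as (del & Hdel & K). exists del. split; auto.
    intros c d Hc Hcx Hxd Hd Hcd Hs. set (eta := e * (d - c) / 4).
    assert (0 < eta). { apply Rdiv_lt_0_compat; [apply Rmult_lt_0_compat|]; lra. }
    exists ((c - eta, d + eta) :: nil). split; [|split].
    * intros p [<-|Hp]; [|destruct Hp]. simpl. lra.
    * intros y [Hy _]. exists (c - eta, d + eta). split. now left. simpl. lra.
    * simpl. assert ((d - c) * (1 - e / 2) <= RInt f c d).
      { apply RInt_lower; auto with cdb. lra. intros y Hy. specialize (K y ltac:(apply Rabs_def1; lra)). apply Rabs_def2 in K. lra. }
      unfold eta. lra.
Qed.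

Lemma fcover_pw a b F : pw a b F -> forall e, 0 < e -> (forall x, a < x < b -> 0 <= F x) ->
  exists l, good l /\ covers l (fun x => a <= x <= b /\ (a < x < b -> 1 <= F x)) /\ len l <= RInt F a b + e.
Proof.
induction 1 as [a b f F L C E|a c b F H1 I1 H2 I2]; intros e He HF.
- set (eta := e / 8).
  set (k := Rmin (1/2) (e / (2 * (b - a)))).
  assert (Hk : 0 < k) by (apply Rmin_glb_lt; [|apply Rdiv_lt_0_compat]; lra).
  assert (K1 : k <= 1/2) by apply Rmin_l. assert (K2 : k <= e / (2 * (b - a))) by apply Rmin_r.
  destruct (fcover_cont f a b k C L ltac:(lra)) as (l & G & Cv & Ln).
  { intros; rewrite <- E by auto; auto. }
  (* The end points, where [F] is not controlled, get two intervals of length [e/4] each. *)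
  exists ((a - eta, a + eta) :: (b - eta, b + eta) :: l). unfold eta in *. split; [|split].
  + intros p [<-|[<-|Hp]]; simpl; try lra. auto.
  + intros x [Hx Fx]. destruct (Req_dec x a) as [->|Na].
    { eexists. split. left; reflexivity. simpl. lra. }
    destruct (Req_dec x b) as [->|Nb].
    { eexists. split. right; left; reflexivity. simpl. lra. }
    destruct (Cv x) as (p & Ip & Kp). { split; auto. rewrite <- E by lra. apply Fx; lra. }
    exists p. split; auto. right; right; auto.
  + simpl. rewrite (RInt_eq F f) by (auto; lra).
    assert (k * (b - a) <= e / 2).
    { replace (e / 2) with (e / (2 * (b - a)) * (b - a)) by (field; lra). apply Rmult_le_compat_r; lra. }
    lra.
- pose proof (pw_lt _ _ _ H1). pose proof (pw_lt _ _ _ H2).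
  destruct (I1 (e / 2)) as (l1 & G1 & C1 & L1); try lra. { intros; apply HF; lra. }
  destruct (I2 (e / 2)) as (l2 & G2 & C2 & L2); try lra. { intros; apply HF; lra. }
  exists (l1 ++ l2). split; [now apply good_app|]. split.
  + intros x [Hx Fx]. destruct (Rle_dec x c).
    * destruct (C1 x) as (p & I & K). split. lra. intros; apply Fx; lra. exists p. split; auto. apply in_or_app; auto.
    * destruct (C2 x) as (p & I & K). split. lra. intros; apply Fx; lra. exists p. split; auto. apply in_or_app; auto.
  + rewrite len_app, <- (RInt_cat F a c b) by auto with cdb. lra.
Qed.

Lemma outer_upper (A : R -> Prop) F v : pw 0 1 F -> (forall x, 0 < x < 1 -> 0 <= F x) ->
  (forall x, A x -> 0 <= x <= 1 /\ 1 <= F x) -> lebesgue_outer_is A v -> v <= RInt F 0 1.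
Proof.
intros HF H0 HA [Hv _]. apply le_epsilon. intros e He.
destruct (fcover_pw 0 1 F HF e He H0) as (l & G & C & L).
apply Rle_trans with (2 := L). apply Hv. apply list_cover; auto.
intros x Ax. apply C. destruct (HA x Ax). split; auto.
Qed.

Lemma outer_exists (A : R -> Prop) : (forall x, A x -> 0 <= x <= 1) -> exists v, lebesgue_outer_is A v.
Proof.
intros HA.
destruct (completeness (fun y => cover_length A (- y))) as (m & Hm1 & Hm2).
- exists 0. intros y (a & b & Hab & _ & Hs).
  assert (0 <= - y); [|lra]. apply Rle_trans with (sum_f_R0 (fun n => b n - a n) 0).
  simpl. specialize (Hab 0%nat). lra. apply sum_incr; auto. intros n; specialize (Hab n); lra.
- exists (-3). replace (- -3) with (len ((-1, 2) :: nil)) by (simpl; ring). apply list_cover.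
  + intros p [<-|Hp]; [|destruct Hp]. simpl; lra.
  + intros x Hx. exists (-1, 2). split. now left. specialize (HA x Hx). simpl; lra.
- exists (- m). split.
  + intros s Hs. assert (- s <= m); [|lra]. apply Hm1. now rewrite Ropp_involutive.
  + intros w Hw. assert (m <= - w); [|lra]. apply Hm2. intros y Hy. specialize (Hw _ Hy). lra.
Qed.

(** * Convergence in distribution from trigonometric test functions *)

Lemma gd_int_le a b : a <= b -> 0 <= RInt gd a b <= b - a.
Proof.
intros H. split. apply RInt_nonneg; auto using gd_cont with cdb. intros; left; apply gd_pos.
replace (b - a) with ((b - a) * 1) by ring. apply RInt_upper; auto using gd_cont with cdb. intros; apply gd_le1.
Qed.

Lemma gd_sym A : RInt gd (- A) A = 2 * RInt gd 0 A.
Proof. pose proof gd_cont. rewrite <- (RInt_cat gd (- A) 0 A), gd_even by auto with cdb. eqR; ring. Qed.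

(** The indicator of [X n <= t] lies between [p' (X n) - e - X^2 / R0^2] and
    [p (X n) + e + X^2 / R0^2]. The quadratic term is Chebyshev's inequality: it takes over where
    [|X n| > R0] and periodic functions no longer follow the indicator, and the second moment bound
    makes its mean at most [1 / R0^2]. *)
Lemma clt_of_trig (X : nat -> R -> R) (mu : nat -> R) t :
  (forall n, pw 0 1 (X n)) ->
  (forall l th, Un_cv (fun n => RInt (fun x => cos (l * X n x + th)) 0 1) (exp (- (l ^ 2 / 2)) * cos th)) ->
  (exists N, forall n, (N <= n)%nat -> RInt (fun x => X n x ^ 2) 0 1 <= 1) ->
  (forall n, lebesgue_outer_is (fun x => 0 <= x <= 1 /\ X n x <= t) (mu n)) ->
  Un_cv mu (1/2 + / sqrt (2 * PI) * RInt gd 0 t).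
Proof.
intros HX HC (N0 & HV) Hmu eps Heps.
pose proof gd_cont as cg.
set (e := Rmin (1/4) (eps / 20)).
assert (He : 0 < e) by (apply Rmin_glb_lt; lra).
assert (He1 : e <= 1/4) by apply Rmin_l. assert (He2 : e <= eps / 20) by apply Rmin_r.
set (c0 := sqrt (2 * PI)) in *.
assert (Hc0 : 1 <= c0).
{ unfold c0. rewrite <- sqrt_1. apply sqrt_le_1_alt. pose proof PI2_1. lra. }
destruct (gauss_full e He) as (R1 & HR1 & GF). fold c0 in GF.
pose proof (Rabs_pos t) as Pt. pose proof (Rle_abs t) as T1. pose proof (Rle_abs (- t)) as T2. rewrite Rabs_Ropp in T2.
assert (ie : 0 < / e) by (apply Rinv_0_lt_compat; lra).
assert (ie1 : 1 <= / e). { rewrite <- Rinv_1. apply Rinv_le_contravar; lra. }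
(* Large enough for the Gaussian tails, for [t - e] and [t + e] to lie inside, and for
   [1 / R0^2 <= e]. *)
set (R0 := R1 + Rabs t + 1 + / e).
assert (HR0 : 0 < R0) by (unfold R0; lra).
assert (R2 : / R0 ^ 2 <= e).
{ rewrite <- (Rinv_inv e). apply Rinv_le_contravar; auto. unfold R0. nra. }
assert (iR : 0 < / R0 ^ 2) by (apply Rinv_0_lt_compat, pow_lt; auto).
(* [p] drops to the right of [t] and serves from above, [p'] drops to the left of [t] and serves
   from below. *)
destruct (separation R0 t (t + e) e ltac:(unfold R0; lra) ltac:(lra) ltac:(unfold R0; lra) ltac:(lra)) as (p & w & Tp & P1 & P2 & P3).
destruct (separation R0 (t - e) t e ltac:(unfold R0; lra) ltac:(lra) ltac:(unfold R0; lra) ltac:(lra)) as (p' & w' & Tp' & P1' & P2' & P3').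
destruct (TP_gauss p w Tp e He) as (A1 & HA1 & GA). destruct (TP_gauss p' w' Tp' e He) as (A2 & HA2 & GA').
fold c0 in GA, GA'.
set (A := R0 + A1 + A2).
assert (HAR : R0 <= A) by (unfold A; lra).
specialize (GA A ltac:(unfold A; lra)). specialize (GA' A ltac:(unfold A; lra)).
pose proof (GF A ltac:(unfold A, R0; lra)) as GFA. pose proof (GF R0 ltac:(unfold R0; lra)) as GFR.
rewrite gd_sym in GFA, GFR.
apply Rabs_le_between in GA, GA', GFA, GFR.
pose proof (TP_cont _ _ Tp) as cp. pose proof (TP_cont _ _ Tp') as cp'.
assert (cpg : cont (fun s => p s * gd s)) by auto with cdb.
assert (cpg' : cont (fun s => p' s * gd s)) by auto with cdb.
set (gt := RInt gd 0 t).
assert (CUT : forall a, RInt gd (- a) t = RInt gd 0 a + gt).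
{ intros a. rewrite <- (RInt_cat gd (- a) 0 t), gd_even by auto with cdb. reflexivity. }
(* The Gaussian expectation of [p] is compared with the mass below [t + e]; from there to [R0] one
   has [p <= e], and the tail past [R0] is small. *)
assert (W1 : c0 * w <= c0 / 2 + gt + e * (c0 + 5)).
{ assert (B1 : RInt (fun s => p s * gd s) (- A) (t + e) <= RInt gd (- A) (t + e)).
  { apply RInt_le; auto with cdb. unfold A, R0; lra. intros s _. pose proof (P1 s). pose proof (gd_pos s). nra. }
  assert (B2 : RInt (fun s => p s * gd s) (t + e) R0 <= e * RInt gd (t + e) R0).
  { rewrite <- RInt_mull by auto with cdb. apply RInt_le; auto with cdb. unfold R0; lra.
    intros s Hs. pose proof (P3 s ltac:(lra)). pose proof (gd_pos s). nra. }
  assert (B3 : RInt (fun s => p s * gd s) R0 A <= RInt gd R0 A).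
  { apply RInt_le; auto with cdb. intros s _. pose proof (P1 s). pose proof (gd_pos s). nra. }
  pose proof (RInt_cat _ (- A) (t + e) A (cont_ex _ _ _ cpg) (cont_ex _ _ _ cpg)) as S1.
  pose proof (RInt_cat _ (t + e) R0 A (cont_ex _ _ _ cpg) (cont_ex _ _ _ cpg)) as S2.
  pose proof (RInt_cat gd (- A) t (t + e) (cont_ex _ _ _ cg) (cont_ex _ _ _ cg)) as S3.
  pose proof (RInt_cat gd 0 R0 A (cont_ex _ _ _ cg) (cont_ex _ _ _ cg)) as S4.
  pose proof (RInt_cat gd (- R0) (t + e) R0 (cont_ex _ _ _ cg) (cont_ex _ _ _ cg)) as S5.
  rewrite gd_sym in S5. rewrite CUT in S3.
  pose proof (gd_int_le t (t + e) ltac:(lra)). pose proof (gd_int_le (- R0) (t + e) ltac:(unfold R0; lra)).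
  assert (e * RInt gd (t + e) R0 <= e * (c0 + 1)) by (apply Rmult_le_compat_l; lra).
  cbv beta in *. lra. }
assert (W2 : c0 / 2 + gt - e * (c0 + 5) <= c0 * w').
{ assert (B1 : (1 - e) * RInt gd (- R0) (t - e) <= RInt (fun s => p' s * gd s) (- R0) (t - e)).
  { rewrite <- RInt_mull by auto with cdb. apply RInt_le; auto with cdb. unfold R0; lra.
    intros s Hs. pose proof (P2' s ltac:(lra)). pose proof (gd_pos s). nra. }
  assert (NN : forall a b, a <= b -> 0 <= RInt (fun s => p' s * gd s) a b).
  { intros. apply RInt_nonneg; auto with cdb. intros s _. pose proof (P1' s). pose proof (gd_pos s). nra. }
  pose proof (NN (- A) (- R0) ltac:(lra)). pose proof (NN (t - e) A ltac:(unfold A, R0; lra)).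
  pose proof (RInt_cat _ (- A) (- R0) A (cont_ex _ _ _ cpg') (cont_ex _ _ _ cpg')) as S1.
  pose proof (RInt_cat _ (- R0) (t - e) A (cont_ex _ _ _ cpg') (cont_ex _ _ _ cpg')) as S2.
  pose proof (RInt_cat gd (- R0) (t - e) t (cont_ex _ _ _ cg) (cont_ex _ _ _ cg)) as S3.
  pose proof (RInt_cat gd (- R0) (t - e) R0 (cont_ex _ _ _ cg) (cont_ex _ _ _ cg)) as S5.
  rewrite gd_sym in S5. rewrite CUT in S3.
  pose proof (gd_int_le (t - e) t ltac:(lra)). pose proof (gd_int_le (t - e) R0 ltac:(unfold R0; lra)).
  assert (e * RInt gd (- R0) (t - e) <= e * (c0 + 1)) by (apply Rmult_le_compat_l; lra).
  cbv beta in *. lra. }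
assert (ic : 0 < / c0 <= 1).
{ split. apply Rinv_0_lt_compat; lra. rewrite <- Rinv_1. apply Rinv_le_contravar; lra. }
assert (ec : / c0 * (e * (c0 + 5)) <= 6 * e).
{ replace (/ c0 * (e * (c0 + 5))) with (e + 5 * e * / c0) by (field; lra). nra. }
assert (W1' : w <= 1/2 + / c0 * gt + 6 * e).
{ apply (Rmult_le_compat_l (/ c0)) in W1; [|lra].
  replace (/ c0 * (c0 * w)) with w in W1 by (field; lra).
  replace (/ c0 * (c0 / 2 + gt + e * (c0 + 5))) with (1/2 + / c0 * gt + / c0 * (e * (c0 + 5))) in W1 by (field; lra). lra. }
assert (W2' : 1/2 + / c0 * gt - 6 * e <= w').
{ apply (Rmult_le_compat_l (/ c0)) in W2; [|lra].
  replace (/ c0 * (c0 * w')) with w' in W2 by (field; lra).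
  replace (/ c0 * (c0 / 2 + gt - e * (c0 + 5))) with (1/2 + / c0 * gt - / c0 * (e * (c0 + 5))) in W2 by (field; lra). lra. }
destruct (TP_limit X HX HC p w Tp e He) as (N1 & K1). destruct (TP_limit X HX HC p' w' Tp' e He) as (N2 & K2).
exists (N0 + N1 + N2)%nat. intros n Hn. specialize (K1 n ltac:(lia)). specialize (K2 n ltac:(lia)). specialize (HV n ltac:(lia)).
specialize (Hmu n). specialize (HX n).
unfold Rdist in *. apply Rabs_def2 in K1. apply Rabs_def2 in K2.
assert (pX : pw 0 1 (fun x => p (X n x))) by (apply pw_comp; auto).
assert (pX' : pw 0 1 (fun x => p' (X n x))) by (apply pw_comp; auto).
assert (pX2 : pw 0 1 (fun x => / R0 ^ 2 * X n x ^ 2)) by (apply pw_mult; [apply pw_cst|auto with cdb]).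
assert (pe : pw 0 1 (fun _ => e)) by apply pw_cst.
assert (X2 : forall x, R0 < Rabs (X n x) -> 1 <= / R0 ^ 2 * X n x ^ 2).
{ intros x H. rewrite <- (pow2_abs (X n x)).
  replace 1 with (/ R0 ^ 2 * R0 ^ 2) by (field; lra). apply Rmult_le_compat_l. lra. apply pow_incr; lra. }
assert (X0 : forall x, 0 <= / R0 ^ 2 * X n x ^ 2) by (intros x; apply Rmult_le_pos; [lra|apply pow2_ge_0]).
assert (EV : / R0 ^ 2 * RInt (fun x => X n x ^ 2) 0 1 <= e).
{ assert (/ R0 ^ 2 * RInt (fun x => X n x ^ 2) 0 1 <= / R0 ^ 2 * 1) by (apply Rmult_le_compat_l; lra). lra. }
assert (UP : mu n <= RInt (fun x => p (X n x) + e + / R0 ^ 2 * X n x ^ 2) 0 1).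
{ apply (outer_upper (fun x => 0 <= x <= 1 /\ X n x <= t)); auto with cdb.
  - intros x _. pose proof (P1 (X n x)). pose proof (X0 x). lra.
  - intros x [Hx Ht]. split; auto. pose proof (P1 (X n x)). pose proof (X0 x).
    destruct (Rle_dec (Rabs (X n x)) R0) as [L|L].
    + apply Rabs_le_between in L. pose proof (P2 (X n x) ltac:(lra)). lra.
    + pose proof (X2 x ltac:(lra)). lra. }
assert (LO : RInt (fun x => p' (X n x) - e - / R0 ^ 2 * X n x ^ 2) 0 1 <= mu n).
{ apply (outer_lower (fun x => 0 <= x <= 1 /\ X n x <= t)); auto with cdb.
  - intros x _. pose proof (P1' (X n x)). pose proof (X0 x). lra.
  - intros x Hx Ht. pose proof (P1' (X n x)). pose proof (X0 x).
    assert (t < X n x). { apply Rnot_le_lt. intros H1. apply Ht. split; auto; lra. }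
    destruct (Rle_dec (Rabs (X n x)) R0) as [L|L].
    + apply Rabs_le_between in L. pose proof (P3' (X n x) ltac:(lra)). lra.
    + pose proof (X2 x ltac:(lra)). lra. }
rewrite !RInt_add, RInt_cst, RInt_mull in UP by auto with cdb.
rewrite !RInt_sub, RInt_cst, RInt_mull in LO by auto with cdb.
apply Rabs_def1; lra.
Qed.

(** * Smooth observables on the closed interval, and assembly *)

Lemma C1_bounded_lipschitz phi : C1_01 phi -> exists L, 0 < L /\
  (forall x, 0 <= x <= 1 -> Rabs (phi x) <= L) /\
  (forall x y, 0 <= x <= 1 -> 0 <= y <= 1 -> Rabs (phi x - phi y) <= L * Rabs (x - y)).
Proof.
intros (dphi & D1 & D2).
assert (exists M, 0 <= M /\ forall y, 0 <= y <= 1 -> Rabs (dphi y) <= M) as (M & HM & KM).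
{ apply (cousin (fun c d => exists M, 0 <= M /\ forall y, c <= y <= d -> Rabs (dphi y) <= M)); try lra.
  - intros c x d _ _ _ _ (M1 & HM1 & K1) (M2 & HM2 & K2). exists (M1 + M2). split. lra.
    intros y Hy. destruct (Rle_dec y x). specialize (K1 y ltac:(lra)); lra. specialize (K2 y ltac:(lra)); lra.
  - intros x Hx. destruct (D2 x Hx 1 Rlt_0_1) as (del & Hdel & K). exists del. split; auto.
    intros c d Hc Hcx Hxd Hd Hcd Hs. exists (Rabs (dphi x) + 1). pose proof (Rabs_pos (dphi x)). split. lra.
    intros y Hy. specialize (K y). simpl in K. unfold Rdist in K.
    assert (Rabs (y - x) < del) by (apply Rabs_def1; lra).
    specialize (K ltac:(split; auto; lra)).
    replace (dphi y) with ((dphi y - dphi x) + dphi x) by ring. eapply Rle_trans; [apply Rabs_triang|]. lra. }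
set (L := M + 1).
(* Difference quotients are only known to converge within [0,1], so the Lipschitz bound is assembled
   from local ones, with [M + 1] in place of the bound [M] on the derivative. *)
assert (LIP : forall a b, 0 <= a -> a < b -> b <= 1 -> Rabs (phi b - phi a) <= L * (b - a)).
{ intros a b Ha Hab Hb. apply (cousin (fun c d => Rabs (phi d - phi c) <= L * (d - c))); auto.
  - intros c x d _ _ _ _ K1 K2. replace (phi d - phi c) with ((phi d - phi x) + (phi x - phi c)) by ring.
    eapply Rle_trans; [apply Rabs_triang|]. lra.
  - intros x Hx. destruct (D1 x ltac:(lra) 1 Rlt_0_1) as (del & Hdel & K). exists del. split; auto.
    assert (Q : forall y, 0 <= y <= 1 -> Rabs (y - x) < del -> Rabs (phi y - phi x) <= L * Rabs (y - x)).
    { intros y Hy Hyx. destruct (Req_dec y x) as [->|Ne]. rewrite !Rminus_diag, Rabs_R0. lra.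
      specialize (K y). simpl in K. unfold Rdist in K. specialize (K ltac:(split; auto)).
      specialize (KM x ltac:(lra)).
      assert (Rabs ((phi y - phi x) / (y - x)) <= L).
      { replace ((phi y - phi x) / (y - x)) with (((phi y - phi x) / (y - x) - dphi x) + dphi x) by ring.
        eapply Rle_trans; [apply Rabs_triang|]. unfold L; lra. }
      replace (phi y - phi x) with ((phi y - phi x) / (y - x) * (y - x)) by (field; lra).
      rewrite Rabs_mult. apply Rmult_le_compat_r; auto. apply Rabs_pos. }
    intros c d Hc Hcx Hxd Hd Hcd Hs.
    pose proof (Q c ltac:(lra) ltac:(apply Rabs_def1; lra)) as Q1. pose proof (Q d ltac:(lra) ltac:(apply Rabs_def1; lra)) as Q2.
    rewrite (Rabs_left1 (c - x)) in Q1 by lra. rewrite (Rabs_pos_eq (d - x)) in Q2 by lra.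
    rewrite Rabs_minus_sym in Q1.
    replace (phi d - phi c) with ((phi d - phi x) + (phi x - phi c)) by ring.
    eapply Rle_trans; [apply Rabs_triang|]. lra. }
assert (LIP2 : forall x y, 0 <= x <= 1 -> 0 <= y <= 1 -> Rabs (phi x - phi y) <= L * Rabs (x - y)).
{ intros x y Hx Hy. destruct (Rtotal_order x y) as [H|[->|H]].
  - rewrite Rabs_minus_sym, (Rabs_left (x - y)) by lra. replace (- (x - y)) with (y - x) by ring. apply LIP; lra.
  - rewrite !Rminus_diag, Rabs_R0. lra.
  - rewrite (Rabs_pos_eq (x - y)) by lra. apply LIP; lra. }
pose proof (Rabs_pos (phi 0)).
exists (L + Rabs (phi 0)). split. unfold L; lra. split.
- intros x Hx. replace (phi x) with ((phi x - phi 0) + phi 0) by ring. eapply Rle_trans; [apply Rabs_triang|].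
  specialize (LIP2 x 0 Hx ltac:(lra)). rewrite Rminus_0_r, (Rabs_pos_eq x) in LIP2 by lra.
  assert (L * x <= L) by (unfold L; nra). lra.
- intros x y Hx Hy. specialize (LIP2 x y Hx Hy). pose proof (Rabs_pos (x - y)). nra.
Qed.

Lemma outer_iff A B v : (forall x, A x <-> B x) -> lebesgue_outer_is A v -> lebesgue_outer_is B v.
Proof.
intros H [H1 H2].
assert (T : forall s, cover_length A s <-> cover_length B s).
{ intros s; split; intros (a & b & Hab & C & S); exists a, b; repeat split; auto; intros x Hx; apply C, H; auto. }
split. intros s Hs; apply H1, T, Hs. intros w Hw; apply H2; intros s Hs; apply Hw, T, Hs.
Qed.

Theorem mainTheorem9 (alpha : R) (beta : nat -> R) (phi : R -> R) (c b : R) :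
  0 < alpha < 1 / 9 ->
  (forall k, (1 <= k)%nat -> 0 < beta k <= alpha) ->
  C1_01 phi ->
  c > 0 ->
  b > 1 / (2 * (1 - 2 * alpha)) ->
  (exists N, forall n, (N <= n)%nat ->
     sigma2 beta phi n >= c * Rpower (INR n) b) ->
  forall t, exists l, std_normal_cdf_is t l /\
    exists mu : nat -> R,
      (forall n, lebesgue_outer_is
         (fun x => 0 <= x <= 1 /\
                   Sn beta phi n x / sqrt (sigma2 beta phi n) <= t) (mu n)) /\
      Un_cv mu l.
Proof.
intros Ha Hbeta Hphi Hc Hb Hs t.
destruct (C1_bounded_lipschitz phi Hphi) as (L & HL & Lb & Ll).
(* Clamping makes the observable Lipschitz on the whole line without changing it on [0,1], where the
   orbits stay. *)
set (f := fun x => phi (cl x)).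
assert (fphi : forall x, 0 <= x <= 1 -> f x = phi x) by (intros; unfold f; rewrite cl_id; auto).
assert (fc : cont f).
{ apply cont_of_lipschitz with L. intros x y. unfold f.
  eapply Rle_trans; [apply Ll; apply cl_range|]. apply Rmult_le_compat_l. lra. apply cl_lip. }
assert (fb : forall x, 0 <= x <= 1 -> Rabs (f x) <= L) by (intros; rewrite fphi; auto).
assert (fl : forall x y, 0 <= x <= 1 -> 0 <= y <= 1 -> Rabs (f x - f y) <= L * Rabs (x - y))
  by (intros; rewrite !fphi; auto).
assert (TR : forall k x, 0 <= x <= 1 -> 0 <= Tcomp beta k x <= 1) by (intros; eapply Tcomp_range; eauto).
assert (EM : forall k, RI (fun y => phi (Tcomp beta k y)) 0 1 = mean beta f k).
{ intros k. assert (pw 0 1 (fun x => f (Tcomp beta k x))) as Hp.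
  { eapply Tcomp_pw; eauto. apply pw_cont; auto; lra. }
  assert (pw 0 1 (fun y => phi (Tcomp beta k y))) as Hp'.
  { apply (pw_ext _ _ _ _ Hp). intros; apply fphi, TR; lra. }
  rewrite RI_RInt by auto with cdb. apply RInt_eq. lra. intros; symmetry; apply fphi, TR; lra. }
assert (ES : forall n x, 0 <= x <= 1 -> Sn beta phi n x = SS beta f n x).
{ intros n x Hx. induction n. reflexivity.
  change (Sn beta phi (S n) x) with (Sn beta phi n x + phik beta phi (S n) (Tcomp beta (S n) x)).
  change (SS beta f (S n) x) with (SS beta f n x + fk beta f (S n) (Tcomp beta (S n) x)).
  rewrite IHn. unfold phik, fk. rewrite EM, (fphi (Tcomp beta (S n) x)) by (apply TR; auto). reflexivity. }
assert (pS : forall n, pw 0 1 (SS beta f n)) by (intros; eapply SS_pw; eauto).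
assert (EG : forall n, sigma2 beta phi n = sg beta f n).
{ intros n. unfold sigma2, sg. rewrite RI_RInt. apply RInt_eq. lra. intros; rewrite ES; auto; lra.
  apply pw_ex. apply (pw_ext _ _ (fun x => SS beta f n x ^ 2)). auto with cdb. intros; rewrite ES; auto; lra. }
exists (1/2 + / sqrt (2 * PI) * RInt gd 0 t). split. apply std_normal_cdf.
set (X := fun n x => SS beta f n x / sqrt (sg beta f n)).
destruct (choice (fun n v => lebesgue_outer_is (fun x => 0 <= x <= 1 /\ X n x <= t) v)) as (mu & Hmu).
{ intros n. apply outer_exists. tauto. }
exists mu. split.
- intros n. apply (outer_iff (fun x => 0 <= x <= 1 /\ X n x <= t)); auto.
  intros x. unfold X. rewrite EG. split; intros [Hx H]; (split; [auto|]); rewrite ES in * by auto; auto.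
(* [1 - 2 alpha < 1], so the assumed lower bound on [b] exceeds 1/2. *)
- assert (Hb2 : 1 / 2 < b).
  { apply Rle_lt_trans with (2 := Hb). apply (Rle_div_r (1/2)); lra. }
  assert (Hs' : exists N, forall n, (N <= n)%nat -> sg beta f n >= c * Rpower (INR n) b).
  { destruct Hs as (N & K). exists N. intros n Hn. rewrite <- EG. auto. }
  apply (clt_of_trig X); auto.
  + intros n. apply pw_mult; auto. apply pw_cst.
  + intros l th. apply (trig_clt alpha Ha beta Hbeta f L HL fc fb fl c b); auto.
  + destruct Hs' as (N & K). exists N. intros n Hn. specialize (K n Hn).
    assert (0 < sg beta f n).
    { pose proof (Rpower_pos (INR n) b). assert (0 < c * Rpower (INR n) b) by (apply Rmult_lt_0_compat; auto). lra. }
    (* Once [sigma_n^2 > 0], the second moment of the normalised sum is exactly 1. *)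
    right. unfold X. rewrite (RInt_eq _ (fun x => / sg beta f n * SS beta f n x ^ 2)); try lra.
    * rewrite RInt_mull by (apply pw_ex; auto with cdb). fold (sg beta f n). field. lra.
    * intros x _. unfold Rdiv. rewrite Rpow_mult_distr, pow_inv, pow2_sqrt by lra. ring.
Qed.
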